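(* Let $a>0$, $0<L<\infty$, $l,k\in\mathbb{N}$ with $1\le k\le 4l$, and let $f\in L^2(0,L)$. Consider the boundary value problem $$au+\sum_{j=1}^{l}(-1)^{j+1}D^{2j+1}u+u^kDu=f\quad\text{in }(0,L),$$ $$D^{i}u(0)=D^{i}u(L)=D^{l}u(L)=0,\qquad i=0,\ldots,l-1.$$ (i) (Regular case.) If $1\le k<4l$, then the problem admits at least one regular solution $u\in H^{2l+1}(0,L)$ such that $$\|u\|_{H^{2l+1}}\le \mathcal{C}\,((1+x),f^2)^{\frac12},$$ where the constant $\mathcal{C}$ depends only on $L$, $l$, $k$, $a$ and $((1+x),f^2)$. (ii) (Critical case.) If $k=4l$ and $f$ satisfies $$\|f\|<\frac{[(2l+1)(4l+2)]^{\frac{1}{4l}}\,a}{2^{\frac{1}{4l}}\,C_*},$$ where $C_*$ is the absolute constant of the Gagliardo–Nirenberg inequality recalled in the context, then the problem admits at least one regular solution $u\in H^{2l+1}(0,L)$ such that $$\|u\|_{H^{2l+1}}\le \mathcal{C}'\,((1+x),f^2)^{\frac12},$$ where the constant $\mathcal{C}'$ depends only on $L$, $l$, $a$ and $((1+x),f^2)$.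
   Context: All functions are real-valued on $(0,L)$; $D^i=d^i/dx^i$, $D=D^1$. $\|\cdot\|$, $\|\cdot\|_\infty$, $\|\cdot\|_{H^i}$ are the norms of $L^2(0,L)$, $L^\infty(0,L)$, $H^i(0,L)$, and $(\cdot,\cdot)$ is the $L^2(0,L)$ inner product, so $((1+x),f^2)=\int_0^L(1+x)f(x)^2\,dx$. A regular solution is a function $u\in H^{2l+1}(0,L)$ satisfying the differential equation (almost everywhere in $(0,L)$) and the boundary conditions. $C_*>0$ denotes an absolute constant such that the Gagliardo–Nirenberg inequality $\|v\|_\infty\le C_*\|D^lv\|^{\frac{1}{2l}}\|v\|^{1-\frac{1}{2l}}$ holds for all $v\in H_0^l(0,L)$. *)

(* Defs.v *)
From HB Require Import structures.
From mathcomp Require Import all_boot all_order all_algebra.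
From mathcomp Require Import all_classical all_reals all_analysis.

Set Implicit Arguments.
Unset Strict Implicit.
Unset Printing Implicit Defensive.

Import Order.TTheory GRing.Theory Num.Theory.
Import numFieldNormedType.Exports.

Local Open Scope classical_set_scope.
Local Open Scope ring_scope.

(* A real-valued function on (0, L) is encoded as a total function R -> R of
   which only the restriction to `]0, L[ matters; [f \_ D] is the extension of
   that restriction by zero, so that norms over (0, L) are norms over R. *)

Definition in_L2 (R : realType) (L : R) (f : R -> R) : Prop :=
  f \_ `]0, L[ \in Lfun (@lebesgue_measure R) 2%:E.

(* Only meaningful under [in_L2 L f]: [fine] sends +oo to 0. *)
Definition L2norm (R : realType) (L : R) (f : R -> R) : R :=
  fine ('N[@lebesgue_measure R]_2%:E [EFin \o (f \_ `]0, L[)]).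

Definition supnorm (R : realType) (L : R) (f : R -> R) : \bar R :=
  'N[@lebesgue_measure R]_+oo%E [EFin \o (f \_ `]0, L[)].

(* C_c^infinity(0, L) *)
Definition test_function (R : realType) (L : R) (phi : R -> R) : Prop :=
  [/\ forall (n : nat) (x : R), derivable phi^`(n)%classic x 1,
      compact (closure [set x | phi x != 0]) &
      closure [set x | phi x != 0] `<=` `]0, L[].

(* Used for [u] and [v] square integrable on (0, L); both integrands are then
   integrable. *)
Definition weak_deriv (R : realType) (L : R) (i : nat) (u v : R -> R) : Prop :=
  forall phi : R -> R, test_function L phi ->
    \int[@lebesgue_measure R]_(x in `]0, L[) (u x * phi^`(i)%classic x) =
    (-1) ^+ i * \int[@lebesgue_measure R]_(x in `]0, L[) (v x * phi x).

Definition in_H (R : realType) (L : R) (m : nat) (u : R -> R) : Prop :=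
  in_L2 L u /\
  forall i : nat, (i <= m)%N -> exists v, in_L2 L v /\ weak_deriv L i u v.

(* D^i u: a chosen representative of the square integrable weak derivative of
   order i, which is unique almost everywhere in (0, L); the default value 0 is
   never used when [in_H L i u]. *)
Definition wD (R : realType) (L : R) (i : nat) (u : R -> R) : R -> R :=
  xget (cst 0) [set v | in_L2 L v /\ weak_deriv L i u v].

Definition Hnorm (R : realType) (L : R) (m : nat) (u : R -> R) : R :=
  Num.sqrt (\sum_(0 <= i < m.+1) L2norm L (wD L i u) ^+ 2).

(* H_0^m(0, L) is the closure of C_c^infinity(0, L) in H^m(0, L). *)
Definition in_H0 (R : realType) (L : R) (m : nat) (u : R -> R) : Prop :=
  in_H L m u /\
  forall e : R, 0 < e ->
    exists phi, test_function L phi /\ Hnorm L m (u \- phi) < e.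

(* [boundary_value L g x0 y]: g agrees a.e. in (0, L) with a continuous function
   on [0, L], and this (unique) function takes the value y at x0. *)
Definition boundary_value (R : realType) (L : R) (g : R -> R) (x0 y : R)
  : Prop :=
  exists h : R -> R,
    [/\ {within `[0, L], continuous h},
        {ae @lebesgue_measure R, forall x, x \in `]0, L[ -> h x = g x} &
        h x0 = y].

Definition regular_solution (R : realType) (a L : R) (l k : nat)
    (f u : R -> R) : Prop :=
  [/\ in_H L (2 * l + 1) u,
      {ae @lebesgue_measure R, forall x, x \in `]0, L[ ->
         a * u x
         + \sum_(1 <= j < l.+1) (-1) ^+ (j + 1) * wD L (2 * j + 1) u x
         + u x ^+ k * wD L 1 u x = f x},
      forall i : nat, (i < l)%N -> boundary_value L (wD L i u) 0 0,
      forall i : nat, (i < l)%N -> boundary_value L (wD L i u) L 0 &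
      boundary_value L (wD L l u) L 0].

(* ((1 + x), f^2) *)
Definition weighted_sq (R : realType) (L : R) (f : R -> R) : R :=
  \int[@lebesgue_measure R]_(x in `]0, L[) ((1 + x) * f x ^+ 2).

Definition GN_constant (R : realType) (L : R) (l : nat) (Cs : R) : Prop :=
  forall v : R -> R, in_H0 L l v ->
    (supnorm L v <=
     (Cs * L2norm L (wD L l v) `^ ((2 * l)%:R^-1)
         * L2norm L v `^ (1 - (2 * l)%:R^-1))%:E)%E.

(* Main.v *)
Require Import Defs.
From mathcomp Require Import all_boot all_order all_algebra ring lra zify.

Set Implicit Arguments.
Unset Strict Implicit.
Unset Printing Implicit Defensive.

Import Order.TTheory GRing.Theory Num.Theory.

(* Solutions are sought as fixed points of w |-> tau Psi(w), where Psi solves the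
   linear problem (-1)^(l+1) D^(2l+1) u = F under the boundary conditions, F
   collecting f and the lower order terms.  Testing the equation with u and with
   (1 + x) u bounds |u| and |D^l u|: integration by parts produces
   (2j + 1)/2 |D^j u|^2 and nonnegative boundary terms from the dispersive
   terms, and 1/(k + 2) int u^(k+2) from u^k Du.  For k < 4l this integral is
   absorbed by means of sup|u|^(4l) <= 4^l |D^l u|^2 |u|^(4l-2).  For k = 4l the
   smallness of f gives only sup|u|^(4l) |u|^2 <= (2l+1)^2 |D^l u|^2, which is not
   quite enough; since u vanishes at 0 it cannot stay near its maximum, and this
   gain yields a bound independent of the distance of |f| to its threshold.
   Interpolation bounds the other derivatives by the data.  A fixed point with
   tau = 1 follows by the Leray-Schauder argument: approximate fixed points among
   step functions come from an approximate Brouwer theorem, obtained from Scarf's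
   lemma, and a cluster point of them is a fixed point because Psi maps bounded
   sets to equi-Lipschitz ones.  Everything is done with chains U_0, U_1, ... in
   which each function is a primitive of the next; a fundamental lemma of the
   calculus of variations identifies U_i with the weak derivative D^i U_0, and
   U_0 is in H_0^l because test functions are dense. *)

(** * Scarf's lemma and an approximate Brouwer theorem *)

(** The constant of the critical case may depend neither on C_* nor on the gap left by the strict
    inequality for f, and this shapes the estimates. Write b_i for |D^i u|^2, S for sup|u| and P for
    the integral of u^(4l+2). The energy estimate reads (2l+1)^2 b_l <= data + P, while the
    threshold gives P <= S^(4l) b_0 <= (2l+1)^2 b_l with the same factor, so nothing is absorbed.
    Two alternatives save the argument. If b_0 b_1 is large compared with S^4, log-convexity of the
    b_i already gives P <= b_l. Otherwise the climb of u from 0 to its maximum costs P a fixed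
    fraction of S^(4l) b_0. Both are measured by a bound on |f|/a alone. The homotopy parameter tau
    is harmless: f and the lower order terms carry the same factor, which cancels when testing with
    u and is bounded by 1 when testing with (1 + x) u. A single tau must serve all derivatives at
    once, since otherwise the retracted functions would no longer form a chain of primitives. *)

Section Scarf.
Local Open Scope nat_scope.
Variables (V K : finType) (r : K -> V -> nat).
Hypothesis r_inj : forall i, injective (r i).

(** Scarf's condition: no point strictly beats the minimum of [Z] in every ranking. Dominant sets of
    size [#|K|] act as the facets of a triangulation, sets with one element less as its ridges. *)
Definition dominant (Z : {set V}) : bool :=
  [forall y, exists i, forall z in Z, r i y <= r i z].

Lemma dominantP (Z : {set V}) :
  reflect (forall y, exists i, forall z, z \in Z -> r i y <= r i z)
          (dominant Z).
Proof.
apply: (iffP forallP) => h y.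
  by have /existsP[i /forall_inP hi] := h y; exists i.
by have [i hi] := h y; apply/existsP; exists i; apply/forall_inP.
Qed.

Lemma dominantS (Z Z' : {set V}) :
  Z' \subset Z -> dominant Z -> dominant Z'.
Proof.
move=> /subsetP sZ /dominantP h; apply/dominantP => y.
by have [i hi] := h y; exists i => z /sZ; apply: hi.
Qed.

Lemma argminP (Z : {set V}) : Z != set0 ->
  exists f : K -> V, forall i, f i \in Z /\ forall z, z \in Z -> r i (f i) <= r i z.
Proof.
case/set0Pn => z0 z0Z; exists (fun i => [arg min_(z < z0 in Z) r i z]) => i.
by case: arg_minnP => // z zZ h; split.
Qed.

(** Dominance, tested at an element of [Z] itself, provides a ranking in which this element is
    minimal. *)
Lemma argmin_surj (Z : {set V}) (f : K -> V) : dominant Z ->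
  (forall i, f i \in Z /\ forall z, z \in Z -> r i (f i) <= r i z) ->
  forall z, z \in Z -> exists i, f i = z.
Proof.
move=> /dominantP dZ hf z zZ; have [i hi] := dZ z.
exists i; apply: (r_inj (i := i)); apply/eqP; rewrite eqn_leq.
by rewrite (hf i).2// hi ?(hf i).1.
Qed.

Lemma imset_argmin (Z : {set V}) (f : K -> V) : dominant Z ->
  (forall i, f i \in Z /\ forall z, z \in Z -> r i (f i) <= r i z) ->
  f @: [set: K] = Z.
Proof.
move=> dZ hf; apply/setP => z; apply/imsetP/idP => [[i _ ->]|zZ].
  exact: (hf i).1.
by have [i <-] := argmin_surj dZ hf zZ; exists i.
Qed.

(* The two indices [i], [j] sharing their minimum are the two sides on which the
   ridge [Z] can be completed to a facet. *)
Lemma ridge_pair (Z : {set V}) (f : K -> V) : dominant Z -> #|Z|.+1 = #|K| ->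
  (forall i, f i \in Z /\ forall z, z \in Z -> r i (f i) <= r i z) ->
  exists i j, [/\ i != j, f i = f j,
    forall p q, f p = f q -> p != q -> (p \in [:: i; j]) /\ (q \in [:: i; j]) &
    forall m z, m \in [:: i; j] -> z \in Z -> exists2 p, p != m & f p = z].
Proof.
move=> dZ cZ hf.
have imf := imset_argmin dZ hf.
have : ~~ dinjectiveb f [set: K].
  apply/negP => /dinjectiveP/card_in_imset; rewrite imf cardsT => e.
  by move: cZ; rewrite -e => /esym /n_Sn.
case/dinjectivePn => i _ [j]; rewrite !inE andbT => ji fij.
have surj m : m \in [:: i; j] -> f @: [set~ m] = Z.
  move=> mij; apply/eqP; rewrite eqEsubset -{1}imf imsetS ?subsetT //=.
  apply/subsetP => z zZ; have [p fp] := argmin_surj dZ hf zZ.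
  have [pm|pm] := eqVneq p m; last by apply/imsetP; exists p; rewrite ?inE.
  move: mij; rewrite !inE -pm => /orP[]/eqP e; apply/imsetP.
    by exists j; [rewrite !inE e|rewrite -fp e].
  by exists i; [rewrite !inE e eq_sym|rewrite -fp e].
exists i, j; split => //; first by rewrite eq_sym.
  have inj m : m \in [:: i; j] -> {in [set~ m] &, injective f}.
    move=> mij; apply/imset_injP; rewrite surj// cardsC1 -cZ.
    by [].
  move=> p q fpq pq.
  have key m : m \in [:: i; j] -> (p == m) || (q == m).
    move=> mij; apply: contraT; rewrite negb_or => /andP[pm qm].
    by move/eqP: pq; case; apply: (inj m mij); rewrite ?inE.
  move: (key i) (key j); rewrite !inE !eqxx orbT => /(_ isT) + /(_ isT).
  move=> /orP[]/eqP -> /orP[]/eqP e; rewrite ?e ?eqxx ?orbT//.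
    by move: ji; rewrite e eqxx.
  by move: ji; rewrite -e eqxx.
move=> m z mij; rewrite -(surj m mij) => /imsetP[p]; rewrite !inE => pm ->.
by exists p.
Qed.

(** The analogue of a ridge lying in exactly two facets. A completing point becomes the minimum of
    one index [m] of the pair from [ridge_pair] and beats the other minima; dominance then forces it
    to have the largest rank [r m] among the points that do so. Each index of the pair thus yields
    one completion, and the last hypothesis guarantees candidates. *)
Lemma ridge_card2 (Z : {set V}) (f : K -> V) :
  dominant Z -> #|Z|.+1 = #|K| ->
  (forall i, f i \in Z /\ forall z, z \in Z -> r i (f i) <= r i z) ->
  (forall m, exists y, forall p, p != m -> r p (f p) < r p y) ->
  #|[set y | (y \notin Z) && dominant (y |: Z)]| = 2.
Proof.
move=> dZ cZ hf hY.
have [i [j [ij fij uniq_ij surj]]] := ridge_pair dZ cZ hf.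
pose Y m := [pred y | [forall p, (p != m) ==> (r p (f p) < r p y)]].
have YP m y : reflect (forall p, p != m -> r p (f p) < r p y) (Y m y).
  by apply: (iffP forallP) => h p; [move/implyP: (h p)|apply/implyP/h].
have ext m : exists y, Y m y /\ forall y', Y m y' -> r m y' <= r m y.
  have [y0 y0P] := hY m.
  have : Y m y0 by apply/YP.
  move=> y0Y; exists [arg max_(y > y0 | Y m y) r m y].
  by case: arg_maxnP.
have YnZ m y : m \in [:: i; j] -> Y m y -> y \notin Z.
  move=> mij /YP h; apply/negP => yZ; have [p pm fp] := surj m y mij yZ.
  by have := h p pm; rewrite fp ltnn.
have nbeat y : ~ forall p, r p (f p) < r p y.
  move=> h; have /dominantP/(_ y)[p hp] := dZ.
  by have := h p; rewrite ltnNge hp ?(hf p).1.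
have [yi [yiY yimax]] := ext i; have [yj [yjY yjmax]] := ext j.
have yij : yi != yj.
  apply/eqP => e; apply: (nbeat yi) => p.
  have [->|pi] := eqVneq p i; last by move/YP: yiY; apply.
  by rewrite e; move/YP: yjY; apply.
have domext m y : m \in [:: i; j] -> Y m y ->
    (forall y', Y m y' -> r m y' <= r m y) -> dominant (y |: Z).
  move=> mij yY ymax; apply/forallP => y'; apply: contraT => /existsPn h.
  have {}h p : exists2 z, z \in y |: Z & r p z < r p y'.
    by have /forall_inPn[z zZ lt] := h p; exists z; rewrite // ltnNge.
  have y'Y : Y m y'.
    apply/YP => p pm; have [z] := h p.
    rewrite inE in_set1 => /orP[/eqP -> |zZ] lt.
      by apply: ltn_trans lt; move/YP: yY; apply.
    by apply: leq_ltn_trans lt; apply: (hf p).2.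
  have [z] := h m; rewrite inE in_set1 => /orP[/eqP -> |zZ] lt.
    by have := ymax _ y'Y; rewrite leqNgt lt.
  case: (nbeat y') => p; have [->|pm] := eqVneq p m.
    by apply: leq_ltn_trans lt; apply: (hf m).2.
  by move/YP: y'Y; apply.
suff -> : [set y | (y \notin Z) && dominant (y |: Z)] = [set yi; yj].
  by rewrite cards2 yij.
apply/setP => y; rewrite !inE; apply/idP/idP; last first.
  case/orP => /eqP ->.
    by rewrite (YnZ i) ?inE ?eqxx// (domext i) ?inE ?eqxx.
  by rewrite (YnZ j) ?inE ?eqxx ?orbT// (domext j) ?inE ?eqxx ?orbT.
case/andP => yZ dyZ.
have [|g hg] := @argminP (y |: Z).
  by apply/set0Pn; exists y; rewrite !inE eqxx.
have img := imset_argmin dyZ hg.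
have ginj : injective g.
  have : {in [set: K] &, injective g}.
    by apply/imset_injP; rewrite img cardsT -cZ cardsU1 yZ.
  by move=> h p q; apply: h; rewrite inE.
have [m gm] : exists m, g m = y by apply: argmin_surj dyZ hg _ _; rewrite !inE eqxx.
have gf p : p != m -> g p = f p.
  move=> pm; apply: (r_inj (i := p)); apply/eqP; rewrite eqn_leq.
  rewrite (hg p).2 ?inE ?(hf p).1 ?orbT// (hf p).2//.
  have := (hg p).1; rewrite !inE -gm => /orP[/eqP/ginj/eqP|//].
  by rewrite (negbTE pm).
have yY : Y m y.
  apply/YP => p pm; rewrite ltn_neqAle -(gf _ pm) (hg p).2 ?inE ?eqxx// andbT.
  apply/eqP => /r_inj; rewrite -gm => /ginj/eqP; by rewrite (negbTE pm).
have ymax y' : Y m y' -> r m y' <= r m y.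
  move=> /YP hy'; have /dominantP/(_ y')[p hp] := dyZ.
  have [pm|pm] := eqVneq p m; first by rewrite -pm; apply: hp; rewrite !inE eqxx.
  by have := hy' p pm; rewrite ltnNge hp // inE (hf p).1 orbT.
have mij : m \in [:: i; j].
  apply: contraT; rewrite !inE negb_or => /andP[mi mj].
  by move/eqP: ij; case; apply: ginj; rewrite !gf 1?eq_sym.
move: mij; rewrite !inE => /orP[]/eqP e; rewrite e in yY ymax; apply/orP; [left|right].
  by apply/eqP/(r_inj (i := i))/eqP; rewrite eqn_leq ymax ?yimax.
by apply/eqP/(r_inj (i := j))/eqP; rewrite eqn_leq ymax ?yjmax.
Qed.

Variables (c : V -> K) (i0 : K) (Zo : {set V}).
Hypothesis Zo_door : #|Zo|.+1 = #|K| /\ c @: Zo = [set~ i0].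
Hypothesis Zo_one : odd #|[set y | (y \notin Zo) && dominant (y |: Zo)]|.
Hypothesis other_two : forall Z : {set V}, #|Z|.+1 = #|K| -> c @: Z = [set~ i0] ->
  dominant Z -> Z != Zo -> ~~ odd #|[set y | (y \notin Z) && dominant (y |: Z)]|.

(** Call an element a door if its removal leaves every colour but [i0]. If [z] is a door and [Z] is
    not rainbow, the colour of [z] is repeated by a single [z'], which is then the only other door:
    there are none or two. *)
Lemma colour_even (Z : {set V}) : #|Z| = #|K| -> c @: Z != [set: K] ->
  ~~ odd #|[set z in Z | c @: (Z :\ z) == [set~ i0]]|.
Proof.
move=> cZ ncol.
set S := [set z in Z | _].
have [->|] := eqVneq S set0; first by rewrite cards0.
case/set0Pn => z; rewrite inE => /andP[zZ /eqP cz].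
have cD x : x \in Z -> #|Z :\ x|.+1 = #|K| by move=> xZ; rewrite -cZ (cardsD1 x Z) xZ.
have inj x : x \in Z -> c @: (Z :\ x) = [set~ i0] -> {in Z :\ x &, injective c}.
  move=> xZ e; apply/imset_injP; rewrite e cardsC1 -(cD x xZ).
  by [].
have cz0 : c z != i0.
  apply: contraNneq ncol => e; apply/eqP/setP => p; rewrite inE.
  have [->|pi] := eqVneq p i0; first by apply/imsetP; exists z.
  have : p \in [set~ i0] by rewrite !inE.
  by rewrite -cz => /imsetP[x]; rewrite !inE => /andP[_ xZ] ->; apply/imsetP; exists x.
have : c z \in [set~ i0] by rewrite !inE.
rewrite -cz => /imsetP[z']; rewrite !inE => /andP[z'z z'Z] czz'.
suff -> : S = [set z; z'] by rewrite cards2 eq_sym z'z.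
apply/setP => x; rewrite !inE; apply/idP/idP.
  case/andP => xZ /eqP cx; apply: contraT; rewrite negb_or => /andP[xz xz'].
  move/eqP: z'z; case; apply/esym; apply: (inj x xZ cx) => //.
    by rewrite !inE eq_sym xz.
  by rewrite !inE eq_sym xz'.
case/orP => /eqP ->; first by rewrite zZ cz eqxx.
rewrite z'Z -cz /=; apply/eqP/setP => p; apply/imsetP/imsetP => -[w];
  rewrite !inE => /andP[wn wZ] ->.
  have [->|wz] := eqVneq w z; last by exists w; rewrite ?inE ?wz.
  by exists z'; rewrite ?inE ?z'z.
have [->|wz] := eqVneq w z'; last by exists w; rewrite ?inE ?wz.
by exists z; rewrite ?inE 1?eq_sym ?z'z.
Qed.

Lemma odd_sum (I : finType) (P : pred I) (F : I -> nat) :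
  odd (\sum_(i | P i) F i) = \big[addb/false]_(i | P i) odd (F i).
Proof. by rewrite (big_morph odd oddD (erefl _)). Qed.

(** Pairs of a facet and a door are counted twice. Grouped by facets their number is even if no
    facet is rainbow; grouped by ridges it is odd, because [Zo] is the only coloured ridge in an odd
    number of facets. *)
Lemma scarf : exists Z : {set V},
  [/\ #|Z| = #|K|, dominant Z & c @: Z = [set: K]].
Proof.
have [/existsP[Z /and3P[/eqP ? ? /eqP ?]]|/existsPn hno] := boolP [exists Z : {set V},
  [&& #|Z| == #|K|, dominant Z & c @: Z == [set: K]]]; first by exists Z.
exfalso.
pose P := [set u : {set V} * V | [&& #|u.1| == #|K|, dominant u.1, u.2 \in u.1 &
  c @: (u.1 :\ u.2) == [set~ i0]]].
pose Q := [set u : {set V} * V | [&& #|u.1|.+1 == #|K|, c @: u.1 == [set~ i0],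
  u.2 \notin u.1 & dominant (u.2 |: u.1)]].
have PQ : #|P| = #|Q|.
  have h1 : {in P &, injective (fun u : {set V} * V => (u.1 :\ u.2, u.2))}.
    move=> [Z z] [Z' z']; rewrite !inE /= => /and4P[_ _ zZ _] /and4P[_ _ zZ' _].
    by move=> [e ze]; rewrite -(setD1K zZ) e ze setD1K.
  rewrite -(card_in_imset h1); congr #|pred_of_set _|.
  apply/setP => -[Z z]; rewrite !inE /=; apply/imsetP/idP.
    move=> [[Z' z']]; rewrite !inE /= => /and4P[/eqP cZ dZ zZ col] [-> ->].
    by rewrite col !inE eqxx setD1K// dZ -cZ (cardsD1 z' Z') zZ eqxx.
  case/and4P => /eqP cZ col zZ dZ; exists (z |: Z, z) => /=; last by rewrite setU1K.
  by rewrite !inE /= cardsU1 zZ eqxx dZ setU1K// col -cZ eqxx.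
have sumP : #|P| = \sum_(Z : {set V} | (#|Z| == #|K|) && dominant Z)
    #|[set z in Z | c @: (Z :\ z) == [set~ i0]]|.
  rewrite -sum1dep_card (eq_bigl (fun u : {set V} * V => (#|u.1| == #|K|) && dominant u.1 &&
    ((u.2 \in u.1) && (c @: (u.1 :\ u.2) == [set~ i0])))); last first.
    by move=> u; rewrite !andbA.
  rewrite -(pair_big_dep (fun Z : {set V} => (#|Z| == #|K|) && dominant Z)
    (fun (Z : {set V}) z => (z \in Z) && (c @: (Z :\ z) == [set~ i0])) (fun _ _ => 1)) /=.
  by apply: eq_bigr => Z _; rewrite -sum1dep_card.
have sumQ : #|Q| = \sum_(Z : {set V} | (#|Z|.+1 == #|K|) && (c @: Z == [set~ i0]))
    #|[set y | (y \notin Z) && dominant (y |: Z)]|.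
  rewrite -sum1dep_card (eq_bigl (fun u : {set V} * V =>
    (#|u.1|.+1 == #|K|) && (c @: u.1 == [set~ i0]) &&
    ((u.2 \notin u.1) && dominant (u.2 |: u.1)))); last first.
    by move=> u; rewrite !andbA.
  rewrite -(pair_big_dep (fun Z : {set V} => (#|Z|.+1 == #|K|) && (c @: Z == [set~ i0]))
    (fun (Z : {set V}) y => (y \notin Z) && dominant (y |: Z)) (fun _ _ => 1)) /=.
  by apply: eq_bigr => Z _; rewrite -sum1dep_card.
have : odd #|P| = false.
  rewrite sumP odd_sum big1 // => Z /andP[/eqP cZ dZ]; apply/negbTE/colour_even => //.
  by apply: contra (hno Z) => ->; rewrite cZ eqxx dZ.
rewrite PQ sumQ odd_sum (bigD1 Zo) /=; last by rewrite Zo_door.1 Zo_door.2 !eqxx.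
rewrite Zo_one big1 // => Z /andP[/andP[/eqP cZ /eqP col] ZZo].
have [dZ|ndZ] := boolP (dominant Z); first by apply/negbTE/other_two.
(* A ridge that is not dominant lies in no facet, as dominance passes to subsets. *)
rewrite (_ : [set y | _] = set0) ?cards0 //; apply/setP => y; rewrite !inE.
apply/negbTE; rewrite negb_and; apply/orP; right.
by apply: contra ndZ; apply: dominantS; apply: subsetUr.
Qed.

End Scarf.

(** * Scarf's lemma for a coloured finite set, with slack vectors adjoined *)

Section ScarfColouring.
Local Open Scope nat_scope.
Variables (T K : finType) (s : K -> T -> nat) (c : T -> K) (t0 : T) (i0 i1 : K).
Hypothesis s_inj : forall i, injective (s i).
Hypothesis i01 : i0 != i1.

(* Scarf's slack vectors: [inr j] is the worst point for [j] and is better than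
   every point of [T] for the other indices. *)
Let top := (\max_i \max_t s i t).+2.
Let r (i : K) (v : T + K) : nat :=
  match v with
  | inl t => (s i t).+1
  | inr j => if j == i then 0 else top + enum_rank j
  end.
Let cV (v : T + K) : K := match v with inl t => c t | inr j => j end.

Let r_top i t j : j != i -> r i (inl t) < r i (inr j).
Proof.
move=> /negbTE ji; rewrite /r ji; apply: leq_trans (leq_addr _ _).
rewrite /top !ltnS; apply: leq_trans (leq_bigmax i).
exact: (@leq_bigmax _ (fun t => s i t)).
Qed.

Let r_inj i : injective (r i).
Proof.
have tj t j : r i (inl t) <> r i (inr j).
  have [->|ji e] := eqVneq j i; first by rewrite /r eqxx.
  by have := r_top t ji; rewrite e ltnn.
move=> [t|j] [t'|j'] //.
- by move=> [] /s_inj ->.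
- by move/tj.
- by move/esym/tj.
rewrite /r; case: eqP => [->|_]; case: eqP => [->|_] //.
by move/addnI/val_inj/enum_rank_inj ->.
Qed.

(** [C] collects the indices whose slack vector is missing from a rainbow facet, so the points of
    the facet carry exactly these colours. A slack vector that is present has rank 0 in its own
    ranking, below every point; hence that ranking cannot be the one in which [y] is dominated. *)
Lemma scarf_colouring : exists (S : {set T}) (C : {set K}),
  [/\ S != set0, c @: S = C &
      forall y, exists2 i, i \in C & forall x, x \in S -> s i y <= s i x].
Proof.
(* The starting ridge. Its only completion is the point ranked highest by [i0]; adding the last
   slack vector fails since [t0] would beat all minima. *)
pose Zo : {set T + K} := inr @: [set~ i0].
have inrZo j : (inr j \in Zo) = (j != i0).
  by rewrite mem_imset ?inE // => ? ? [].
have inlZo t : inl t \in Zo = false.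
  by apply/imsetP => -[].
have cZo : #|Zo|.+1 = #|K|.
  rewrite card_imset ?cardsC1 ?prednK//; last by move=> ? ? [].
  by apply/card_gt0P; exists i0.
have colZo : cV @: Zo = [set~ i0].
  apply/setP => j; rewrite !inE; apply/imsetP/idP => [[[t|k]]|ji].
  - by rewrite inlZo.
  - by rewrite inrZo => ? ->.
  by exists (inr j); rewrite ?inrZo.
have K2 : 1 < #|K| by apply/card_gt1P; exists i0, i1.
have [||Z [cZ dZ colZ]] := @scarf (T + K)%type K r cV i0 Zo (conj cZo colZo).
- pose tm := [arg max_(t > t0) s i0 t].
  have tmP t : s i0 t <= s i0 tm by rewrite /tm; case: arg_maxnP => // ? _; apply.
  rewrite (_ : [set y | _] = [set inl tm]) ?cards1//; apply/setP => v; rewrite !inE.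
  apply/idP/eqP => [/andP[vZo /dominantP dv]|->]; last first.
    rewrite inlZo; apply/dominantP => -[t|j].
      exists i0 => z; rewrite !inE => /orP[/eqP ->|]; first by rewrite /= ltnS.
      by case: z => [t'|j]; rewrite ?inlZo// inrZo => ji; apply/ltnW/r_top.
    by exists j => z _; rewrite /= eqxx.
  case: v vZo dv => [t _ dv|j].
    congr inl; apply: (@s_inj i0); apply/eqP; rewrite eqn_leq tmP /=.
    have [i hi] := dv (inl tm); have [ii|ii] := eqVneq i i0.
      by have := hi (inl t); rewrite !inE eqxx ii /= => /(_ isT).
    by have := hi (inr i); rewrite !inE inrZo ii orbT /= eqxx => /(_ isT).
  rewrite inrZo negbK => /eqP -> /(_ (inl t0))[i hi].
  have := hi (inr i); rewrite !inE inrZo /= eqxx.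
  by have [->|ii] := eqVneq i i0; rewrite ?eqxx ?ii ?orbT => /(_ isT).
- move=> Z cZ colZ dZ ZZo.
  (* A ridge with these colours made of slack vectors only would be [Zo]. A genuine point keeps
     every minimum below the slack vectors of other indices, which are the candidates that
     [ridge_card2] asks for. *)
  have [t tZ] : exists t, inl t \in Z.
    apply/existsP; apply: contraR ZZo => /existsPn h; apply/eqP/setP => -[t|j].
      by rewrite inlZo; apply/negbTE/h.
    rewrite inrZo; apply/idP/idP => [jZ|ji].
      have : cV (inr j) \in cV @: Z by apply: imset_f.
      by rewrite colZ !inE.
    have : j \in cV @: Z by rewrite colZ !inE.
    by case/imsetP => -[t tZ|k kZ /= ->//]; have := h t; rewrite tZ.
  have Z0 : Z != set0 by apply/set0Pn; exists (inl t).
  have [f hf] := argminP r Z0.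
  rewrite (ridge_card2 r_inj dZ cZ hf) // => m; exists (inr m) => p pm.
  by apply: leq_ltn_trans (r_top t _); rewrite ?(hf p).2 1?eq_sym.
exists [set t | inl t \in Z], [set j | inr j \notin Z].
have cinj : {in Z &, injective cV} by apply/imset_injP; rewrite colZ cardsT cZ.
move/dominantP: dZ => dZ.
have noinr i y : (forall z, z \in Z -> r i (inl y) <= r i z) -> inr i \notin Z.
  by move=> hi; apply/negP => /hi; rewrite /= eqxx.
split.
- apply/set0Pn; have [i /noinr iZ] := dZ (inl t0).
  have : i \in cV @: Z by rewrite colZ inE.
  case/imsetP => -[t tZ _|k kZ /= e]; first by exists t; rewrite inE.
  by rewrite -e (negbTE iZ) in kZ.
- apply/setP => j; rewrite !inE; apply/imsetP/idP => [[t]|jZ].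
    rewrite inE => tZ ->; apply/negP => jZ.
    by have := cinj _ _ tZ jZ erefl.
  have : j \in cV @: Z by rewrite colZ inE.
  case/imsetP => -[t tZ ->|k kZ /= e]; first by exists t; rewrite ?inE.
  by rewrite -e (negbTE jZ) in kZ.
move=> y; have [i hi] := dZ (inl y); exists i; first by rewrite inE (noinr _ _ hi).
by move=> x; rewrite inE => /hi; rewrite /= ltnS.
Qed.

End ScarfColouring.

Local Open Scope ring_scope.

Lemma sum_option (I : finType) (F : option I -> nat) :
  (\sum_o F o = F None + \sum_i F (Some i))%N.
Proof.
rewrite (bigD1 None)//= (reindex_omap Some id) => [|[]//]; congr (_ + _)%N.
by apply: eq_bigl => i; rewrite /= eqxx.
Qed.

(** * Colourings of the lattice points of a simplex *)

Section GridColouring.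
Local Open Scope nat_scope.
Variables (I : finType) (i1 : I) (m : nat).

Definition grid := {t : {ffun option I -> 'I_m.+1} | \sum_o t o == m}.

(** A discrete form of the Knaster-Kuratowski-Mazurkiewicz lemma. In the set [S] of
    [scarf_colouring], coordinates outside [C] are at most [#|I|], those in [C] vary by at most
    [#|I|], and every index of [C] is the colour of a point of [S]. *)
Lemma grid_colouring (c : grid -> option I) :
  exists t : grid, forall o, val t o <= #|I| \/ exists t' : grid, c t' = o /\
    forall o', val t o' <= val t' o' + #|I| /\ val t' o' <= val t o' + #|I|.
Proof.
have mk (F : option I -> nat) : \sum_o F o = m -> exists t : grid, forall o, val t o = F o :> nat.
  move=> sF; have Fm o : F o < m.+1 by rewrite ltnS -sF (bigD1 o)//= leq_addr.
  have h : \sum_o [ffun o => Ordinal (Fm o)] o == m.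
    by apply/eqP; rewrite -[RHS]sF; apply: eq_bigr => o _; rewrite ffunE.
  by exists (exist (fun t : {ffun option I -> 'I_m.+1} => \sum_o t o == m) _ h) => o; rewrite /= ffunE.
have [t0 _] : exists t : grid, forall o, val t o = (if o == None then m else 0) :> nat.
  by apply: mk; rewrite -big_mkcond big_pred1_eq.
(* Rankings have to be injective: coordinates are compared first, and ties are broken by the
   enumeration of the grid. *)
pose s (o : option I) (t : grid) := val t o * #|{: grid}| + enum_rank t.
have s_le o t t' : s o t <= s o t' -> val t o <= val t' o.
  move=> h; rewrite leqNgt; apply/negP => lt; move: h; rewrite leqNgt => /negP; apply.
  apply: (@leq_trans ((val t' o).+1 * #|{: grid}|)).
    by rewrite mulSn [leqRHS]addnC ltn_add2l ltn_ord.
  by apply: leq_trans (leq_addr _ _); rewrite leq_mul2r lt orbT.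
have s_inj o : injective (s o).
  move=> t t' e; have e1 : val t o = val t' o :> nat.
    by apply/eqP; rewrite eqn_leq !s_le ?e.
  by move: e; rewrite /s e1 => /addnI /val_inj /enum_rank_inj.
have [S [C [S0 cS dom]]] := @scarf_colouring _ _ s c t0 None (Some i1) s_inj isT.
have [x0 x0S] := set0Pn _ S0.
pose mu o : nat := val [arg min_(t < x0 in S) val t o] o.
have mu_le o t : t \in S -> mu o <= val t o.
  by rewrite /mu; case: arg_minnP => // t' _ h tS; apply: h.
have muE o : exists2 t, t \in S & mu o = val t o.
  by rewrite /mu; case: arg_minnP => // t' t'S _; exists t'.
have cC : \sum_(o in C) mu o + #|C| <= \sum_(o in C) mu o + #|I|.+1.
  by rewrite leq_add2l -card_option max_card.
have sumt (t : grid) : \sum_o val t o = m by apply/eqP/(valP t).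
(* If the minima over [S] left more room than this, some grid point would exceed all of them on [C]
   by at least one, against dominance. *)
have key : m <= \sum_(o in C) mu o + #|I|.
  rewrite -ltnS -addnS; apply: leq_trans cC; rewrite ltnNge; apply/negP => le.
  have [o1 o1C _] := dom x0.
  have [|y yE] := mk (fun o => (if o \in C then (mu o).+1 else 0) +
    (if o == o1 then m - (\sum_(o in C) mu o + #|C|) else 0)).
    rewrite big_split /= -!big_mkcond /= big_pred1_eq.
    by under eq_bigr do rewrite -addn1; rewrite big_split /= sum1_card subnKC.
  have [o oC ho] := dom y; have [t tS muo] := muE o.
  by have := s_le _ _ _ (ho _ tS); rewrite yE oC -muo addSn ltnNge leq_addr.
have sumC (t : grid) : \sum_(o in C) val t o + \sum_(o | o \notin C) val t o = m.
  by rewrite -[RHS](sumt t) [RHS](bigID (mem C)).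
have inC o t : o \in C -> t \in S -> val t o <= mu o + #|I|.
  move=> oC tS; have := leq_trans (leq_addr _ _) (leq_trans (eq_leq (sumC t)) key).
  rewrite (bigD1 o)//= [X in _ <= X + _](bigD1 o)//= addnAC.
  have : \sum_(o' in C | o' != o) mu o' <= \sum_(o' in C | o' != o) val t o'.
    by apply: leq_sum => o' _; apply: mu_le.
  set a := \sum_(_ in C | _) _; set b := \sum_(_ in C | _) _ => ab h.
  by rewrite -(leq_add2r b); apply: leq_trans h _; rewrite leq_add2l.
have notC o t : o \notin C -> t \in S -> val t o <= #|I|.
  move=> oC tS; have := leq_trans (eq_leq (sumC t)) key.
  rewrite (bigD1 (P := fun o => o \notin C) o)//= addnA.
  have : \sum_(o' in C) mu o' <= \sum_(o' in C) val t o'.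
    by apply: leq_sum => o' _; apply: mu_le.
  set a := \sum_(_ in C) _; set b := \sum_(_ in C) _ => ab h.
  rewrite -(leq_add2l b); apply: leq_trans (leq_trans (leq_addr _ _) h) _.
  by rewrite leq_add2r.
exists x0 => o; have [oC|oC] := boolP (o \in C); last by left; apply: notC.
right; move: (oC); rewrite -cS => /imsetP[t tS ->]; exists t; split=> // o'.
have [o'C|o'C] := boolP (o' \in C).
  by split; apply: leq_trans (inC _ _ o'C _) _ => //; rewrite leq_add2r mu_le.
by split; apply: leq_trans (notC _ _ o'C _) (leq_addl _ _).
Qed.

End GridColouring.

(** * Approximate fixed points of Lipschitz maps of a cube *)

Section Brouwer.
Variables (R : archiRealFieldType) (I : finType).

Definition in_cube (x : I -> R) := forall i, 0 <= x i <= 1.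

(** The simplex is scaled to contain the cube. A grid point gets a colour [i] with p_i <= g_i at its
    clipped position, and [None] if there is no such [i]. Near a point of colour [i] the difference
    g_i - p_i is almost nonnegative; near one of colour [None] the sum of the differences is almost
    nonpositive. Small coordinates give the same bounds directly, from g_i >= 0 and from the sum of
    the g_i being at most [N]. So all differences are small. *)
Lemma approx_brouwer (g : (I -> R) -> I -> R) (K : R) :
  (forall x, in_cube x -> in_cube (g x)) ->
  (forall x y (d : R), in_cube x -> in_cube y -> (forall i, `|x i - y i| <= d) ->
     forall i, `|g x i - g y i| <= K * d) ->
  forall e : R, 0 < e -> exists x, in_cube x /\ forall i, `|g x i - x i| <= e.
Proof.
move=> g01 gK e e0.
have [i1 _|I0] := pickP I; last by exists (fun=> 0); split=> i; have := I0 i.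
wlog K0 : K gK / 0 <= K.
  move=> /(_ `|K|); apply => // x y d x01 y01 xy i.
  apply: le_trans (gK x y d x01 y01 xy i) _.
  by rewrite ler_wpM2r ?ler_norm//; apply: le_trans (normr_ge0 _) (xy i).
set N : R := #|I|%:R.
have N1 : 1 <= N by rewrite ler1n; apply/card_gt0P; exists i1.
have N0 : 0 <= N := le_trans ler01 N1.
pose m := (Num.truncn (3 * N ^+ 3 * (1 + K) / e)).+1.
have mlt : 3 * N ^+ 3 * (1 + K) / e < m%:R by apply: truncnS_gt.
have m0 : 0 < m%:R :> R by rewrite ltr0n.
(* The diameter of the cell in each coordinate: [#|I|] grid steps of length N / m. *)
set del := N * N / m%:R.
have del0 : 0 <= del by rewrite divr_ge0 ?mulr_ge0.
have delE : 3 * N * (1 + K) * del <= e.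
  rewrite /del; move: mlt; rewrite ltr_pdivrMr// => /ltW.
  by rewrite mulrA ler_pdivrMr// => h; lra.
pose p (t : grid I m) i := N * (val t (Some i))%:R / m%:R.
pose cl (t : grid I m) i := Num.min 1 (p t i).
have p0 t i : 0 <= p t i by rewrite divr_ge0 ?mulr_ge0.
have cl01 t : in_cube (cl t) by move=> i; rewrite /cl le_min ler01 p0 ge_min lexx.
pose c t := [pick i | p t i <= g (cl t) i].
have pclose (t t' : grid I m) : (forall o', (val t o' <= val t' o' + #|I|)%N /\
    (val t' o' <= val t o' + #|I|)%N) -> forall i, `|p t i - p t' i| <= del.
  move=> h i; have [h1 h2] := h (Some i).
  rewrite /p -mulrBl -mulrBr /del !normrM normfV (ger0_norm N0) (gtr0_norm m0).
  rewrite ler_pM2r ?invr_gt0// ler_wpM2l// ler_norml.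
  move: h1 h2; rewrite -!(ler_nat R) !natrD -/N; lra.
have clclose (t t' : grid I m) : (forall o', (val t o' <= val t' o' + #|I|)%N /\
    (val t' o' <= val t o' + #|I|)%N) -> forall i, `|cl t i - cl t' i| <= del.
  move=> /pclose h i; move: (h i); rewrite /cl !ler_norml.
  by case: (leP 1 (p t i)); case: (leP 1 (p t' i)); lra.
have [t tP] := grid_colouring i1 c.
have sump (t' : grid I m) : \sum_i p t' i = N - N * (val t' None)%:R / m%:R.
  rewrite /p -mulr_suml -mulr_sumr.
  have := eqP (valP t'); rewrite sum_option => /(congr1 (fun n => n%:R : R)).
  rewrite natrD natr_sum => h.
  have -> : \sum_i (val t' (Some i))%:R = m%:R - (val t' None)%:R :> R.
    by rewrite -h addrC addKr.
  by rewrite mulrBr mulrBl mulfK ?gt_eqF.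
have lo i : p t i - (1 + K) * del <= g (cl t) i.
  case: (tP (Some i)) => [ti|[t' [ct' tt']]].
    have [g0 _] := andP (g01 _ (cl01 t) i); apply: le_trans g0.
    rewrite subr_le0; apply: (@le_trans _ _ del); last by rewrite ler_peMl// lerDl.
    by rewrite /p /del ler_pM2r ?invr_gt0// ler_wpM2l// ler_nat.
  have : p t' i <= g (cl t') i.
    by move: ct'; rewrite /c; case: pickP => // j h [<-].
  have := gK _ _ _ (cl01 t) (cl01 t') (clclose _ _ tt') i.
  by have := pclose _ _ tt' i; rewrite !ler_norml; lra.
have hi : \sum_i g (cl t) i - \sum_i p t i <= N * ((1 + K) * del).
  case: (tP None) => [ti|[t' [ct' tt']]].
    have s1 : \sum_i g (cl t) i <= N.
      rewrite /N -sum1_card natr_sum; apply: ler_sum => i _.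
      by have /andP[] := g01 _ (cl01 t) i.
    have : N * (val t None)%:R / m%:R <= del.
      by rewrite /del ler_pM2r ?invr_gt0// ler_wpM2l// ler_nat.
    have : del <= N * ((1 + K) * del).
      by rewrite mulrA ler_peMl// -[X in X <= _]mulr1 ler_pM// lerDl.
    rewrite sump; lra.
  rewrite -sumrB; apply: (@le_trans _ _ (\sum_(i : I) ((1 + K) * del))); last first.
    by rewrite sumr_const -mulr_natl.
  have nocol i : g (cl t') i < p t' i.
    by move: ct'; rewrite /c; case: pickP => // h _; rewrite ltNge h.
  apply: ler_sum => i _; have := gK _ _ _ (cl01 t) (cl01 t') (clclose _ _ tt') i.
  by have := nocol i; have := pclose _ _ tt' i; rewrite !ler_norml; lra.
have up i : g (cl t) i - p t i <= 2 * N * ((1 + K) * del).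
  move: hi; rewrite -sumrB (bigD1 i)//=.
  have : - (N * ((1 + K) * del)) <= \sum_(j | j != i) (g (cl t) j - p t j).
    have -> : - (N * ((1 + K) * del)) = \sum_(j : I) (- ((1 + K) * del)).
      by rewrite sumr_const mulNrn -mulr_natl.
    rewrite [leLHS](bigD1 i)//= -[leRHS]add0r; apply: lerD.
      by rewrite oppr_le0 mulr_ge0// addr_ge0.
    by apply: ler_sum => j _; have := lo j; lra.
  lra.
exists (cl t); split=> // i.
have [g0 g1] := andP (g01 _ (cl01 t) i).
have K1 : (1 + K) * del <= N * ((1 + K) * del).
  by rewrite ler_peMl// mulr_ge0// addr_ge0.
have K2 : 0 <= (1 + K) * del by rewrite mulr_ge0// addr_ge0.
have clE : cl t i = Num.min 1 (p t i) by [].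
have := lo i; have := up i; rewrite ler_norml clE.
by case: (leP 1 (p t i)); lra.
Qed.

End Brouwer.

From mathcomp Require Import all_classical all_reals all_analysis.
From mathcomp Require Import measurable_realfun ess_sup_inf.

Import numFieldNormedType.Exports.

Local Open Scope classical_set_scope.
Local Open Scope ring_scope.

(** * Absolutely continuous functions and square integrable functions *)

Section Primitive.
Variable R : realType.
Notation mu := (@lebesgue_measure R).
Implicit Types (p q P Q f g : R -> R) (x y L : R).

Definition itg L p : Prop := mu.-integrable `[0, L] (EFin \o p).

Definition prim p x : R := \int[mu]_(t in `[0, x]) p t.

Lemma itg_le L x p : x <= L -> itg L p -> itg x p.
Proof. by move=> xL; apply: integrableS => //; apply: subset_itvl. Qed.

Lemma itg_measurable L p : itg L p -> measurable_fun `[0, L] p.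
Proof. by move/measurable_int/measurable_EFinP. Qed.

Lemma integrable_patch (D : set R) p : measurable D ->
  mu.-integrable D (EFin \o p) -> mu.-integrable setT ((EFin \o p) \_ D).
Proof. by move=> mD; apply: (iffLR (integrable_mkcond _ _)). Qed.

Lemma itgT L p : itg L p <-> mu.-integrable setT (EFin \o (p \_ `[0, L])).
Proof.
by rewrite /itg -restrict_EFin; apply: integrable_mkcond.
Qed.

Lemma eq_itg L p q : (forall x, 0 <= x <= L -> p x = q x) -> itg L p -> itg L q.
Proof.
by move=> h; apply: eq_integrable => // x; rewrite inE /= in_itv /= => /h ->.
Qed.

Lemma itgD L p q : itg L p -> itg L q -> itg L (fun x => p x + q x).
Proof. by move=> ip iq; apply: (integrableD _ ip iq). Qed.

Lemma itgZ L k p : itg L p -> itg L (fun x => k * p x).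
Proof. by move=> ip; apply: (integrableZl _ k ip). Qed.

Lemma itg_norm L p : itg L p -> itg L (fun x => `|p x|).
Proof. exact: integrable_norm. Qed.

Lemma itg_dom L p q : measurable_fun `[0, L] p ->
  (forall x, 0 <= x <= L -> `|p x| <= q x) -> itg L q -> itg L p.
Proof.
move=> mp pq; apply: le_integrable => //; first exact/measurable_EFinP.
move=> x /=; rewrite in_itv /= => xL; rewrite lee_fin.
by rewrite (le_trans (pq x xL))// ler_norm.
Qed.

Lemma eq_prim x p q : (forall t, 0 <= t <= x -> p t = q t) -> prim p x = prim q x.
Proof. by move=> h; apply: eq_Rintegral => t; rewrite inE /= in_itv /= => /h. Qed.

Lemma primD x p q : itg x p -> itg x q ->
  prim (fun t => p t + q t) x = prim p x + prim q x.
Proof. by move=> ip iq; apply: RintegralD. Qed.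

Lemma primB x p q : itg x p -> itg x q ->
  prim (fun t => p t - q t) x = prim p x - prim q x.
Proof. by move=> ip iq; apply: RintegralB. Qed.

Lemma primZ x k p : itg x p -> prim (fun t => k * p t) x = k * prim p x.
Proof. by move=> ip; apply: RintegralZl. Qed.

Lemma prim_ge0 x p : (forall t, 0 <= t <= x -> 0 <= p t) -> 0 <= prim p x.
Proof. by move=> h; apply: Rintegral_ge0 => t /=; rewrite in_itv /=; apply: h. Qed.

Lemma le_prim x p q : itg x p -> itg x q ->
  (forall t, 0 <= t <= x -> p t <= q t) -> prim p x <= prim q x.
Proof.
by move=> ip iq h; apply: le_Rintegral => // t /=; rewrite in_itv /=; apply: h.
Qed.

Lemma le_norm_prim x p : itg x p -> `|prim p x| <= prim (fun t => `|p t|) x.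
Proof. by move=> ip; apply: le_normr_Rintegral. Qed.

Lemma prim_cst x k : 0 <= x -> prim (fun=> k) x = k * x.
Proof.
move=> x0; have mux : mu `[0, x]%classic = x%:E.
  rewrite lebesgue_measure_itv /= lte_fin.
  by case: ltgtP x0 => //= [x0 _|<- _]; rewrite -?EFinB ?subr0.
by rewrite /prim Rintegral_cst//; congr (_ * _); exact: (congr1 fine mux).
Qed.

Lemma itg_cst L k : itg L (fun=> k).
Proof.
have h : (mu `[0, L]%classic < +oo%E)%O.
  rewrite lebesgue_measure_itv /=; case: ifP => // _.
  by rewrite -EFinB ltry.
apply: (measurable_bounded_integrable (f := cst k)) => //.
exists `|k|; split; first exact: num_real.
by move=> M kM x _ /=; apply: ltW.
Qed.

Lemma prim0 p : prim p 0 = 0.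
Proof. by rewrite /prim set_itv1 Rintegral_set1. Qed.

Lemma prim_split p L x y : itg L p -> 0 <= x -> x <= y -> y <= L ->
  prim p y - prim p x = \int[mu]_(t in `]x, y]) p t.
Proof.
move=> ip x0 xy yL; apply: Rintegral_itvB; rewrite ?bnd_simp//.
exact: itg_le ip.
Qed.

Lemma prim_le p L x y : itg L p -> (forall t, 0 <= t <= L -> 0 <= p t) ->
  0 <= x -> x <= y -> y <= L -> prim p x <= prim p y.
Proof.
move=> ip p0 x0 xy yL; rewrite -subr_ge0 (prim_split ip)//.
apply: Rintegral_ge0 => t /=; rewrite in_itv /= => /andP[xt ty]; apply: p0.
by rewrite (le_trans x0 (ltW xt)) (le_trans ty).
Qed.

Lemma norm_primB p L x y : itg L p -> 0 <= x -> x <= y -> y <= L ->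
  `|prim p y - prim p x| <= prim (fun t => `|p t|) y - prim (fun t => `|p t|) x.
Proof.
move=> ip x0 xy yL; rewrite (prim_split ip)// (prim_split (itg_norm ip))//.
apply: le_normr_Rintegral => //; apply: integrableS ip => //.
apply: subset_itvScc; rewrite ?bnd_simp//.
Qed.

Definition bm L P : Prop := measurable_fun `[0, L] P /\
  exists M, forall x, 0 <= x <= L -> `|P x| <= M.

Lemma itgM_bm L p P : itg L p -> bm L P -> itg L (fun x => p x * P x).
Proof.
move=> ip [mP [M PM]]; apply: (@itg_dom _ _ (fun x => M * `|p x|)).
- by apply: measurable_funM => //; apply: itg_measurable.
- by move=> x /PM xM; rewrite normrM mulrC ler_wpM2r.
- exact/itgZ/itg_norm.
Qed.

Lemma prim_bm L p : itg L p -> bm L (prim p).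
Proof.
move=> ip; have [L0|L0] := ltP L 0.
  rewrite /bm set_itv_ge -?ltNge//; split; first exact: measurable_fun_set0.
  by exists 0 => x /andP[x0 xL]; have := le_trans x0 xL; rewrite leNgt L0.
split; last exists (prim (fun t => `|p t|) L).
  by apply: subspace_continuous_measurable_fun => //; exact: parameterized_integral_continuous.
move=> t /andP[t0 tx]; apply: le_trans (le_norm_prim _) _; first exact: itg_le ip.
by apply: (@prim_le _ L) => //; apply: itg_norm.
Qed.

(** Integration by parts for merely integrable factors, by Fubini for p(s) q(t) on the triangle t <=
    s. Integrating in [t] first gives the left side, in [s] first gives the integral of q(t) (prim p
    x - prim p t). *)
Lemma prim_mul p q x : 0 <= x -> itg x p -> itg x q ->
  prim (fun s => p s * prim q s) x = prim p x * prim q x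
    - prim (fun t => q t * prim p t) x.
Proof.
move=> x0 ip iq.
pose p' := p \_ `[0, x]; pose q' := q \_ `[0, x].
have ip' : mu.-integrable setT (EFin \o p') by apply/itgT.
have iq' : mu.-integrable setT (EFin \o q') by apply/itgT.
have mp' : measurable_fun setT p' by move/measurable_int/measurable_EFinP: ip'.
have mq' : measurable_fun setT q' by move/measurable_int/measurable_EFinP: iq'.
pose A : set (R * R) := [set st | st.2 <= st.1].
have mA : measurable A.
  have := @measurable_fun_ler _ _ R setT snd fst measurable_snd measurable_fst
    measurableT [set true] I.
  by rewrite setTI (_ : _ @^-1` _ = A).
pose f (st : R * R) := p' st.1 * q' st.2 * \1_A st.
have mf : measurable_fun setT (EFin \o f).
  apply/measurable_EFinP; apply: measurable_funM; last exact: measurable_indic.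
  by apply: measurable_funM; apply: measurableT_comp.
have if_ : (mu \x mu)%E.-integrable setT (EFin \o f).
  apply: (proj2 (@integrable12ltyP _ _ _ _ _ mu mu _ mf)).
  have h (g : R -> R) : mu.-integrable setT (EFin \o g) ->
      (\int[mu]_t `|(g t)%:E| < +oo)%E by case/integrableP.
  apply: (@le_lt_trans _ _ (\int[mu]_s (`|(p' s)%:E| * \int[mu]_t `|(q' t)%:E|))%E).
    have mq2 : measurable_fun setT (fun t => `|(q' t)%:E|%E).
      by apply: measurableT_comp => //; apply/measurable_EFinP.
    apply: ge0_le_integral => //.
    - by move=> s _; apply: integral_ge0.
    - have maf : measurable_fun setT (abse \o (EFin \o f)).
        exact: measurableT_comp.
      exact: (@measurable_fun_fubini_tonelli_F _ _ _ _ R mu _ maf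
        (fun=> abse_ge0 _)).
    - apply: emeasurable_funM => //; apply: measurableT_comp => //.
      exact/measurable_EFinP.
    - move=> s _; rewrite -ge0_integralZl//.
      apply: ge0_le_integral => //.
      + apply: measurableT_comp => //; apply/measurable_EFinP.
        apply: measurable_funM.
          by apply: measurable_funM => //; exact: (measurable_cst (p' s)).
        have mi : measurable_fun setT (\1_A : R * R -> R) by exact: measurable_indic.
        exact: (measurableT_comp mi (pair1_measurable s)).
      + by apply: emeasurable_funM.
      + move=> t _; rewrite /f /= !lee_fin !normrM.
        by rewrite indicE; case: (_ \in _); rewrite ?normr1 ?normr0 ?mulr1 ?mulr0 ?mulr_ge0.
  rewrite ge0_integralZr//.
  - by rewrite lte_mul_pinfty ?h// ?integral_ge0// ge0_fin_numE ?h// integral_ge0.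
  - by apply: measurableT_comp => //; exact/measurable_EFinP.
  - exact: integral_ge0.
have := Fubini if_.
have E1 s : (\int[mu]_t (EFin \o f) (s, t))%E =
    (((fun s => p s * prim q s) \_ `[0, x]) s)%:E.
  rewrite patchE; case: ifPn => [|sx]; last first.
    under eq_integral do rewrite /f /= /p' patchE (negbTE sx) !mul0r.
    by rewrite integral0.
  rewrite inE /= in_itv /= => /andP[s0 sx].
  have iqs : itg s q by apply: itg_le iq.
  pose qs := (EFin \o q) \_ `[0, s].
  transitivity (\int[mu]_t ((p s)%:E * qs t))%E; first apply: eq_integral.
    move=> t _; rewrite /qs restrict_EFin /= -EFinM /f /= /p' patchE mem_set /=; last first.
      by rewrite in_itv /= s0.
    rewrite /q' indicE /A -mulrA; congr (_ * _)%:E; rewrite !patchE.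
    rewrite !mem_setE !in_itv /= (_ : ((s, t) \in _) = (t <= s)); last first.
      by [].
    rewrite -[point]/(0 : R).
    have [t0|] := leP 0 t; rewrite /= ?mul0r//.
    have [ts|st] := leP t s; rewrite ?mulr0 ?mulr1; last by [].
    by rewrite (le_trans ts sx).
  have iqs' : mu.-integrable setT qs by apply: integrable_patch.
  rewrite integralZl// EFinM; congr (_ * _)%E.
  rewrite /qs -integral_mkcond fineK//; exact: integrable_fin_num iqs.
have E2 t : (\int[mu]_s (EFin \o f) (s, t))%E =
    (((fun t => q t * (prim p x - prim p t)) \_ `[0, x]) t)%:E.
  rewrite patchE; case: ifPn => [|tx]; last first.
    under eq_integral do rewrite /f /= /q' [(q \_ _) t]patchE (negbTE tx) mulr0 mul0r.
    by rewrite integral0.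
  rewrite inE /= in_itv /= => /andP[t0 tx].
  have ipt : mu.-integrable `[t, x] (EFin \o p).
    by apply: integrableS ip => //; apply: subset_itvr; rewrite bnd_simp.
  have ipt' : mu.-integrable `]t, x] (EFin \o p).
    by apply: integrableS ipt => //; apply: subset_itv_oc_cc.
  rewrite (prim_split ip)// (Rintegral_itv_obnd_cbnd ipt').
  pose pt := (EFin \o p) \_ `[t, x].
  transitivity (\int[mu]_s ((q t)%:E * pt s))%E; first apply: eq_integral.
    move=> s _; rewrite /pt restrict_EFin /= -EFinM /f /= /q' [(q \_ _) t]patchE mem_set /=; last first.
      by rewrite in_itv /= t0.
    rewrite indicE /A [p' s * _]mulrC -mulrA; congr (_ * _)%:E; rewrite /p' !patchE.
    rewrite !mem_setE !in_itv /= (_ : ((s, t) \in _) = (t <= s)); last first.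
      by [].
    rewrite -[point]/(0 : R).
    have [ts|st] := leP t s; rewrite ?mulr0 ?mulr1 /=; last by [].
    by rewrite (le_trans t0 ts).
  have ipt2 : mu.-integrable setT pt by apply: integrable_patch.
  rewrite EFinM; etransitivity; first exact: (integralZl measurableT ipt2).
  congr (_ * _)%E.
  rewrite /pt -integral_mkcond fineK//; exact: integrable_fin_num ipt.
under eq_integral do rewrite E1.
under [in X in _ = X -> _]eq_integral do rewrite E2.
move/(congr1 fine); rewrite -!/(Rintegral _ _ _) -!Rintegral_mkcond -!/(prim _ _) => ->.
rewrite (@eq_prim _ _ (fun t => prim p x * q t - q t * prim p t)); last by move=> t _; ring.
rewrite primB ?primZ//; first exact: itgZ.
by apply: itgM_bm => //; exact: prim_bm.
Qed.

End Primitive.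

(** * Calculus of absolutely continuous functions; Cauchy-Schwarz *)

Section AbsolutelyContinuous.
Variable R : realType.
Notation mu := (@lebesgue_measure R).
Implicit Types (p q P Q f g : R -> R) (x y L : R).

Lemma eq_bm L p q : (forall x, 0 <= x <= L -> p x = q x) -> bm L p -> bm L q.
Proof.
move=> pq [mp [M pM]]; split; last by exists M => x xL; rewrite -pq// pM.
apply: eq_measurable_fun mp => x; rewrite inE /= in_itv /=; exact: pq.
Qed.

Lemma bm_cst L (k : R) : bm L (fun=> k).
Proof. by split; [exact: measurable_cst|exists `|k|]. Qed.

Lemma bm_id L : bm L (fun x => x).
Proof.
split; first exact: measurable_id.
by exists L => x /andP[x0 xL]; rewrite ger0_norm.
Qed.

Lemma bmD L P Q : bm L P -> bm L Q -> bm L (fun x => P x + Q x).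
Proof.
move=> [mP [M PM]] [mQ [N QN]]; split; first exact: measurable_funD.
by exists (M + N) => x xL; rewrite (le_trans (ler_normD _ _))// lerD ?PM ?QN.
Qed.

Lemma bmM L P Q : bm L P -> bm L Q -> bm L (fun x => P x * Q x).
Proof.
move=> [mP [M PM]] [mQ [N QN]]; split; first exact: measurable_funM.
by exists (M * N) => x xL; rewrite normrM ler_pM ?PM ?QN.
Qed.

Lemma bmZ L k P : bm L P -> bm L (fun x => k * P x).
Proof. by move=> h; apply: bmM => //; exact: bm_cst. Qed.

Lemma bmN L P : bm L P -> bm L (fun x => - P x).
Proof. by move=> /(bmZ (-1)); apply: eq_bm => x _; rewrite mulN1r. Qed.

Lemma bmB L P Q : bm L P -> bm L Q -> bm L (fun x => P x - Q x).
Proof. by move=> hP /bmN; apply: bmD. Qed.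

Lemma bmX L P n : bm L P -> bm L (fun x => P x ^+ n).
Proof.
move=> h; elim: n => [|n IH]; first exact: bm_cst.
by apply: (eq_bm (p := fun x => P x * P x ^+ n)) (bmM h IH) => x _; rewrite exprS.
Qed.

Lemma bm_sum L (I : eqType) (s : seq I) (F : I -> R -> R) :
  (forall i, i \in s -> bm L (F i)) -> bm L (fun x => \sum_(i <- s) F i x).
Proof.
elim: s => [|i s IH] h; first by apply: eq_bm (bm_cst L 0) => x _; rewrite big_nil.
have hs : bm L (fun x => \sum_(i <- s) F i x).
  by apply: IH => j js; apply: h; rewrite inE js orbT.
by apply: eq_bm (bmD (h i (mem_head _ _)) hs) => x _; rewrite big_cons.
Qed.

Lemma bm_itg L P : bm L P -> itg L P.
Proof.
move=> hP; have := itgM_bm (itg_cst L 1) hP.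
by apply: eq_itg => x _; rewrite mul1r.
Qed.

(* [P] is absolutely continuous on [0, L] with derivative [p] almost everywhere. *)
Definition ac L P p : Prop :=
  itg L p /\ forall x, 0 <= x <= L -> P x = P 0 + prim p x.

Lemma eq_ac L P Q p q : (forall x, 0 <= x <= L -> P x = Q x) ->
  (forall x, 0 <= x <= L -> p x = q x) -> ac L P p -> ac L Q q.
Proof.
move=> PQ pq [ip hP]; split=> [|x xL]; first exact: eq_itg ip.
have [x0 xL'] := andP xL; rewrite -!PQ ?lexx ?(le_trans x0)// hP//; congr (_ + _).
by apply: eq_prim => t /andP[t0 tx]; rewrite pq// t0 (le_trans tx).
Qed.

Lemma ac_prim L p : itg L p -> ac L (prim p) p.
Proof. by move=> ip; split=> // x _; rewrite prim0 add0r. Qed.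

Lemma ac_bm L P p : ac L P p -> bm L P.
Proof.
move=> [ip hP]; apply: (eq_bm (p := fun x => P 0 + prim p x)); first by move=> x /hP.
by apply: bmD; [exact: bm_cst|exact: prim_bm].
Qed.

Lemma ac_continuous L P p : 0 <= L -> ac L P p -> {within `[0, L], continuous P}.
Proof.
move=> L0 [ip hP].
apply: (@subspace_eq_continuous _ _ _ (fun x => P 0 + prim p x)) => [x|].
  by rewrite inE /= in_itv /= => /hP.
have := parameterized_integral_continuous L0 ip.
by move=> h x; apply: continuousD; [exact: cvg_cst|exact: h].
Qed.

Lemma ac_cst L k : ac L (fun=> k) (fun=> 0).
Proof.
split; first exact: itg_cst.
by move=> x /andP[x0 _]; rewrite prim_cst// mul0r addr0.
Qed.

Lemma ac_id L : ac L (fun x => x) (fun=> 1).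
Proof.
split; first exact: itg_cst.
by move=> x /andP[x0 _]; rewrite prim_cst// mul1r add0r.
Qed.

Lemma acD L P Q p q : ac L P p -> ac L Q q ->
  ac L (fun x => P x + Q x) (fun x => p x + q x).
Proof.
move=> [ip hP] [iq hQ]; split; first exact: itgD.
move=> x xL; have [x0 xL'] := andP xL.
by rewrite hP// hQ// primD; [ring|apply: itg_le ip|apply: itg_le iq].
Qed.

Lemma acZ L k P p : ac L P p -> ac L (fun x => k * P x) (fun x => k * p x).
Proof.
move=> [ip hP]; split; first exact: itgZ.
move=> x xL; have [x0 xL'] := andP xL.
by rewrite hP// primZ; [ring|apply: itg_le ip].
Qed.

Lemma acB L P Q p q : ac L P p -> ac L Q q ->
  ac L (fun x => P x - Q x) (fun x => p x - q x).
Proof.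
move=> hP hQ; apply: eq_ac (acD hP (acZ (-1) hQ)) => x _; ring.
Qed.

Lemma ac_sum L (I : Type) (s : seq I) (P p : I -> R -> R) :
  (forall i, ac L (P i) (p i)) ->
  ac L (fun x => \sum_(i <- s) P i x) (fun x => \sum_(i <- s) p i x).
Proof.
move=> h; elim: s => [|i s IH].
  by apply: eq_ac (ac_cst L 0) => x _; rewrite big_nil.
by apply: eq_ac (acD (h i) IH) => x _; rewrite big_cons.
Qed.

Lemma acM L P Q p q : ac L P p -> ac L Q q ->
  ac L (fun x => P x * Q x) (fun x => p x * Q x + P x * q x).
Proof.
move=> aP aQ; have [[ip hP] [iq hQ]] := (aP, aQ).
have ipQ := itgM_bm ip (ac_bm aQ).
have iqP := itgM_bm iq (ac_bm aP).
have iPq : itg L (fun x => P x * q x) by apply: eq_itg iqP => x _; rewrite mulrC.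
split; first exact: itgD.
move=> x xL; have [x0 xL'] := andP xL.
have {}ip := itg_le xL' ip; have {}iq := itg_le xL' iq.
have sub t : 0 <= t <= x -> 0 <= t <= L.
  by move=> /andP[-> tx]; rewrite (le_trans tx).
have bp := prim_bm ip; have bq := prim_bm iq.
have E1 : prim (fun t => p t * Q t) x = Q 0 * prim p x + prim (fun t => p t * prim q t) x.
  rewrite -primZ// -primD; [|exact: itgZ|exact: itgM_bm].
  by apply: eq_prim => t /sub /hQ ->; ring.
have E2 : prim (fun t => P t * q t) x = P 0 * prim q x + prim (fun t => q t * prim p t) x.
  rewrite -primZ// -primD; [|exact: itgZ|exact: itgM_bm].
  by apply: eq_prim => t /sub /hP ->; ring.
rewrite primD; [|exact: itg_le ipQ|exact: itg_le iPq].
by rewrite E1 E2 prim_mul// (hP x)// (hQ x)//; ring.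
Qed.

Lemma acX L P p n : ac L P p ->
  ac L (fun x => P x ^+ n.+1) (fun x => n.+1%:R * (P x ^+ n * p x)).
Proof.
move=> hP; elim: n => [|n IH].
  by apply: eq_ac hP => x _; rewrite ?expr1// expr0 !mul1r.
apply: eq_ac (acM hP IH) => x _; first by rewrite -exprS.
rewrite [in RHS]exprS -[in RHS]natr1 ![P x ^+ n.+1]exprS; ring.
Qed.

Lemma ac_poly L (r : {poly R}) : ac L (fun x => r.[x]) (fun x => r^`().[x]).
Proof.
elim/poly_ind: r => [|r c IH].
  by apply: eq_ac (ac_cst L 0) => x _; rewrite ?deriv0 horner0.
apply: eq_ac (acD (acM IH (ac_id L)) (ac_cst L c)) => x _; rewrite ?hornerE//.
by rewrite derivD derivC derivM derivX addr0 !hornerE.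
Qed.

Lemma ac_increment_le L P p M x y : ac L P p -> 0 <= x -> x <= y -> y <= L ->
  (forall t, x < t <= y -> `|p t| <= M) -> `|P y - P x| <= M * (y - x).
Proof.
move=> [ip hP] x0 xy yL pM; have y0 := le_trans x0 xy.
rewrite (hP x) ?x0 ?(le_trans xy)// (hP y) ?y0// opprD addrACA subrr add0r.
rewrite (prim_split ip)// mulrBr -(prim_cst M x0) -(prim_cst M y0).
rewrite (prim_split (itg_cst L M))//.
have sub : `]x, y] `<=` `[0, L] by apply: subset_itvScc; rewrite bnd_simp.
have ixy : mu.-integrable `]x, y] (EFin \o p) by apply: integrableS ip.
apply: le_trans (le_normr_Rintegral _ ixy) _ => //.
apply: le_Rintegral => //; first exact: integrable_norm ixy.
  by apply: integrableS (itg_cst L M).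
Qed.

Lemma ac_lip L P p M x y : ac L P p -> (forall t, 0 <= t <= L -> `|p t| <= M) ->
  0 <= x <= L -> 0 <= y <= L -> `|P y - P x| <= M * `|y - x|.
Proof.
move=> aP pM; wlog xy : x y / x <= y.
  move=> h xL yL; have [/h|/ltW/h] := leP x y; first exact.
  by rewrite distrC [`|x - y|]distrC; apply.
move=> /andP[x0 _] /andP[_ yL]; rewrite [`|y - x|]ger0_norm ?subr_ge0//.
apply: (ac_increment_le aP) => // t /andP[xt ty].
by apply: pM; rewrite (le_trans x0 (ltW xt)) (le_trans ty).
Qed.

Definition L2 L p : Prop := measurable_fun `[0, L] p /\ itg L (fun x => p x ^+ 2).
Definition sqn L p : R := prim (fun x => p x ^+ 2) L.

Lemma sqn_ge0 L p : 0 <= sqn L p.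
Proof. by apply: prim_ge0 => t _; apply: sqr_ge0. Qed.

Lemma eq_L2 L p q : (forall x, 0 <= x <= L -> p x = q x) -> L2 L p -> L2 L q.
Proof.
move=> pq [mp ip]; split; last by apply: eq_itg ip => x /pq ->.
by apply: eq_measurable_fun mp => x; rewrite inE /= in_itv /=; exact: pq.
Qed.

Lemma L2_mul L p q : L2 L p -> L2 L q -> itg L (fun x => p x * q x).
Proof.
move=> [mp ip] [mq iq]; apply: itg_dom (itgD ip iq); first exact: measurable_funM.
move=> x _; rewrite normrM -(real_normK (num_real (p x))) -(real_normK (num_real (q x))).
have := sqr_ge0 (`|p x| - `|q x|); have := normr_ge0 (p x); have := normr_ge0 (q x).
nra.
Qed.

Lemma bm_L2 L P : bm L P -> L2 L P.
Proof. by move=> h; split; [case: h|apply/bm_itg/bmX]. Qed.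

Lemma L2_itg L p : L2 L p -> itg L p.
Proof.
move=> h; have := L2_mul h (bm_L2 (bm_cst L 1)).
by apply: eq_itg => x _; rewrite mulr1.
Qed.

Lemma L2D L p q : L2 L p -> L2 L q -> L2 L (fun x => p x + q x).
Proof.
move=> hp hq; have [[mp ip] [mq iq]] := (hp, hq).
split; first exact: measurable_funD.
have := itgD (itgD ip iq) (itgZ 2 (L2_mul hp hq)); apply: eq_itg => x _; ring.
Qed.

Lemma L2Z L k p : L2 L p -> L2 L (fun x => k * p x).
Proof.
move=> [mp ip]; split; first by apply: measurable_funM => //; exact: measurable_cst.
by apply: eq_itg (itgZ (k ^+ 2) ip) => x _; rewrite exprMn.
Qed.

Lemma L2B L p q : L2 L p -> L2 L q -> L2 L (fun x => p x - q x).
Proof.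
by move=> hp /(L2Z (-1)) /(L2D hp); apply: eq_L2 => x _; rewrite mulN1r.
Qed.

Lemma L2_norm L p : L2 L p -> L2 L (fun x => `|p x|).
Proof.
move=> [mp ip]; split; first exact: measurableT_comp.
by apply: eq_itg ip => x _; rewrite real_normK ?num_real.
Qed.

Lemma quadratic_ge0 (a b c : R) : 0 <= a -> 0 <= c ->
  (forall t, 0 <= a - 2 * t * b + t ^+ 2 * c) -> b ^+ 2 <= a * c.
Proof.
move=> a0; rewrite le0r => /orP[/eqP ->|c0] h.
  have [->|b0] := eqVneq b 0; first by rewrite expr0n mulr0.
  (* For c = 0 the expression is affine in [t]; this [t] gives it the value -1. *)
  have := h ((a + 1) / (2 * b)); rewrite mulr0 addr0.
  rewrite (_ : 2 * _ * b = a + 1); last by field.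
  lra.
have := h (b / c); rewrite (_ : _ + _ = (a * c - b ^+ 2) / c).
  by rewrite pmulr_lge0 ?invr_gt0// subr_ge0.
by field; rewrite gt_eqF.
Qed.

Lemma cauchy_schwarz L p q : L2 L p -> L2 L q ->
  prim (fun x => p x * q x) L ^+ 2 <= sqn L p * sqn L q.
Proof.
move=> hp hq; apply: quadratic_ge0; rewrite ?sqn_ge0// => t.
have ipq := L2_mul hp hq; have [_ ip] := hp; have [_ iq] := hq.
have := sqn_ge0 L (fun x => p x - t * q x).
rewrite /sqn (@eq_prim _ _ _ (fun x => p x ^+ 2 + ((- (2 * t)) * (p x * q x) +
  t ^+ 2 * q x ^+ 2))); last by move=> x _; ring.
rewrite primD//; last by apply: itgD; apply: itgZ.
by rewrite primD; [|exact: itgZ..]; rewrite !primZ// mulNr addrA.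
Qed.

Lemma cauchy_schwarz_norm L p q : L2 L p -> L2 L q ->
  prim (fun x => `|p x * q x|) L ^+ 2 <= sqn L p * sqn L q.
Proof.
move=> hp hq; have := cauchy_schwarz (L2_norm hp) (L2_norm hq).
rewrite (@eq_prim _ _ _ (fun x => `|p x * q x|)); last by move=> t _; rewrite normrM.
congr (_ <= _ * _); apply: eq_prim => t _; exact/real_normK/num_real.
Qed.

End AbsolutelyContinuous.

(** * The linear boundary value problem *)

Section Hermite.
Variable R : realType.
Implicit Types (p r : {poly R}) (a : R).

Lemma derivn_mul_expXsubC p a n :
  (forall i, (i < n)%N -> (p * ('X - a%:P) ^+ n)^`(i).[a] = 0) /\
  (p * ('X - a%:P) ^+ n)^`(n).[a] = n`!%:R * p.[a].
Proof.
elim: n p => [|n IH] p; first by split=> //; rewrite expr0 mulr1 mul1r derivn0.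
have dE : (p * ('X - a%:P) ^+ n.+1)^`() =
    (p^`() * ('X - a%:P) + n.+1%:R *: p) * ('X - a%:P) ^+ n.
  rewrite derivM deriv_exp derivXsubC mul1r /= exprS.
  by rewrite -[_ *+ n.+1]mulr_natl -mul_polyC polyC_natr; ring.
have [IH1 IH2] := IH (p^`() * ('X - a%:P) + n.+1%:R *: p); split.
  case=> [|i] ni; first by rewrite derivn0 exprS hornerM hornerM hornerXsubC subrr mul0r mulr0.
  by rewrite derivSn dE IH1.
by rewrite derivSn dE IH2 hornerD hornerM hornerXsubC hornerZ subrr mulr0 add0r factS natrM; ring.
Qed.

(** Newton's scheme: a multiple of (X - L)^n added to [r] leaves the derivatives at [L] of order
    below [n] unchanged, and its coefficient adjusts the one of order [n] because X^l does not
    vanish at [L]. *)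
Lemma hermite (l : nat) (L : R) (b : nat -> R) n : L != 0 ->
  exists r, (size r <= n)%N /\ forall i, (i < n)%N -> ('X^l * r)^`(i).[L] = b i.
Proof.
move=> L0; elim: n => [|n [r [sr hr]]]; first by exists 0; rewrite size_poly0.
pose c := (b n - ('X^l * r)^`(n).[L]) / (n`!%:R * L ^+ l).
have fn0 : n`!%:R != 0 :> R by rewrite pnatr_eq0 -lt0n fact_gt0.
have [h1 h2] := derivn_mul_expXsubC ('X^l * c%:P) L n.
exists (r + c *: ('X - L%:P) ^+ n); split.
  apply: leq_trans (size_polyD _ _) _; rewrite geq_max leqW//=.
  by apply: leq_trans (size_scale_leq _ _) _; rewrite size_exp_XsubC.
move=> i; rewrite ltnS leq_eqVlt mulrDr derivnD hornerD -mul_polyC mulrA => /orP[/eqP ->|lt].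
  rewrite h2 hornerM hornerXn hornerC /c; set Q := _.[L]; set f := n`!%:R in fn0 *.
  have Ll : L ^+ l != 0 by rewrite expf_neq0.
  by field; rewrite fn0 Ll.
by rewrite hr// h1// addr0.
Qed.

(** A basis of the polynomials of degree at most 2l satisfying the conditions at 0, dual to the l +
    1 conditions at [L]: it corrects the iterated primitive of the right-hand side. The factor X^l
    takes care of 0. *)
Lemma hermite_basis (l : nat) (L : R) : L != 0 ->
  exists e : nat -> {poly R}, forall m,
    [/\ (e m)^`(2 * l + 1) = 0,
        forall i, (i < l)%N -> (e m)^`(i).[0] = 0 &
        forall i, (i <= l)%N -> (e m)^`(i).[L] = (i == m)%:R].
Proof.
move=> L0; have h m := hermite l (fun i => (i == m)%:R : R) l.+1 L0.
have [r hr] := choice h; exists (fun m => 'X^l * r m) => m.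
have [sr rm] := hr m; split=> [|i il|i il]; last exact: rm.
  apply: derivn_poly0; apply: leq_trans (size_polyMleq _ _) _.
  by rewrite size_polyXn /= mul2n -addnn addn1 -addnS leq_add2l.
have [h1 _] := derivn_mul_expXsubC (r m) 0 l.
by rewrite mulrC -['X]subr0 h1.
Qed.

End Hermite.

(** * The solution operator of D^(2l+1) u = F and its bounds *)

Section InverseOperator.
Variables (R : realType) (l : nat) (L : R) (e : nat -> {poly R}).
Hypothesis L_gt0 : 0 < L.
Hypothesis eP : forall m, [/\ (e m)^`(2 * l + 1) = 0,
  forall i, (i < l)%N -> (e m)^`(i).[0] = 0 &
  forall i, (i <= l)%N -> (e m)^`(i).[L] = (i == m)%:R].
Implicit Types (F G : R -> R).

(* [invop F 0] solves [D^(2l+1) u = F] under the boundary conditions, and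
   [invop F i] is its derivative of order [i]. *)
Definition invop F (i : nat) (x : R) : R :=
  iter (2 * l + 1 - i) (@prim R) F x
  - \sum_(0 <= m < l.+1) iter (2 * l + 1 - m) (@prim R) F L * (e m)^`(i).[x].

Lemma iter_prim_itg F n : itg L F -> itg L (iter n (@prim R) F).
Proof.
by move=> iF; elim: n => [//|n IH]; rewrite iterS; apply/bm_itg/ac_bm/ac_prim.
Qed.

Lemma iter_primB F G n x : itg L F -> itg L G -> 0 <= x <= L ->
  iter n (@prim R) (fun t => F t - G t) x =
  iter n (@prim R) F x - iter n (@prim R) G x.
Proof.
move=> iF iG; elim: n x => [//|n IH] x /andP[x0 xL].
rewrite !iterS -primB; [|exact: itg_le xL (iter_prim_itg _ _)..].
by apply: eq_prim => t /andP[t0 tx]; rewrite IH// t0 (le_trans tx).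
Qed.

Lemma iter_prim_le F n x : itg L F -> 0 <= x <= L ->
  `|iter n.+1 (@prim R) F x| <= L ^+ n * prim (fun t => `|F t|) L.
Proof.
move=> iF; elim: n x => [|n IH] x /andP[x0 xL].
  rewrite expr0 mul1r; apply: le_trans (le_norm_prim _) _; first exact: itg_le iF.
  by apply: (prim_le (itg_norm iF)).
rewrite iterS; apply: le_trans (le_norm_prim _) _; first exact: itg_le xL (iter_prim_itg _ _).
have P0 : 0 <= prim (fun t => `|F t|) L by apply: prim_ge0.
apply: (@le_trans _ _ (L ^+ n * prim (fun t => `|F t|) L * x)).
  rewrite -prim_cst//; apply: le_prim; [|exact: itg_cst|].
    exact/itg_norm/(itg_le xL)/iter_prim_itg.
  by move=> t /andP[t0 tx]; apply: IH; rewrite t0 (le_trans tx).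
rewrite exprS mulrC -[leRHS]mulrA ler_wpM2r// mulr_ge0// exprn_ge0// ltW//.
Qed.

Lemma invop_ac F i : itg L F -> (i <= 2 * l)%N -> ac L (invop F i) (invop F i.+1).
Proof.
move=> iF il; apply: acB.
  rewrite (_ : (2 * l + 1 - i = (2 * l + 1 - i.+1).+1)%N); last by lia.
  exact/ac_prim/iter_prim_itg.
apply: ac_sum => m; apply: acZ; rewrite derivnS; exact: ac_poly.
Qed.

Lemma invop0 F i : (i < l)%N -> invop F i 0 = 0.
Proof.
move=> il; rewrite /invop (_ : (2 * l + 1 - i = (2 * l - i).+1)%N); last by lia.
rewrite iterS prim0 big1 ?subr0// => m _; have [_ -> //] := eP m.
by rewrite mulr0.
Qed.

Lemma invopL F i : (i <= l)%N -> invop F i L = 0.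
Proof.
move=> il; have eL m : (e m)^`(i).[L] = (i == m)%:R by have [_ _ ->] := eP m.
rewrite /invop (bigD1_seq i) ?mem_index_iota ?iota_uniq ?ltnS//= eL eqxx mulr1.
rewrite big1 ?addr0 ?subrr// => m mi.
by rewrite eL eq_sym (negbTE mi) mulr0.
Qed.

Lemma invop_top F x : invop F (2 * l + 1) x = F x.
Proof.
rewrite /invop subnn /= big1 ?subr0// => m _.
by have [-> _ _] := eP m; rewrite horner0 mulr0.
Qed.

Lemma invopB F G i x : itg L F -> itg L G -> 0 <= x <= L ->
  invop (fun t => F t - G t) i x = invop F i x - invop G i x.
Proof.
move=> iF iG xL; rewrite /invop iter_primB//.
under eq_bigr do rewrite iter_primB ?lexx ?(ltW L_gt0)// mulrBl.
rewrite sumrB; ring.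
Qed.

Lemma invop_bound : exists K, 0 <= K /\ forall F, itg L F -> forall i x,
  (i <= 2 * l)%N -> 0 <= x <= L -> `|invop F i x| <= K * prim (fun t => `|F t|) L.
Proof.
have /choice[B hB] (im : nat * nat) : exists B, forall x, 0 <= x <= L ->
    `|(e im.2)^`(im.1).[x]| <= B.
  by have [_ [B hB]] := ac_bm (ac_poly L (e im.2)^`(im.1)); exists B.
have B0 im : 0 <= B im.
  by apply: le_trans (normr_ge0 _) (hB im 0 _); rewrite lexx ltW.
pose K i := L ^+ (2 * l - i) + \sum_(0 <= m < l.+1) L ^+ (2 * l - m) * B (i, m).
have K0 i : 0 <= K i.
  by rewrite addr_ge0 ?exprn_ge0 ?(ltW L_gt0)// sumr_ge0// => m _;
     rewrite mulr_ge0// exprn_ge0// ltW.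
exists (\sum_(0 <= i < (2 * l).+1) K i); split; first by rewrite sumr_ge0.
move=> F iF i x il xL; have P0 : 0 <= prim (fun t => `|F t|) L by apply: prim_ge0.
apply: (@le_trans _ _ (K i * prim (fun t => `|F t|) L)); last first.
  rewrite ler_wpM2r// (bigD1_seq i) ?mem_index_iota ?iota_uniq ?ltnS//=.
  by rewrite lerDl sumr_ge0.
have iterE j y : (j <= 2 * l)%N -> 0 <= y <= L ->
    `|iter (2 * l + 1 - j) (@prim R) F y| <= L ^+ (2 * l - j) * prim (fun t => `|F t|) L.
  move=> jl yL; rewrite (_ : (2 * l + 1 - j = (2 * l - j).+1)%N); last by lia.
  exact: iter_prim_le.
rewrite /invop /K mulrDl mulr_suml; apply: le_trans (ler_normB _ _) _.
apply: lerD; first exact: iterE.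
apply: le_trans (ler_norm_sum _ _ _) _; rewrite !big_nat; apply: ler_sum => m /andP[_ ml].
rewrite normrM [leRHS]mulrAC; apply: ler_pM => //; last exact: (hB (i, m)).
apply: iterE; last by rewrite lexx ltW.
by apply: leq_trans (_ : m <= l)%N _ => //; rewrite leq_pmull.
Qed.

End InverseOperator.

(** * A fixed point theorem *)

Section Compactness.
Variable R : realType.

(** Tychonoff's theorem for a product of segments. A neighbourhood controls finitely many
    coordinates only; equi-Lipschitz bounds later make this control uniform. *)
Lemma bounded_family_cluster (I : eqType) (B : R) (f : nat -> I -> R) :
  (forall n i, `|f n i| <= B) ->
  exists g : I -> R, forall e : R, 0 < e -> forall (s : seq I) N,
    exists2 n, (N <= n)%N & forall i, i \in s -> `|f n i - g i| < e.
Proof.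
move=> fB.
pose X : topologicalType := prod_topology (fun _ : I => R).
have cpt := @tychonoff I (fun=> R) (fun=> `[- B, B]%classic)
  (fun=> @segment_compact R (- B) B).
have [|g [_ gcl]] := cpt (f @ \oo) _.
  by exists 0%N => // n _ i /=; rewrite in_itv /= -ler_norml.
exists g => e e0 s N.
have near_s : nbhs (g : X) [set h : X | forall i, i \in s -> `|h i - g i| < e].
  elim: s => [|i s IH].
    by apply: (@filterS X (nbhs (g : X)) _ setT) => [h _ i|]; [rewrite in_nil|exact: filterT].
  have h1 : nbhs (g : X) [set h : X | `|h i - g i| < e].
    have hb : nbhs (g i) [set z : R | `|z - g i| < e].
      by apply/nbhs_ballP; exists e => // z; rewrite /ball /= distrC.
    exact: (@proj_continuous I (fun=> R) i g _ hb).
  have hI := @filterI X (nbhs (g : X)) (nbhs_filter _) _ _ h1 IH.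
  apply: (@filterS X (nbhs (g : X)) (nbhs_filter _) _ _ _ hI) => h [/= hi hs] j.
  by rewrite inE => /orP[/eqP ->|/hs].
have tail : (f @ \oo) [set h | exists2 n, (N <= n)%N & h = f n].
  by exists N => // n /= Nn; exists n.
have [h [[n Nn ->] hn]] := gcl _ _ tail near_s.
by exists n.
Qed.

Lemma lipschitz_measurable (L K : R) (g : R -> R) : 0 <= L ->
  (forall x y, 0 <= x <= L -> 0 <= y <= L -> `|g x - g y| <= K * `|x - y|) ->
  measurable_fun `[0, L] g.
Proof.
move=> L0 gK; apply: subspace_continuous_measurable_fun => //.
pose cl (x : R) := Num.max 0 (Num.min L x).
have cl01 x : 0 <= cl x <= L by rewrite /cl le_max lexx ge_max L0 ge_min lexx.
have clE x : 0 <= x <= L -> cl x = x.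
  by move=> /andP[x0 xL]; rewrite /cl min_r// max_r.
have clK x y : `|cl x - cl y| <= `|x - y|.
  rewrite /cl; have := ler_norm (x - y); have := ler_norm (y - x).
  rewrite [`|y - x|]distrC ler_norml.
  have [|] := leP L x; have [|] := leP L y;
  case: (leP 0 x); case: (leP 0 y); case: (leP 0 L); lra.
have cg : continuous (fun x => g (cl x)).
  move=> x; apply/cvgrPdist_lt => e e0; apply/nbhs_ballP.
  exists (e / (`|K| + 1)) => /=; first by rewrite divr_gt0.
  move=> y; rewrite /ball /= ltr_pdivlMr// => xy.
  apply: le_lt_trans xy; apply: le_trans (gK _ _ (cl01 _) (cl01 _)) _.
  rewrite mulrC; apply: (@le_trans _ _ (`|cl x - cl y| * (`|K| + 1))).
    by rewrite ler_wpM2l// (le_trans (ler_norm _))// lerDl.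
  by rewrite ler_wpM2r// ltW.
apply: (@subspace_eq_continuous _ _ _ (fun x => g (cl x))) => [x|].
  by rewrite inE /= in_itv /= => /clE ->.
exact: continuous_subspaceT.
Qed.

End Compactness.

(** * Fixed points of a compact map composed with a radial retraction *)

Section Schauder.
Variables (R : realType) (d : nat) (L M Lam K : R).
Hypotheses (L_gt0 : 0 < L) (M_gt0 : 0 < M) (Lam_ge0 : 0 <= Lam) (K_ge0 : 0 <= K).
Variable Psi : ('I_d.+1 -> R -> R) -> 'I_d.+1 -> R -> R.

Definition admissible (w : 'I_d.+1 -> R -> R) : Prop := forall i,
  measurable_fun `[0, L] (w i) /\ forall x, 0 <= x <= L -> `|w i x| <= M.

Hypothesis Psi_lip : forall w, admissible w -> forall i x y,
  0 <= x <= L -> 0 <= y <= L -> `|Psi w i x - Psi w i y| <= Lam * `|x - y|.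
Hypothesis Psi_cont : forall w w' dl, admissible w -> admissible w' ->
  (forall i x, 0 <= x <= L -> `|w i x - w' i x| <= dl) ->
  forall i x, 0 <= x <= L -> `|Psi w i x - Psi w' i x| <= K * dl.

(** One component of the radial retraction onto a ball of the sup norm, [s] and [t] being the
    scaling factors of the two arguments. One [eta] comes from the numerators, the other from the
    factors. *)
Lemma radial_lipschitz (a b s t eta : R) : 1 <= s -> 1 <= t -> `|b| <= M * t ->
  `|a - b| <= eta -> `|s - t| <= eta / M -> `|a / s - b / t| <= 2 * eta.
Proof.
move=> s1 t1 bt ab st; have s0 : 0 < s by lra.
have t0 : 0 < t by lra.
have eta0 : 0 <= eta by apply: le_trans ab.
rewrite (_ : a / s - b / t = (a - b) / s + b / t * ((t - s) / s)); last first.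
  by field; rewrite !gt_eqF.
apply: le_trans (ler_normD _ _) _.
have h1 : `|(a - b) / s| <= eta.
  rewrite normrM normfV (gtr0_norm s0) ler_pdivrMr//.
  by apply: le_trans ab _; rewrite ler_peMr.
suff h2 : `|b / t * ((t - s) / s)| <= eta by lra.
have h3 : `|b / t| <= M by rewrite normrM normfV (gtr0_norm t0) ler_pdivrMr.
have h4 : `|(t - s) / s| <= eta / M.
  rewrite normrM normfV (gtr0_norm s0) ler_pdivrMr// distrC.
  by apply: le_trans st _; rewrite ler_peMr// divr_ge0// ltW.
by rewrite normrM; apply: le_trans (ler_pM _ _ h3 h4) _ => //; rewrite mulrC divfK// gt_eqF.
Qed.

(* [u] is [Psi w] retracted radially to the ball of radius [M] by the factor [tau]. *)
Lemma approx_schauder n : exists (tau : R) (w u : 'I_d.+1 -> R -> R),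
  [/\ 0 <= tau <= 1, admissible w,
      forall i x, 0 <= x <= L -> u i x = tau * Psi w i x,
      forall i x, 0 <= x <= L -> `|u i x - w i x| <= (Lam * L + 1) / n.+1%:R &
      tau < 1 -> exists i x, 0 <= x <= L /\ `|u i x| = M].
Proof.
pose N := n.+1; pose h := L / N%:R.
have h0 : 0 < h by rewrite divr_gt0.
pose J := ('I_d.+1 * 'I_N.+1)%type.
pose pt (m : 'I_N.+1) : R := m%:R * h.
have pt01 m : 0 <= pt m <= L.
  apply/andP; split; first by rewrite /pt mulr_ge0// ltW.
  have -> : pt m = m%:R / N%:R * L by rewrite /pt /h mulrAC mulrA.
  by rewrite ler_piMl ?(ltW L_gt0)// ler_pdivrMr// mul1r ler_nat -ltnS.
pose idx (x : R) : 'I_N.+1 := inord (Num.truncn (x / h)).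
have idxE x : 0 <= x <= L -> idx x = Num.truncn (x / h) :> nat.
  move=> /andP[x0 xL]; rewrite inordK// ltnS -(ler_nat R).
  have /andP[+ _] := truncn_itv (divr_ge0 x0 (ltW h0)); move/le_trans; apply.
  by rewrite ler_pdivrMr// /h mulrC divfK ?gt_eqF.
have idxP x : 0 <= x <= L -> pt (idx x) <= x < pt (idx x) + h.
  move=> xL; have [x0 _] := andP xL.
  have := truncn_itv (divr_ge0 x0 (ltW h0)).
  rewrite ler_pdivlMr// ltr_pdivrMr// /pt idxE// -natr1 mulrDl mul1r.
  by [].
pose v (c : J -> R) j := M * (2 * c j - 1).
(* A point of the cube encodes a tuple of step functions with values in [-M, M]; sampling the image
   under [Psi] at the nodes returns to finitely many numbers. *)
pose st (c : J -> R) (i : 'I_d.+1) (x : R) := v c (i, idx x).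
have vM c j : in_cube c -> `|v c j| <= M.
  move=> /(_ j) /andP[c0 c1]; rewrite normrM gtr0_norm// ler_piMr ?(ltW M_gt0)//.
  by rewrite ler_norml; lra.
have st_meas c i : measurable_fun `[0, L] (st c i).
  have : bm L (fun x => \sum_(m <- enum 'I_N.+1) v c (i, m) * \1_(`[pt m, pt m + h[) x).
    apply: bm_sum => m _; apply: bmZ; split; last first.
      by exists 1 => x _; rewrite indicE; case: (_ \in _); rewrite ?normr1 ?normr0.
    by apply: measurable_funTS; exact: measurable_indic.
  case=> + _; apply: eq_measurable_fun => x; rewrite inE /= in_itv /= => xL.
  rewrite big_enum /= (bigD1 (idx x))//= indicE mem_set ?mulr1; last first.
    by rewrite /= in_itv /= idxP.
  rewrite big1 ?addr0// => m mx; rewrite indicE memNset ?mulr0//= in_itv /= => /andP[h1 h2].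
  have /andP[h3 h4] := idxP _ xL.
  move/eqP: mx; apply; apply: val_inj; apply/eqP; rewrite eqn_leq; apply/andP.
  split; rewrite -ltnS -(ltr_nat R) -natr1 -(ltr_pM2r h0) mulrDl mul1r.
    exact: le_lt_trans h1 h4.
  exact: le_lt_trans h3 h2.
have st_adm c : in_cube c -> admissible (st c).
  by move=> c01 i; split=> // x _; apply: vM.
pose a c (j : J) := Psi (st c) j.1 (pt j.2).
pose js c : J := [arg max_(j > (ord0, ord0)) `|a c j|]%O.
have jsP c j : `|a c j| <= `|a c (js c)|.
  by rewrite /js; case: arg_maxP => // j' _; apply.
(* One factor for all components and all nodes, so that the retraction is multiplication by a single
   [tau]. *)
pose s c := Num.max 1 (`|a c (js c)| / M).
have s1 c : 1 <= s c by rewrite /s le_max lexx.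
have s0 c : 0 < s c by apply: lt_le_trans (s1 c).
have aM c j : `|a c j| <= M * s c.
  apply: le_trans (jsP c j) _; rewrite mulrC -ler_pdivrMr//.
  by rewrite /s le_max lexx orbT.
pose y c j := a c j / s c.
have yM c j : `|y c j| <= M.
  by rewrite /y normrM normfV (gtr0_norm (s0 c)) ler_pdivrMr// aM.
pose G c j := (y c j / M + 1) / 2.
have G01 c : in_cube c -> in_cube (G c).
  move=> _ j; have := yM c j; rewrite /G ler_norml => /andP[y1 y2].
  have : -1 <= y c j / M by rewrite ler_pdivlMr// mulN1r.
  have : y c j / M <= 1 by rewrite ler_pdivrMr// mul1r.
  by move=> *; apply/andP; split; lra.
have GK c c' (dl : R) : in_cube c -> in_cube c' -> (forall j, `|c j - c' j| <= dl) ->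
    forall j, `|G c j - G c' j| <= 2 * K * dl.
  move=> c01 c01' cc' j.
  have hv j' : `|v c j' - v c' j'| <= 2 * M * dl.
    rewrite /v -mulrBr normrM (gtr0_norm M_gt0).
    rewrite (_ : 2 * c j' - 1 - _ = 2 * (c j' - c' j')); last by ring.
    by rewrite normrM ger0_norm// mulrCA mulrA ler_wpM2l ?mulr_ge0 ?(ltW M_gt0).
  have ha j' : `|a c j' - a c' j'| <= K * (2 * M * dl).
    by apply: Psi_cont => //; [exact: st_adm..|move=> i x xL; exact: hv].
  have hs : `|s c - s c'| <= K * (2 * M * dl) / M.
    have h1 : `| `|a c (js c)| - `|a c' (js c')| | <= K * (2 * M * dl).
      have hn j' : - (K * (2 * M * dl)) <= `|a c j'| - `|a c' j'| <= K * (2 * M * dl).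
        by rewrite -ler_norml; exact: le_trans (ler_dist_dist _ _) (ha j').
      have /andP[n1 n2] := hn (js c); have /andP[n3 n4] := hn (js c').
      have n5 := jsP c (js c'); have n6 := jsP c' (js c).
      by rewrite ler_norml; apply/andP; split; lra.
    rewrite ler_pdivlMr//; apply: le_trans h1; rewrite /s.
    set A := `|a c _|; set A' := `|a c' _|.
    have -> : `|A - A'| = `|A / M - A' / M| * M.
      by rewrite -mulrBl normrM normfV (gtr0_norm M_gt0) divfK ?gt_eqF.
    rewrite ler_wpM2r ?(ltW M_gt0)//.
    case: (leP 1 (A / M)); case: (leP 1 (A' / M)) => h2 h3; rewrite ?subrr ?normr0//.
      by rewrite !ger0_norm; lra.
    by rewrite !ler0_norm; lra.
  have := radial_lipschitz (s1 c) (s1 c') (aM c' j) (ha j) hs.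
  rewrite -/(y c j) -/(y c' j) => hy.
  rewrite /G (_ : _ - _ = (y c j - y c' j) / (2 * M)); last by field; rewrite gt_eqF.
  have M2 : 0 < 2 * M by rewrite mulr_gt0.
  rewrite normrM normfV (gtr0_norm M2) ler_pdivrMr//; lra.
(* Passing from cube coordinates to values multiplies errors by 2 M, so this tolerance becomes 1 /
   N. *)
have e0 : 0 < (2 * M * N%:R)^-1 by rewrite invr_gt0 !mulr_gt0.
have [c [c01 Gc]] := approx_brouwer G01 GK e0.
have yv j : `|y c j - v c j| <= N%:R^-1.
  have := Gc j; rewrite /G /v (_ : _ - c j = (y c j - M * (2 * c j - 1)) / (2 * M)); last first.
    by field; rewrite gt_eqF.
  have M2 : 0 < 2 * M by rewrite mulr_gt0.
  rewrite normrM normfV (gtr0_norm M2) ler_pdivrMr//.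
  by rewrite (_ : _ * (2 * M) = N%:R^-1)//; field; rewrite !gt_eqF.
have si1 : 0 <= (s c)^-1 <= 1 by rewrite invr_ge0 ltW//= invf_le1.
exists (s c)^-1, (st c), (fun i x => (s c)^-1 * Psi (st c) i x); split=> //.
- exact: st_adm.
- move=> i x xL; have /andP[h1 h2] := idxP _ xL.
  have := yv (i, idx x); rewrite -/(st c i x) /y /a /= => h3.
  have h4 : `|Psi (st c) i x - Psi (st c) i (pt (idx x))| <= Lam * h.
    apply: le_trans (Psi_lip (st_adm _ c01) _ _ _) _ => //; rewrite ler_wpM2l// ger0_norm; lra.
  have h5 : `|(s c)^-1 * (Psi (st c) i x - Psi (st c) i (pt (idx x)))| <= Lam * h.
    rewrite normrM ger0_norm ?invr_ge0 ?(ltW (s0 c))//.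
    by apply: le_trans h4; rewrite ler_piMl//; case/andP: si1.
  rewrite (_ : _ - st c i x = (s c)^-1 * (Psi (st c) i x - Psi (st c) i (pt (idx x))) +
    (Psi (st c) i (pt (idx x)) / s c - st c i x)); last by ring.
  apply: le_trans (ler_normD _ _) _; rewrite mulrDl mul1r lerD//.
  by rewrite -mulrA.
- move=> lt1; exists (js c).1, (pt (js c).2); split=> //.
  have : s c = `|a c (js c)| / M.
    rewrite /s; have [h1|h1] := leP 1 (`|a c (js c)| / M); first by [].
    by move: lt1; rewrite /s max_l ?invr1 ?ltxx// ltW.
  move=> sE; rewrite normrM normfV (gtr0_norm (s0 c)) sE invf_div -/(a c (js c)).
  rewrite divfK//; apply/eqP => a0; have := s1 c; rewrite sE a0 mul0r; lra.
Qed.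

(** Functions and factors are clustered jointly. If the limit factor is below 1, the approximants
    close to the limit touch the sphere of radius [M], so the limit comes within any [e] of it. *)
Lemma schauder : exists (tau : R) (w : 'I_d.+1 -> R -> R),
  [/\ 0 <= tau <= 1, admissible w,
      forall i x, 0 <= x <= L -> w i x = tau * Psi w i x &
      tau = 1 \/ forall e, 0 < e -> exists i x, 0 <= x <= L /\ M - e <= `|w i x|].
Proof.
have [tau0 h0] := choice approx_schauder; have [w0 h1] := choice h0.
have [u {h0 h1}hu] := choice h1.
pose C := Lam * L + 1.
have C0 : 0 < C by rewrite ltr_wpDl// mulr_ge0// ltW.
have uM n i x : 0 <= x <= L -> `|u n i x| <= M + C / n.+1%:R.
  move=> xL; have [_ adm _ uw _] := hu n.
  rewrite -[u n i x](subrK (w0 n i x)); apply: le_trans (ler_normD _ _) _.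
  by rewrite addrC lerD//; [case: (adm i) => _; exact|exact: uw].
have Cn n : C / n.+1%:R <= C.
  by rewrite ler_pdivrMr ?ltr0n// ler_peMr ?(ltW C0)// ler1n.
pose Idx := option ('I_d.+1 * R).
(* The index [None] carries the factor; values outside [0, L] are set to 0 to keep the family
   bounded. *)
pose f n (o : Idx) : R := match o with
  | None => tau0 n
  | Some ix => if 0 <= ix.2 <= L then u n ix.1 ix.2 else 0 end.
have fB n o : `|f n o| <= M + C + 1.
  case: o => [[i x]|] /=.
    case: ifP => xL; last by rewrite normr0; have := M_gt0; lra.
    by apply: le_trans (uM n i x xL) _; rewrite -addrA lerD2l (le_trans (Cn n))// lerDl.
  by have [/andP[t0 t1] _ _ _ _] := hu n; rewrite ger0_norm//; have := M_gt0; lra.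
have [g gP] := bounded_family_cluster fB.
pose tau := g None; pose w i x := g (Some (i, x)).
have uL n i x y : 0 <= x <= L -> 0 <= y <= L -> `|u n i x - u n i y| <= Lam * `|x - y|.
  move=> xL yL; have [/andP[t0 t1] adm uE _ _] := hu n.
  rewrite !uE// -mulrBr normrM ger0_norm//.
  by apply: le_trans (Psi_lip adm i xL yL); rewrite ler_piMl.
have wL i x y : 0 <= x <= L -> 0 <= y <= L -> `|w i x - w i y| <= Lam * `|x - y|.
  move=> xL yL; apply/ler_addgt0Pr => e e0.
  have e2 : 0 < e / 2 by rewrite divr_gt0.
  have [n _ hn] := gP _ e2 [:: Some (i, x); Some (i, y)] 0%N.
  have := hn (Some (i, x)); have := hn (Some (i, y)).
  rewrite !inE !eqxx orbT /= xL yL => /(_ isT) hy /(_ isT) hx.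
  have := uL n i x y xL yL; set K1 := Lam * _.
  move: hx hy; rewrite -/(w i x) -/(w i y) !ltr_norml !ler_norml.
  by move=> /andP[? ?] /andP[? ?] /andP[? ?]; apply/andP; split; lra.
(* Closeness at the nodes of a mesh [h] becomes uniform: the oscillations of both functions on a
   cell use half of [e], the node values the other half. *)
have unif e N : 0 < e -> exists n, [/\ (N <= n)%N, `|tau0 n - tau| <= e &
    forall i x, 0 <= x <= L -> `|u n i x - w i x| <= e].
  move=> e0; pose m := Num.truncn (4 * Lam * L / e).
  have m1 : 4 * Lam * L / e < m.+1%:R by apply: truncnS_gt.
  pose h := L / m.+1%:R.
  have h0 : 0 < h by rewrite divr_gt0.
  have Lh : 2 * (Lam * h) <= e / 2.
    have : 4 * Lam * L <= m.+1%:R * e by rewrite -ler_pdivrMr// ltW.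
    have -> : 2 * (Lam * h) = 4 * Lam * L / m.+1%:R / 2 by rewrite /h; field; rewrite nat1r pnatr_eq0.
    by move=> hE; rewrite ler_pM2r ?invr_gt0// ler_pdivrMr// [e * _]mulrC.
  pose s : seq Idx := None :: [seq Some (i, k%:R * h) | i <- enum 'I_d.+1, k <- iota 0 m.+2].
  have e2 : 0 < e / 2 by rewrite divr_gt0.
  have [n Nn hn] := gP _ e2 s N; exists n; split=> //.
    by apply/ltW/(lt_trans (hn None _)); rewrite ?inE//; lra.
  move=> i x xL; have [x0 xL'] := andP xL.
  pose k := Num.truncn (x / h); pose y := k%:R * h.
  have /andP[k1 k2] := truncn_itv (divr_ge0 x0 (ltW h0)).
  have yx : y <= x by rewrite -ler_pdivlMr.
  have xy : x < y + h by move: k2; rewrite ltr_pdivrMr// -natr1 mulrDl mul1r.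
  have yL : 0 <= y <= L by rewrite mulr_ge0 ?(ltW h0)//= (le_trans yx).
  have km : (k < m.+2)%N.
    rewrite ltnS -(ler_nat R) (le_trans k1)// ler_pdivrMr// /h mulrC divfK// gt_eqF//.
  have := hn (Some (i, y)); rewrite /= yL -/(w i y) => hy.
  have {}hy : `|u n i y - w i y| < e / 2.
    apply: hy; rewrite inE; apply/orP; right; apply/allpairsP.
    by exists (i, k); split; rewrite ?mem_enum ?mem_iota ?add0n.
  have xyn : `|x - y| <= h by rewrite ger0_norm; lra.
  have h1 : `|u n i x - u n i y| <= Lam * h.
    by apply: le_trans (uL n i x y xL yL) _; rewrite ler_wpM2l.
  have h2 : `|w i x - w i y| <= Lam * h.
    by apply: le_trans (wL i x y xL yL) _; rewrite ler_wpM2l.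
  move: h1 h2 hy; rewrite !ler_norml ltr_norml => /andP[? ?] /andP[? ?] /andP[? ?].
  by apply/andP; split; lra.
have tau01 : 0 <= tau <= 1.
  apply/andP; split; apply/ler_addgt0Pr => e e0;
    have [n [_ + _]] := unif e 0%N e0; have [/andP[t0 t1] _ _ _ _] := hu n;
    rewrite ler_norml => /andP[? ?]; lra.
have Nbig e : 0 < e -> exists N, forall n, (N <= n)%N -> C / n.+1%:R <= e.
  move=> e0; exists (Num.truncn (C / e)) => n Nn.
  rewrite ler_pdivrMr ?ltr0n// mulrC -ler_pdivrMr//.
  by apply: le_trans (ltW (truncnS_gt _)) _; rewrite ler_nat.
have wM i x : 0 <= x <= L -> `|w i x| <= M.
  move=> xL; apply/ler_addgt0Pr => e e0.
  have e2 : 0 < e / 2 by rewrite divr_gt0.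
  have [N hN] := Nbig _ e2; have [n [/hN Cn2 _ un]] := unif _ N e2.
  rewrite -[w i x](subKr (u n i x)); apply: le_trans (ler_normB _ _) _.
  by apply: le_trans (lerD (uM n i x xL) (un i x xL)) _; move: Cn2; set q := C / _; lra.
have wadm : admissible w.
  by move=> i; split; [apply: (lipschitz_measurable (ltW L_gt0) (wL i))|exact: wM].
exists tau, w; split=> //.
- move=> i x xL; apply/eqP; rewrite -subr_eq0 -normr_le0.
  apply/ler_addgt0Pr => e e0; rewrite add0r.
  pose D := 1 + 2 * K + `|Psi w i x|.
  have D0 : 0 < D by rewrite /D ltr_wpDr// ltr_wpDr// mulr_ge0.
  have e2 : 0 < e / D by rewrite divr_gt0.
  have [N hN] := Nbig _ e2; have [n [/hN Cn2 tn un]] := unif _ N e2.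
  have [/andP[t0 t1] adm uE uw _] := hu n.
  have ww : forall j y, 0 <= y <= L -> `|w0 n j y - w j y| <= 2 * (e / D).
    move=> j y yL; rewrite -(subrKA (u n j y)).
    apply: le_trans (ler_normD _ _) _; rewrite mulrDl mul1r lerD ?un//.
    by rewrite distrC (le_trans (uw j y yL)).
  have hP := Psi_cont adm wadm ww i xL.
  rewrite (_ : w i x - _ = - (u n i x - w i x) +
    tau0 n * (Psi (w0 n) i x - Psi w i x) + (tau0 n - tau) * Psi w i x); last first.
    by rewrite uE//; ring.
  apply: le_trans (ler_normD _ _) _; apply: (@le_trans _ _ (e / D + K * (2 * (e / D)) +
    e / D * `|Psi w i x|)).
    apply: lerD; last by rewrite normrM ler_wpM2r.
    apply: le_trans (ler_normD _ _) _; rewrite normrN lerD ?un// normrM ger0_norm//.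
    by apply: le_trans hP; rewrite ler_piMl.
  rewrite (_ : _ + _ = e)//; rewrite /D; field; rewrite -/D gt_eqF//.
- have [t1|t1] := eqVneq tau 1; [by left|right] => e e0.
  have {}t1 : tau < 1 by rewrite lt_neqAle t1; case/andP: tau01.
  pose e' := Num.min e ((1 - tau) / 2).
  have e'0 : 0 < e' by rewrite lt_min e0 divr_gt0// subr_gt0.
  have ee : e' <= e by rewrite ge_min lexx.
  have et : e' <= (1 - tau) / 2 by rewrite ge_min lexx orbT.
  have [n [_ tn un]] := unif _ 0%N e'0.
  have [_ _ _ _ hM] := hu n.
  have [|i [x [xL ux]]] := hM; first by move: tn; rewrite ler_norml => /andP[? ?]; lra.
  exists i, x; split=> //; have := un i x xL; rewrite -ux distrC => h.
  have := ler_normD (u n i x - w i x) (w i x); rewrite subrK distrC; lra.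
Qed.

End Schauder.

(** * A priori estimates *)

Section Energy.
Variables (R : realType) (L : R) (l : nat) (U : nat -> R -> R).
Hypothesis L_gt0 : 0 < L.
Hypothesis l_gt0 : (0 < l)%N.

Lemma itg_sum (I : eqType) (s : seq I) (F : I -> R -> R) x :
  (forall i, i \in s -> itg x (F i)) -> itg x (fun t => \sum_(i <- s) F i t).
Proof.
elim: s => [|i s IH] h; first by apply: eq_itg (itg_cst x 0) => t _; rewrite big_nil.
have hs : itg x (fun t => \sum_(i <- s) F i t).
  by apply: IH => j js; apply: h; rewrite inE js orbT.
by apply: eq_itg (itgD (h i (mem_head _ _)) hs) => t _; rewrite big_cons.
Qed.

Lemma prim_sum (I : eqType) (s : seq I) (F : I -> R -> R) x :
  (forall i, i \in s -> itg x (F i)) ->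
  prim (fun t => \sum_(i <- s) F i t) x = \sum_(i <- s) prim (F i) x.
Proof.
elim: s => [|i s IH] h.
  rewrite big_nil (@eq_prim _ _ _ (fun=> 0 * 0)); last by move=> t _; rewrite big_nil mulr0.
  by rewrite primZ ?mul0r//; exact: itg_cst.
have hs j : j \in s -> itg x (F j) by move=> js; apply: h; rewrite inE js orbT.
rewrite big_cons -IH// -primD; [|exact/h/mem_head|exact: itg_sum].
by apply: eq_prim => t _; rewrite big_cons.
Qed.

Lemma prim_ibp P p Q q : ac L P p -> ac L Q q ->
  prim (fun x => P x * q x) L = P L * Q L - P 0 * Q 0 - prim (fun x => p x * Q x) L.
Proof.
move=> aP aQ; have [_ h] := acM aP aQ.
have := h L; rewrite lexx ltW// => /(_ isT) ->.
have [[ip _] [iq _]] := (aP, aQ).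
rewrite primD ?addrK//; first by ring.
  exact: itgM_bm ip (ac_bm aQ).
by apply: eq_itg (itgM_bm iq (ac_bm aP)) => x _; rewrite mulrC.
Qed.

Lemma prim_ac P p : ac L P p -> prim p L = P L - P 0.
Proof.
move=> [_ h]; have := h L; rewrite lexx ltW// => /(_ isT) ->.
by rewrite addrAC subrr add0r.
Qed.

(* [U i] stands for [D^i u]; [U (2 * l + 1)] is merely integrable. *)
Definition tower : Prop :=
  [/\ forall i, (i <= 2 * l)%N -> ac L (U i) (U i.+1),
      forall i, (i < l)%N -> U i 0 = 0 & forall i, (i <= l)%N -> U i L = 0].

Hypothesis hU : tower.

Let Uac i : (i <= 2 * l)%N -> ac L (U i) (U i.+1).
Proof. by case: hU => h _ _; apply: h. Qed.
Let U0 i : (i < l)%N -> U i 0 = 0.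
Proof. by case: hU => _ h _; apply: h. Qed.
Let UL i : (i <= l)%N -> U i L = 0.
Proof. by case: hU => _ _ h; apply: h. Qed.
Let Ubm i : (i <= 2 * l)%N -> bm L (U i).
Proof. by move=> /Uac/ac_bm. Qed.
Let Uitg i : (i <= 2 * l + 1)%N -> itg L (U i).
Proof.
rewrite addn1 leq_eqVlt ltnS => /orP[/eqP ->|/Ubm/bm_itg//].
by have [] := Uac (leqnn _).
Qed.

(** What the term of order 2j + 1 leaves after testing with (al + be x) u. The boundary part can be
    nonzero for j = l only. *)
Definition energy (al be : R) (j : nat) : R :=
  be * ((2 * j + 1)%:R / 2) * sqn L (U j) + al / 2 * U j 0 ^+ 2.

(** For an affine weight [w], D^i(w u) = w D^i u + i w' D^(i-1) u. The first [j] integrations by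
    parts have no boundary terms. Of the two integrals left, D^(j+1) u times w D^j u yields be/2 and
    the boundary term at 0, and D^(j+1) u times D^(j-1) u yields be j. *)
Lemma energy_identity (al be : R) (j : nat) : (j <= l)%N ->
  (-1) ^+ (j + 1) * prim (fun x => U (2 * j + 1) x * ((al + be * x) * U 0 x)) L =
  energy al be j.
Proof.
move=> jl.
pose w x : R := al + be * x.
(* At i = 0 the factor [i%:R] removes the spurious second term. *)
pose V i x := w x * U i x + i%:R * be * U i.-1 x.
have aw : ac L w (fun=> be).
  by apply: eq_ac (acD (ac_cst L al) (acZ be (ac_id L))) => x _; rewrite ?add0r ?mulr1.
have aV i : (i <= 2 * l)%N -> ac L (V i) (V i.+1).
  move=> il; case: i il => [|i] il.
    apply: eq_ac (acM aw (Uac il)) => x _; rewrite /V /=; ring.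
  apply: eq_ac (acD (acM aw (Uac il)) (acZ (i.+1%:R * be) (Uac (ltnW il)))) => x _ //.
  by rewrite /V /= -[i.+2%:R]natr1; ring.
have V0 i : (i < j)%N -> V i 0 = 0.
  move=> ij; have il := leq_trans ij jl.
  by rewrite /V !U0// ?mulr0 ?addr0//; apply: leq_ltn_trans il; exact: leq_pred.
have VL i : (i < j)%N -> V i L = 0.
  move=> ij; have il : (i <= l)%N by rewrite ltnW// (leq_trans ij).
  by rewrite /V !UL// ?mulr0 ?addr0//; apply: leq_trans il; exact: leq_pred.
have step i : (i <= j)%N -> prim (fun x => U (2 * j + 1) x * V 0 x) L =
    (-1) ^+ i * prim (fun x => U (2 * j + 1 - i) x * V i x) L.
  elim: i => [|i IH] ij; first by rewrite subn0 expr0 mul1r.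
  rewrite IH ?(ltnW ij)//.
  have h1 : (2 * j - i <= 2 * l)%N by apply: leq_trans (leq_subr _ _) _; rewrite leq_mul2l.
  have h2 : (i <= 2 * l)%N by apply: leq_trans (ltnW ij) (leq_trans jl (leq_pmull _ _)).
  have e1 : (2 * j + 1 - i = (2 * j - i).+1)%N by lia.
  have := prim_ibp (aV i h2) (Uac h1); rewrite V0// VL// !mul0r subrr sub0r => e2.
  rewrite e1 (@eq_prim _ _ _ (fun x => V i x * U (2 * j - i).+1 x)); last by move=> x _; rewrite mulrC.
  rewrite e2 exprS mulN1r mulrN mulNr; congr (- (_ * _)).
  rewrite (_ : (2 * j + 1 - i.+1 = 2 * j - i)%N); last by lia.
  by apply: eq_prim => x _; rewrite mulrC.
have jl2 : (j <= 2 * l)%N by apply: leq_trans jl (leq_pmull _ _).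
have := step j (leqnn j); rewrite (_ : (2 * j + 1 - j = j.+1)%N); last by lia.
rewrite (@eq_prim _ _ _ (fun x => U (2 * j + 1) x * ((al + be * x) * U 0 x))); last first.
  by move=> x _; rewrite /V /w mul0r mul0r addr0.
move=> ->.
have itgUU p q : (p <= 2 * l + 1)%N -> (q <= 2 * l)%N -> itg L (fun x => U p x * U q x).
  by move=> hp hq; apply: itgM_bm (Uitg hp) (Ubm hq).
have jS : (j.+1 <= 2 * l + 1)%N by rewrite addn1 ltnS.
have e1 : prim (fun x => U j.+1 x * (w x * U j x)) L =
    - (al * U j 0 ^+ 2 + be * sqn L (U j)) / 2.
  have h := prim_ac (acM aw (acX 1 (Uac jl2))).
  rewrite UL// expr0n mulr0 sub0r /w mulr0 addr0 in h.
  have iw : itg L (fun x => U j.+1 x * (w x * U j x)).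
    by apply: itgM_bm (Uitg jS) (bmM (ac_bm aw) (Ubm jl2)).
  have iu : itg L (fun x => U j x ^+ 2) by apply/bm_itg/bmX/Ubm.
  rewrite (@eq_prim _ _ _ (fun x => be * U j x ^+ 2 + 2 * (U j.+1 x * (w x * U j x)))) in h; last first.
    by move=> x _; rewrite expr1 /w; ring.
  rewrite primD ?primZ -/(sqn L (U j)) in h; [|done..|exact: itgZ|exact: itgZ].
  lra.
have e2 : j%:R * prim (fun x => U j.+1 x * U j.-1 x) L = - (j%:R * sqn L (U j)).
  case: j jl jl2 jS {V0 VL step e1} => [|j] jl jl2 jS; first by rewrite !mul0r oppr0.
  have h := prim_ibp (Uac (ltnW jl2)) (Uac jl2).
  rewrite /= (@eq_prim _ _ _ (fun x => U j x * U j.+2 x)); last by move=> x _; rewrite mulrC.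
  rewrite h UL ?(ltnW jl)// U0// !mul0r subrr sub0r mulrN /sqn; congr (- (_ * _)).
have e3 : prim (fun x => U j.+1 x * V j x) L =
    prim (fun x => U j.+1 x * (w x * U j x)) L + be * (j%:R * prim (fun x => U j.+1 x * U j.-1 x) L).
  have i1 : itg L (fun x => U j.+1 x * U j.-1 x).
    exact: (itgUU _ _ jS (leq_trans (leq_pred _) jl2)).
  rewrite mulrA -primZ// -primD; [|exact: itgM_bm (Uitg jS) (bmM (ac_bm aw) (Ubm jl2))|exact: itgZ].
  by apply: eq_prim => x _; rewrite /V; ring.
rewrite e3 e1 e2 addn1 exprS mulN1r mulNr mulrA -expr2 sqrr_sign mul1r.
by rewrite /energy natrD natrM; field.
Qed.

Lemma energy_ge0 (al be : R) j : 0 <= al -> 0 <= be -> 0 <= energy al be j.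
Proof.
by move=> al0 be0; rewrite addr_ge0// mulr_ge0 ?sqr_ge0 ?sqn_ge0 ?mulr_ge0 ?divr_ge0.
Qed.

(** u^(k+1) Du is the derivative of u^(k+2) / (k+2), so only the slope [be] of the weight
    survives. *)
Lemma nonlinear_identity (al be : R) (k : nat) :
  prim (fun x => U 0 x ^+ k * U 1 x * ((al + be * x) * U 0 x)) L =
  - (be / (k + 2)%:R * prim (fun x => U 0 x ^+ (k + 2)) L).
Proof.
have h0 : (0 <= 2 * l)%N by [].
have aw : ac L (fun x => al + be * x) (fun=> be).
  by apply: eq_ac (acD (ac_cst L al) (acZ be (ac_id L))) => x _; rewrite ?add0r ?mulr1.
have h := prim_ac (acM aw (acX k.+1 (Uac h0))).
rewrite UL// U0// !expr0n !mulr0 subrr in h.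
have bU := Ubm h0.
have i1 : itg L (fun x => U 0 x ^+ k * U 1 x * ((al + be * x) * U 0 x)).
  apply: eq_itg (itgM_bm (Uitg (_ : 1 <= 2 * l + 1)%N) (bmM (bmX k bU) (bmM (ac_bm aw) bU))).
    by move=> x _; ring.
  by rewrite addn1.
have i2 : itg L (fun x => U 0 x ^+ (k + 2)) by apply/bm_itg/bmX.
rewrite (@eq_prim _ _ _ (fun x => be * U 0 x ^+ (k + 2) +
  (k + 2)%:R * (U 0 x ^+ k * U 1 x * ((al + be * x) * U 0 x)))) in h; last first.
  by move=> x _; rewrite addn2 [_ ^+ k.+1]exprSr; ring.
rewrite primD ?primZ in h; [|done..|exact: itgZ|exact: itgZ].
have k0 : (k + 2)%:R != 0 :> R by rewrite pnatr_eq0 addn2.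
apply: (mulfI k0); move/eqP: h; rewrite addr_eq0 => /eqP h.
by rewrite mulrN mulrA mulrCA divff// mulr1 h opprK.
Qed.

Variables (a tau : R) (k : nat) (f : R -> R).
Hypothesis f_L2 : L2 L f.
Hypothesis a_gt0 : 0 < a.
Hypothesis tau01 : 0 < tau <= 1.

Definition scaled_equation : Prop := forall x, 0 <= x <= L ->
  (-1) ^+ (l + 1) * U (2 * l + 1) x = tau * (f x - (a * U 0 x
    + \sum_(1 <= j < l) (-1) ^+ (j + 1) * U (2 * j + 1) x + U 0 x ^+ k * U 1 x)).
Hypothesis eqn : scaled_equation.

(** The equation tested with (al + be x) u. The energy of order [l] stands apart as the only one
    without the factor [tau]. *)
Lemma energy_balance (al be : R) :
  energy al be l + tau * (a * prim (fun x => (al + be * x) * U 0 x ^+ 2) L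
    + \sum_(1 <= j < l) energy al be j) =
  tau * (prim (fun x => f x * ((al + be * x) * U 0 x)) L
    + be / (k + 2)%:R * prim (fun x => U 0 x ^+ (k + 2)) L).
Proof.
pose W x : R := (al + be * x) * U 0 x.
have h0 : (0 <= 2 * l)%N by [].
have bW : bm L W by apply: bmM (Ubm h0); apply: bmD (bm_cst L al) (bmZ be (bm_id L)).
have b1 : bm L (U 1) by apply: Ubm; rewrite muln_gt0.
have bk : bm L (fun x => U 0 x ^+ k * U 1 x) by apply: bmM b1; apply/bmX/Ubm.
pose S x := \sum_(1 <= j < l) (-1) ^+ (j + 1) * U (2 * j + 1) x.
have bUj j : j \in index_iota 1 l -> bm L (U (2 * j + 1)).
  by rewrite mem_index_iota => /andP[_ jl]; apply: Ubm; lia.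
have bS : bm L S by apply: bm_sum => j /bUj; exact: bmZ.
have iS : prim (fun x => S x * W x) L = \sum_(1 <= j < l) energy al be j.
  rewrite (@eq_prim _ _ _ (fun x => \sum_(1 <= j < l) (-1) ^+ (j + 1) * (U (2 * j + 1) x * W x))); last first.
    by move=> x _; rewrite mulr_suml; apply: eq_bigr => j _; rewrite -mulrA.
  rewrite prim_sum; last by move=> j jl; apply/itgZ/bm_itg/bmM => //; exact: bUj.
  rewrite !big_seq; apply: eq_bigr => j jl.
  rewrite primZ; last by apply/bm_itg/bmM => //; exact: bUj.
  by rewrite -energy_identity//; move: jl; rewrite mem_index_iota => /andP[_ /ltnW].
have := energy_identity al be (leqnn l).
have iT : itg L (fun x => U (2 * l + 1) x * W x) by apply: itgM_bm => //; apply: Uitg.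
rewrite -(primZ _ iT).
have if_ : itg L (fun x => f x * W x) by apply: itgM_bm => //; apply: L2_itg.
have iu : itg L (fun x => (al + be * x) * U 0 x ^+ 2).
  by apply: eq_itg (bm_itg (bmM bW (Ubm h0))) => x _; rewrite /W; ring.
have iSW : itg L (fun x => S x * W x) by apply/bm_itg/bmM.
have ikW : itg L (fun x => U 0 x ^+ k * U 1 x * W x) by apply/bm_itg/bmM.
rewrite (@eq_prim _ _ _ (fun x => tau * (f x * W x - (a * ((al + be * x) * U 0 x ^+ 2)
  + S x * W x + U 0 x ^+ k * U 1 x * W x)))); last first.
  by move=> x xL; rewrite [LHS]mulrA eqn// -/(S x) /W; ring.
have i1 : itg L (fun x => a * ((al + be * x) * U 0 x ^+ 2) + S x * W x).
  by apply: itgD => //; apply: itgZ.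
have i2 := itgD i1 ikW.
rewrite primZ; last by apply: eq_itg (itgD if_ (itgZ (-1) i2)) => x _; ring.
rewrite primB// primD// primD//; last exact: itgZ.
rewrite primZ// iS nonlinear_identity => <-; ring.
Qed.

(** With a constant weight the nonlinear term integrates to 0 and [tau] cancels; what remains is a
    |u|^2 <= (f, u). *)
Lemma sqn_le_forcing : a ^+ 2 * sqn L (U 0) <= sqn L f.
Proof.
have h := energy_balance 1 0.
have h0 : (0 <= 2 * l)%N by [].
rewrite !mul0r addr0 in h.
rewrite (@eq_prim _ _ (fun x => (1 + 0 * x) * U 0 x ^+ 2) (fun x => U 0 x ^+ 2)) in h; last by move=> x _; ring.
rewrite (@eq_prim _ _ (fun x => f x * ((1 + 0 * x) * U 0 x)) (fun x => f x * U 0 x)) in h; last by move=> x _; ring.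
have e1 : 0 <= energy 1 0 l by apply: energy_ge0.
have e2 : 0 <= \sum_(1 <= j < l) energy 1 0 j by apply: sumr_ge0 => j _; apply: energy_ge0.
have [t0 _] := andP tau01.
have b0 := sqn_ge0 L (U 0); have f0 := sqn_ge0 L f.
have cs := cauchy_schwarz f_L2 (bm_L2 (Ubm h0)).
rewrite -/(sqn L (U 0)) in h.
have h1 : a * sqn L (U 0) <= prim (fun x => f x * U 0 x) L.
  by rewrite -(ler_pM2l t0) -h mulrDr; have := mulr_ge0 (ltW t0) e2; lra.
have h2 : (a * sqn L (U 0)) ^+ 2 <= sqn L f * sqn L (U 0).
  by apply: le_trans cs; rewrite ler_sqr ?nnegrE ?(le_trans _ h1)// mulr_ge0// ltW.
move: b0; rewrite le_eqVlt => /orP[/eqP <-|b0]; first by rewrite mulr0.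
by rewrite -(ler_pM2r b0) (le_trans _ h2)// exprMn [X in _ <= _ * X]expr2 mulrA.
Qed.

(** The slope of the weight 1 + x brings in |D^l u|^2; its bound 1 + L and [sqn_le_forcing] control
    the forcing. The bracket multiplied by [tau] is nonnegative, so [tau] may be replaced by 1. *)
Lemma top_energy_le : (2 * l + 1)%:R / 2 * sqn L (U l) <=
  (1 + L) * (sqn L f / a) + (k + 2)%:R^-1 * prim (fun x => U 0 x ^+ (k + 2)) L.
Proof.
have h := energy_balance 1 1.
have h0 : (0 <= 2 * l)%N by [].
have [t0 t1] := andP tau01.
have e1 : (2 * l + 1)%:R / 2 * sqn L (U l) <= energy 1 1 l.
  by rewrite /energy mul1r lerDl mulr_ge0// sqr_ge0.
have e2 : 0 <= \sum_(1 <= j < l) energy 1 1 j by apply: sumr_ge0 => j _; apply: energy_ge0.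
have w1 x : 0 <= x <= L -> 0 <= 1 + 1 * x <= 1 + L by move=> /andP[x0 xL]; lra.
have e3 : 0 <= prim (fun x => (1 + 1 * x) * U 0 x ^+ 2) L.
  by apply: prim_ge0 => x xL; rewrite mulr_ge0 ?sqr_ge0//; case/andP: (w1 x xL).
have bW : bm L (fun x => (1 + 1 * x) * U 0 x).
  by apply: bmM (Ubm h0); apply: bmD (bm_cst L 1) (bmZ 1 (bm_id L)).
have cs := cauchy_schwarz f_L2 (bm_L2 bW).
have f0 := sqn_ge0 L f; have b0 := sqn_ge0 L (U 0).
have e4 : sqn L (fun x => (1 + 1 * x) * U 0 x) <= (1 + L) ^+ 2 * sqn L (U 0).
  rewrite -primZ; last by apply/bm_itg/bmX/Ubm.
  apply: le_prim; [exact/bm_itg/bmX|exact/itgZ/bm_itg/bmX/Ubm|].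
  move=> x /w1 /andP[x0 xL]; rewrite exprMn ler_wpM2r ?sqr_ge0// ler_sqr ?nnegrE//.
  exact: le_trans xL.
have e5 : prim (fun x => f x * ((1 + 1 * x) * U 0 x)) L <= (1 + L) * (sqn L f / a).
  apply: le_trans (ler_norm _) _; rewrite -ler_sqr ?nnegrE//; last first.
    by rewrite mulr_ge0 ?divr_ge0 ?(ltW a_gt0)// addr_ge0 ?ltW.
  rewrite real_normK ?num_real//; apply: le_trans cs _.
  have h1 := sqn_le_forcing.
  apply: le_trans (ler_wpM2l f0 e4) _.
  rewrite exprMn expr_div_n mulrCA ler_wpM2l ?sqr_ge0// ler_pdivlMr ?exprn_gt0//.
  by rewrite [leRHS]expr2 -mulrA ler_wpM2l// mulrC.
rewrite mul1r in h; set N := _^-1 * _ in h *; set Q := prim (fun x => f x * _) _ in h e5.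
apply: le_trans e1 _.
have h2 : energy 1 1 l <= tau * (Q + N).
  by rewrite -h lerDl mulr_ge0 ?(ltW t0)// addr_ge0// mulr_ge0// ltW.
have h3 : 0 <= Q + N.
  by rewrite -(pmulr_rge0 _ t0) (le_trans _ h2)//; apply: energy_ge0.
by apply: le_trans h2 _; apply: (@le_trans _ _ (Q + N)); [rewrite ler_piMl|rewrite lerD2r].
Qed.

End Energy.

(** * Interpolation inequalities *)

Section Interpolation.
Variable R : realType.

(** Log-convexity makes the ratios b_(i+1) / b_i nondecreasing, hence b_l / b_1 is at least (b_1 /
    b_0)^(l-1). Vanishing terms are treated apart. *)
Lemma logconvex_pow (b : nat -> R) (l : nat) : (0 < l)%N -> (forall i, 0 <= b i) ->
  (forall i, (i.+1 < l)%N -> b i.+1 ^+ 2 <= b i * b i.+2) ->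
  b 1%N ^+ l <= b l * b 0%N ^+ l.-1.
Proof.
move=> l0 b0 hb.
have [->|b1] := eqVneq (b 1%N) 0; first by rewrite expr0n gtn_eqF// mulr_ge0 ?exprn_ge0.
have {}b1 : 0 < b 1%N by rewrite lt_def b1 b0.
case: l l0 hb => // l _ hb; rewrite /=.
have [e0|bb0] := eqVneq (b 0%N) 0.
  case: l hb => [|l] hb; first by rewrite expr0 mulr1 expr1.
  by have := hb 0%N isT; rewrite e0 mul0r lt_geF// exprn_gt0.
have {}bb0 : 0 < b 0%N by rewrite lt_def bb0 b0.
have key i : (i < l.+1)%N -> 0 < b i /\ b 1%N * b i <= b 0%N * b i.+1.
  elim: i => [|i IH] il; first by rewrite mulrC.
  have [bi hi] := IH (ltnW il).
  have bi1 : 0 < b i.+1 by rewrite -(pmulr_rgt0 _ bb0) (lt_le_trans _ hi)// mulr_gt0.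
  split=> //; rewrite -(ler_pM2r bi) -mulrA [b i.+1 * b i]mulrC mulrA.
  apply: le_trans (ler_wpM2r (ltW bi1) hi) _; rewrite -!mulrA -expr2 ler_pM2l//.
  by apply: le_trans (hb i il) _; rewrite mulrC.
have {key} : forall i, (i < l.+1)%N -> b 1%N ^+ i.+1 <= b i.+1 * b 0%N ^+ i.
  elim=> [|i IH] il; first by rewrite expr0 mulr1 expr1.
  rewrite exprS; apply: le_trans (ler_wpM2l (ltW b1) (IH (ltnW il))) _.
  rewrite mulrA [in leRHS]exprS mulrA ler_wpM2r ?exprn_ge0//.
  by rewrite [leRHS]mulrC; case: (key i.+1 il).
by apply.
Qed.

(** On an interval of length [h] containing [x], h p(x) differs from the increment of [P] by at most
    h c. The oscillation bound [c] is left free: it comes either from a Lipschitz constant of [p] or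
    from the L^1 norm of its derivative. *)
Lemma landau_bound (L h b0 c : R) (P p : R -> R) x : ac L P p -> 0 < h <= L ->
  0 <= x <= L -> (forall t, 0 <= t <= L -> `|P t| <= b0) ->
  (forall t, 0 <= t <= L -> `|t - x| <= h -> `|p t - p x| <= c) ->
  h * `|p x| <= 2 * b0 + h * c.
Proof.
move=> aP /andP[h0 hL] /andP[x0 xL] Pb pc.
have [y [y0 yx xyh yhL]] : exists y, [/\ 0 <= y, y <= x, x <= y + h & y + h <= L].
  have [xh|xh] := leP (x + h) L; first by exists x; split=> //; lra.
  by exists (L - h); split; lra.
have e2 : `|(P (y + h) - p x * (y + h)) - (P y - p x * y)| <= c * h.
  have := ac_increment_le (M := c) (acB aP (acZ (p x) (ac_id L))) y0 _ yhL.
  rewrite [y + h - y]addrC addKr; apply; first by lra.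
  move=> t /andP[yt th]; rewrite mulr1; apply: pc; first by apply/andP; split; lra.
  by rewrite ler_norml; apply/andP; split; lra.
have hp : h * p x = (P (y + h) - P y) - ((P (y + h) - p x * (y + h)) - (P y - p x * y)).
  by ring.
have -> : h * `|p x| = `|h * p x| by rewrite normrM gtr0_norm.
rewrite hp; apply: le_trans (ler_normB _ _) _; rewrite [h * c]mulrC lerD//.
apply: le_trans (ler_normB _ _) _; rewrite mulr_natl mulr2n.
by apply: lerD; apply: Pb; apply/andP; split; lra.
Qed.

(* Ehrling's inequality for a sequence satisfying Landau's inequalities. *)
Lemma interpolation (L : R) (m : nat) : 0 < L -> forall e : R, 0 < e ->
  exists C : R, 0 <= C /\ forall s : nat -> R, (forall i, 0 <= s i) ->
    (forall i, (i.+2 <= m)%N -> forall h : R, 0 < h <= L ->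
       h * s i.+1 <= 2 * s i + h ^+ 2 * s i.+2) ->
    forall i, (i < m)%N -> s i <= e * s m + C * s 0%N.
Proof.
move=> L0; elim: m => [|m IH] e e0; first by exists 0; split.
case: m IH => [|m] IH.
  exists 1; split=> // s s0 _ [|i] // _.
  by rewrite mul1r lerDr mulr_ge0 ?(ltW e0).
(* The inductive constant h / 4 lets half of h s_(m+1) be absorbed, h <= e / 2 makes the term in
   s_(m+2) small enough, and h <= 4 is used for the lower indices, where h / 4 <= 1. *)
pose h := Num.min L (Num.min (e / 2) 4).
have h0 : 0 < h by rewrite !lt_min L0 divr_gt0//= ltr0n.
have hL : h <= L by rewrite ge_min lexx.
have he : h <= e / 2 by rewrite !ge_min lexx orbT.
have h4 : h <= 4 by rewrite !ge_min lexx !orbT.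
have [|C [C0 hC]] := IH (h / 4); first by rewrite divr_gt0.
exists (4 * C / h + C); split.
  by rewrite addr_ge0// divr_ge0 ?mulr_ge0// ltW.
move=> s s0 hs i.
have hm j : (j < m.+1)%N -> s j <= h / 4 * s m.+1 + C * s 0%N.
  by apply: hC => // j' hj' h' h'L; apply: hs => //; apply: ltnW.
have top : s m.+1 <= e * s m.+2 + 4 * C / h * s 0%N.
  have h1 := hs m (leqnn _) h (introT andP (conj h0 hL)).
  have h2 := hm m (ltnSn m).
  rewrite -(ler_pM2l h0).
  have -> : h * (e * s m.+2 + 4 * C / h * s 0%N) = h * e * s m.+2 + 4 * (C * s 0%N).
    by field; rewrite gt_eqF.
  have h3 : 2 * (h ^+ 2 * s m.+2) <= h * e * s m.+2.
    by rewrite mulrA ler_wpM2r// expr2 mulrCA ler_pM2l//; lra.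
  have : 2 * (h / 4 * s m.+1) = h * s m.+1 / 2 by field.
  lra.
have sC : 0 <= C * s 0%N by rewrite mulr_ge0.
rewrite ltnS leq_eqVlt => /orP[/eqP ->|im].
  by apply: le_trans top _; rewrite [leRHS](_ : _ = e * s m.+2 + 4 * C / h * s 0%N + C * s 0%N) ?lerDl//; ring.
apply: le_trans (hm i im) _.
have h5 : h / 4 * s m.+1 <= s m.+1 by rewrite ler_piMl// ler_pdivrMr// mul1r.
rewrite mulrDl; lra.
Qed.

End Interpolation.

(** * Estimates for u that use the boundary conditions only *)

Section APriori.
Variables (R : realType) (L : R) (l : nat).
Hypothesis L_gt0 : 0 < L.
Hypothesis l_gt0 : (0 < l)%N.
Implicit Types U : nat -> R -> R.

Lemma double_ge2 : exists m,
  [/\ (4 * l - 4 = 2 * m)%N, (4 * l = 2 * m.+2)%N & (2 * m + 8 = 2 * m.+2 + 4)%N].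
Proof. by exists (2 * l - 2)%N; split; lia. Qed.

Lemma tower_bm U i : tower L l U -> (i <= 2 * l)%N -> bm L (U i).
Proof. by case=> h _ _ /h/ac_bm. Qed.

(** The boundary conditions give |D^(i+1) u|^2 = - (D^i u, D^(i+2) u) for i + 1 < l, so
    Cauchy-Schwarz makes these squared norms log-convex. *)
Lemma sqn_logconvex U : tower L l U ->
  sqn L (U 1) ^+ l <= sqn L (U l) * sqn L (U 0) ^+ l.-1.
Proof.
move=> hU; have [Uac U0 UL] := hU.
apply: (@logconvex_pow _ (fun i => sqn L (U i))) => //= [i|i il]; first exact: sqn_ge0.
have i1 : (i <= 2 * l)%N by lia.
have i2 : (i.+1 <= 2 * l)%N by lia.
have i3 : (i.+2 <= 2 * l)%N by lia.
have h := prim_ibp L_gt0 (Uac i i1) (Uac i.+1 i2).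
rewrite U0 ?UL ?mul0r ?subrr ?sub0r in h; [|lia..].
have e : sqn L (U i.+1) = - prim (fun x => U i x * U i.+2 x) L.
  by rewrite h opprK; apply: eq_prim => x _; rewrite expr2.
rewrite [in leLHS]e sqrrN; apply: cauchy_schwarz; exact/bm_L2/tower_bm.
Qed.

(** As u(0) = 0, u(x)^2 is twice the integral of u Du over [0, x]. *)
Lemma sup4_le U x : tower L l U -> 0 <= x <= L ->
  U 0 x ^+ 4 <= 4 * (sqn L (U 0) * sqn L (U 1)).
Proof.
move=> hU xL; have [Uac U0 _] := hU; have [x0 xL'] := andP xL.
have b0 := tower_bm hU (leq0n _); have b1 : bm L (U 1) by apply: tower_bm => //; lia.
have [_ /(_ x xL)] := acX 1 (Uac 0%N (leq0n _)).
rewrite U0// expr0n add0r => e.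
have i01 := bm_itg (bmM b0 b1).
have i01' : itg L (fun x => U 0 x ^+ 1 * U 1 x) by apply: eq_itg i01 => t _; rewrite expr1.
rewrite primZ in e; last exact: itg_le i01'.
have h : `|U 0 x ^+ 2| <= 2 * prim (fun t => `|U 0 t * U 1 t|) L.
  rewrite e normrM ger0_norm// ler_wpM2l//.
  apply: le_trans (le_norm_prim (itg_le xL' i01')) _.
  rewrite (@eq_prim _ _ _ (fun t => `|U 0 t * U 1 t|)); last by move=> t _; rewrite expr1.
  by apply: (prim_le (itg_norm i01)).
have cs := cauchy_schwarz_norm (bm_L2 b0) (bm_L2 b1).
have -> : U 0 x ^+ 4 = `|U 0 x ^+ 2| ^+ 2 by rewrite real_normK ?num_real// -exprM.
apply: (@le_trans _ _ ((2 * prim (fun t => `|U 0 t * U 1 t|) L) ^+ 2)).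
  by rewrite ler_sqr ?nnegrE// (le_trans _ h).
by rewrite exprMn (_ : 2 ^+ 2 = 4); [rewrite ler_pM2l|ring].
Qed.

Lemma sup_attained U : tower L l U -> exists S, [/\ 0 <= S,
  forall x, 0 <= x <= L -> `|U 0 x| <= S & exists2 x, 0 <= x <= L & `|U 0 x| = S].
Proof.
move=> hU; have [Uac _ _] := hU.
have c := ac_continuous (ltW L_gt0) (acX 1 (Uac 0%N (leq0n _))).
have [x xL hx] := EVT_max (ltW L_gt0) c.
rewrite in_itv /= in xL.
exists `|U 0 x|; split=> //; last by exists x.
move=> t tL; have := hx t; rewrite in_itv /= => /(_ tL) h.
by rewrite -ler_sqr ?nnegrE// !real_normK ?num_real.
Qed.

Lemma prim_pow_le U S k : tower L l U -> (forall x, 0 <= x <= L -> `|U 0 x| <= S) ->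
  prim (fun x => U 0 x ^+ (k + 2)) L <= S ^+ k * sqn L (U 0).
Proof.
move=> hU hS; have b0 := tower_bm hU (leq0n _).
rewrite -primZ; last exact/bm_itg/bmX.
apply: le_prim; [exact/bm_itg/bmX|exact/itgZ/bm_itg/bmX|].
move=> t tL; rewrite exprD ler_wpM2r ?sqr_ge0//; apply: le_trans (ler_norm _) _.
by rewrite normrX lerXn2r ?nnegrE//; [exact: le_trans (hS t tL)|exact: hS].
Qed.

(* Cauchy-Schwarz for [U_0 (S^2 - U_0^2) U_0'], the derivative of
   [S^2 U_0^2 / 2 - U_0^4 / 4]: the bound of [prim_pow_le] is not sharp because
   [U_0] has to climb from [0] to its maximum. *)
Lemma prim_pow_gain U S : tower L l U -> 0 <= S ->
  (forall x, 0 <= x <= L -> `|U 0 x| <= S) ->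
  (exists2 x, 0 <= x <= L & `|U 0 x| = S) ->
  S ^+ (4 * l + 4) / 16 <= sqn L (U 1) *
    (S ^+ (4 * l) * sqn L (U 0) - prim (fun x => U 0 x ^+ (4 * l + 2)) L).
Proof.
move=> hU S0 hS [y yL Sy]; have [Uac U0 _] := hU; have [y0 yL'] := andP yL.
have b0 := tower_bm hU (leq0n _); have b1 : bm L (U 1) by apply: tower_bm => //; lia.
pose g x := U 0 x * (S ^+ 2 - U 0 x ^+ 2).
have bg : bm L g by apply: bmM => //; apply: bmB; [exact: bm_cst|exact: bmX].
have a0 := Uac 0%N (leq0n _).
have aP := acB (acZ (S ^+ 2 / 2) (acX 1 a0)) (acZ (4^-1) (acX 3 a0)).
have [_ /(_ y yL)] := aP; rewrite U0// !expr0n !mulr0 subrr add0r.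
have y2 : U 0 y ^+ 2 = S ^+ 2 by rewrite -(real_normK (num_real (U 0 y))) Sy.
have y4 : U 0 y ^+ 4 = S ^+ 4 by rewrite (exprM _ 2 2) y2 -exprM.
rewrite y2 y4 (@eq_prim _ _ _ (fun x => g x * U 1 x)); last first.
  by move=> x _; rewrite /g expr1; field.
move=> e.
have cs := cauchy_schwarz (bm_L2 (_ : bm y g)) (bm_L2 (_ : bm y (U 1))).
have bmle P : bm L P -> bm y P.
  move=> [mP [M PM]]; split.
    by apply: measurable_funS mP => //; apply: subset_itvl; rewrite bnd_simp.
  by exists M => x /andP[x0 xy]; apply: PM; rewrite x0 (le_trans xy).
have {}cs := cs (bmle _ bg) (bmle _ b1); rewrite -e in cs.
have sqn_le P : bm L P -> sqn y P <= sqn L P.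
  by move=> bP; apply: (prim_le (bm_itg (bmX 2 bP))) => // t _; apply: sqr_ge0.
(* At the maximum point [y] the primitive of g Du equals S^4 / 2 - S^4 / 4 = S^4 / 4. *)
have {}cs : S ^+ 8 / 16 <= sqn L g * sqn L (U 1).
  apply: le_trans (ler_pM (sqn_ge0 _ _) (sqn_ge0 _ _) (sqn_le _ bg) (sqn_le _ b1)).
  by apply: le_trans cs; rewrite le_eqVlt; apply/orP; left; apply/eqP; field.
have i1 : itg L (fun x => U 0 x ^+ 2) by apply/bm_itg/bmX.
have i2 : itg L (fun x => U 0 x ^+ (4 * l + 2)) by apply/bm_itg/bmX.
(* A pointwise inequality: with s = S^2, t = u^2 and m = 2l - 2 it combines (s - t)^2 <= s^2 - s t
   with t^(m+2) <= s^(m+1) t. *)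
have hg : S ^+ (4 * l - 4) * sqn L g <=
    S ^+ (4 * l) * sqn L (U 0) - prim (fun x => U 0 x ^+ (4 * l + 2)) L.
  rewrite -!primZ//; last exact/bm_itg/bmX.
  rewrite -primB//; last exact: itgZ.
  apply: le_prim; [exact/itgZ/bm_itg/bmX| |].
    by apply: eq_itg (itgD (itgZ (S ^+ (4 * l)) i1) (itgZ (-1) i2)) => x _; ring.
  move=> x xL; rewrite exprD -mulrBl /g exprMn mulrA [_ * U 0 x ^+ 2]mulrC -mulrA.
  rewrite [leRHS]mulrC ler_wpM2l ?sqr_ge0//.
  have ts : U 0 x ^+ 2 <= S ^+ 2.
    by rewrite -(real_normK (num_real (U 0 x))) ler_sqr ?nnegrE// hS.
  have [m [-> -> _]] := double_ge2.
  rewrite !(exprM _ 2); set t := U 0 x ^+ 2 in ts *; set s := S ^+ 2 in ts *.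
  have t0 : 0 <= t by apply: sqr_ge0.
  have s0 : 0 <= s by apply: sqr_ge0.
  have tm : t ^+ m <= s ^+ m by rewrite lerXn2r.
  have sm : 0 <= s ^+ m by apply: exprn_ge0.
  have h1 : t ^+ m.+2 <= s ^+ m * (s * t).
    rewrite !exprSr -mulrA; apply: ler_pM => //.
    - exact: exprn_ge0.
    - exact: mulr_ge0.
    - exact: ler_wpM2r.
  have h2 : s ^+ m * (s - t) ^+ 2 <= s ^+ m * (s ^+ 2 - s * t).
    rewrite ler_wpM2l//; nra.
  by apply: le_trans h2 _; rewrite mulrBr -exprD addn2 lerD2l lerN2.
rewrite [leRHS]mulrC; apply: le_trans (ler_wpM2r (sqn_ge0 _ _) hg).
rewrite -mulrA; apply: le_trans (ler_wpM2l (exprn_ge0 _ S0) cs).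
have [m [-> -> e8]] := double_ge2.
by rewrite mulrA -exprD e8.
Qed.

End APriori.

(** * Closing the estimate of |D^l u|^2 *)

Section Numeric.
Variable R : realType.
Implicit Types (L a W S P : R).

Lemma double_facts (l : nat) : (0 < l)%N ->
  [/\ (3 <= 2 * l + 1)%N, (4 * l + 2 = 2 * (2 * l + 1))%N & (l.+1 + l.-1 = 2 * l)%N].
Proof. by move=> l0; split; lia. Qed.

(** The last term covers S <= D and the first one S > D. A large [D] makes the coefficient of the
    higher power as small as desired. *)
Lemma exprn_lt_split S D (k n : nat) : 0 <= S -> 1 <= D -> (k < n)%N ->
  S ^+ k <= D^-1 * S ^+ n + D ^+ k.
Proof.
move=> S0 D1 kn; have D0 : 0 < D by lra.
have [SD|DS] := leP S D.
  apply: (@le_trans _ _ (D ^+ k)); first by rewrite lerXn2r ?nnegrE// ltW.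
  by rewrite lerDr mulr_ge0 ?invr_ge0 ?exprn_ge0// ltW.
rewrite -(subnKC (ltnW kn)) exprD mulrCA.
apply: (@le_trans _ _ (S ^+ k * (D^-1 * S ^+ (n - k)))); last first.
  by rewrite lerDl exprn_ge0// ltW.
rewrite ler_peMr ?exprn_ge0// ler_pdivlMl// mulr1.
have S1 : 1 <= S by apply: le_trans (ltW DS).
apply: le_trans (ltW DS) _; rewrite -{1}[S]expr1 ler_weXn2l// subn_gt0//.
Qed.

Lemma sup_pow_le S b0 b1 bl (l : nat) : (0 < l)%N -> 0 <= S -> 0 <= b0 -> 0 <= b1 ->
  S ^+ 4 <= 4 * (b0 * b1) -> b1 ^+ l <= bl * b0 ^+ l.-1 ->
  S ^+ (4 * l) * b0 <= 4 ^+ l * (bl * b0 ^+ (2 * l)).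
Proof.
move=> l0 S0 b00 b10 h4 hl; rewrite exprM.
have h : S ^+ 4 ^+ l <= (4 * (b0 * b1)) ^+ l.
  by rewrite lerXn2r ?nnegrE ?mulr_ge0 ?exprn_ge0.
apply: le_trans (ler_wpM2r b00 h) _; rewrite exprMn -mulrA ler_wpM2l ?exprn_ge0//.
rewrite exprMn mulrAC; apply: (@le_trans _ _ (b0 ^+ l * b0 * (bl * b0 ^+ l.-1))).
  by rewrite ler_wpM2l ?mulr_ge0 ?exprn_ge0.
rewrite mulrCA le_eqVlt; apply/orP; left; apply/eqP; congr (_ * _).
by rewrite -exprSr -exprD; congr (_ ^+ _); case: (double_facts l0).
Qed.

(** Here [b0], [b1], [bl] are the squared norms of u, Du and D^l u, [S] is sup|u|, [P] the integral
    of u^(k+2) and [W] a bound of |f|^2. The base of the power [k] in the conclusion is chosen as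
    [D] so that D^-1 S^(4l) b0 <= bl, by [sup_pow_le]; this leaves P <= bl + D^k W / a^2. Since k +
    2 >= 2 and 2l + 1 >= 3, at most bl / 2 has to be absorbed by 3 bl / 2. *)
Lemma regular_numeric (l k : nat) L a W b0 b1 bl S P : (0 < l)%N -> (k < 4 * l)%N ->
  0 < L -> 0 < a -> 0 <= b0 -> 0 <= b1 -> 0 <= bl -> 0 <= S ->
  a ^+ 2 * b0 <= W ->
  (2 * l + 1)%:R / 2 * bl <= (1 + L) * (W / a) + (k + 2)%:R^-1 * P ->
  P <= S ^+ k * b0 -> S ^+ 4 <= 4 * (b0 * b1) -> b1 ^+ l <= bl * b0 ^+ l.-1 ->
  bl <= ((1 + L) / a + (4 ^+ l * (W / a ^+ 2) ^+ (2 * l) + 1) ^+ k / a ^+ 2) * W.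
Proof.
move=> l0 kl L0 a0 b00 b10 bl0 S0 hb0 htop hP h4 hl.
set be := W / a ^+ 2; set D := _ + 1.
have a20 : 0 < a ^+ 2 by rewrite exprn_gt0.
have b0be : b0 <= be by rewrite ler_pdivlMr// mulrC.
have be0 : 0 <= be by apply: le_trans b0be.
have D1 : 1 <= D by rewrite /D lerDr mulr_ge0 ?exprn_ge0.
have D0 : 0 < D by lra.
have h1 : P <= bl + D ^+ k * be.
  apply: le_trans hP _; apply: le_trans (ler_wpM2r b00 (exprn_lt_split S0 D1 kl)) _.
  rewrite mulrDl; apply: lerD; last by rewrite ler_wpM2l ?exprn_ge0// ltW.
  rewrite -mulrA ler_pdivrMl//; apply: le_trans (sup_pow_le l0 S0 b00 b10 h4 hl) _.
  rewrite mulrCA [leRHS]mulrC ler_wpM2l//.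
  apply: (@le_trans _ _ (4 ^+ l * be ^+ (2 * l))); last by rewrite /D lerDl.
  by rewrite ler_wpM2l ?exprn_ge0// lerXn2r ?nnegrE.
have k2 : (k + 2)%:R^-1 * P <= (bl + D ^+ k * be) / 2.
  apply: (@le_trans _ _ ((k + 2)%:R^-1 * (bl + D ^+ k * be))).
    by rewrite ler_wpM2l ?invr_ge0.
  rewrite mulrC; apply: ler_wpM2l.
    by rewrite addr_ge0// mulr_ge0// exprn_ge0// ltW.
  by rewrite lef_pV2 ?posrE ?ltr0n ?addn2// ler_nat.
have l3 : 3 / 2 * bl <= (2 * l + 1)%:R / 2 * bl.
  by rewrite ler_wpM2r// ler_pM2r ?invr_gt0// ler_nat; case: (double_facts l0).
have Dk : 0 <= D ^+ k * be by rewrite mulr_ge0// exprn_ge0// ltW.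
have -> : ((1 + L) / a + D ^+ k / a ^+ 2) * W = (1 + L) * (W / a) + D ^+ k * be.
  by rewrite /be; field; rewrite gt_eqF.
lra.
Qed.

(** [G] will be C_*^(4l), and the last hypothesis is the threshold condition on f. [G] is absent
    from the conclusion: the gain is measured by the factor [D], which is at least both 1 and
    b0^(2l). *)
Lemma critical_numeric (l : nat) L a W G b0 b1 bl S P : (0 < l)%N ->
  0 < L -> 0 < a -> 0 <= b0 -> 0 <= b1 -> 0 <= bl -> 0 <= S -> 0 <= G ->
  a ^+ 2 * b0 <= W ->
  (2 * l + 1)%:R / 2 * bl <= (1 + L) * (W / a) + (4 * l + 2)%:R^-1 * P ->
  P <= S ^+ (4 * l) * b0 ->
  S ^+ (4 * l + 4) / 16 <= b1 * (S ^+ (4 * l) * b0 - P) ->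
  S ^+ 4 <= 4 * (b0 * b1) -> b1 ^+ l <= bl * b0 ^+ l.-1 ->
  S ^+ (4 * l) <= G * (bl * b0 ^+ (2 * l).-1) ->
  G * b0 ^+ (2 * l) <= (2 * l + 1)%:R ^+ 2 ->
  bl <= (32 * (2 * l + 1)%:R * (1 + L) / a * ((W / a ^+ 2) ^+ (2 * l) + 1)) * W.
Proof.
move=> l0 L0 a0 b00 b10 bl0 S0 G0 hb0 htop hP hgain h4 hl hG hGb.
set be := W / a ^+ 2; set D := _ + 1; set n := (2 * l + 1)%:R in htop hGb *.
have a20 : 0 < a ^+ 2 by rewrite exprn_gt0.
have b0be : b0 <= be by rewrite ler_pdivlMr// mulrC.
have be0 : 0 <= be by apply: le_trans b0be.
have W0 : 0 <= W by apply: le_trans hb0; rewrite mulr_ge0// ltW.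
have D1 : 1 <= D by rewrite /D lerDr exprn_ge0.
have D0 : 0 < D by lra.
have n3 : 3 <= n by rewrite /n ler_nat; case: (double_facts l0).
have n0 : 0 < n by lra.
pose X := (1 + L) * (W / a).
have X0 : 0 <= X by rewrite mulr_ge0 ?divr_ge0 ?addr_ge0// ltW.
have {}htop : n ^+ 2 * bl <= 2 * n * X + P.
  have e : (4 * l + 2)%:R = 2 * n :> R by rewrite /n -natrM; congr (_%:R); case: (double_facts l0).
  have n20 : 0 < 2 * n by lra.
  rewrite -(ler_pM2l n20) in htop; rewrite e mulrDr mulVKf ?gt_eqF// in htop.
  by apply: le_trans htop; rewrite le_eqVlt; apply/orP; left; apply/eqP; field.
suff key : bl <= 32 * n * D * X.
  by apply: le_trans key _; rewrite le_eqVlt; apply/orP; left; apply/eqP; rewrite /X; field; rewrite gt_eqF.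
have n29 : 9 <= n ^+ 2 by rewrite expr2; nra.
have DX : X <= D * X by rewrite ler_peMl.
have nDX : 0 <= n * (D * X) := mulr_ge0 (ltW n0) (mulr_ge0 (ltW D0) X0).
have nX : n * X <= n * (D * X) by rewrite ler_pM2l.
have small : P <= bl -> bl <= 32 * n * D * X.
  move=> Pbl; have h : 9 * bl <= n ^+ 2 * bl by rewrite ler_wpM2r.
  have -> : 32 * n * D * X = 32 * (n * (D * X)) by ring.
  lra.
have P0b : S ^+ (4 * l) * b0 <= bl -> bl <= 32 * n * D * X.
  by move=> h; apply: small; apply: le_trans hP h.
have [e1|b1n] := eqVneq b1 0.
  apply: P0b; suff -> : S = 0 by rewrite expr0n muln_eq0 (gtn_eqF l0) mul0r.
  apply/eqP; rewrite -sqrf_eq0 -sqrf_eq0 -exprM; move: h4.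
  by rewrite e1 !mulr0 => h4; rewrite -normr_le0 ger0_norm// exprn_ge0.
have {}b1n : 0 < b1 by rewrite lt_def b1n.
(* If b0 b1 exceeds D S^4, log-convexity gives S^(4l) b0 <= D^-l bl b0^(2l) <= bl, far below the
   critical size. *)
have [big|sml] := leP (b0 * b1) (D * S ^+ 4); last first.
  apply: P0b; apply: (@le_trans _ _ (D^-1 * (bl * b0 ^+ (2 * l)))); last first.
    rewrite ler_pdivrMl// mulrC ler_wpM2r//.
    by apply: (@le_trans _ _ (be ^+ (2 * l))); [rewrite lerXn2r ?nnegrE|rewrite /D lerDl].
  have h : S ^+ 4 ^+ l <= (D^-1 * (b0 * b1)) ^+ l.
    by rewrite lerXn2r ?nnegrE ?mulr_ge0 ?invr_ge0 ?exprn_ge0 ?(ltW D0)// ler_pdivlMl// ltW.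
  rewrite exprM; apply: le_trans (ler_wpM2r b00 h) _; rewrite exprMn -mulrA.
  apply: ler_pM; rewrite ?mulr_ge0 ?exprn_ge0 ?invr_ge0 ?mulr_ge0 ?(ltW D0)//.
    by rewrite -{2}[D^-1]expr1 ler_wiXn2l ?invr_ge0 ?(ltW D0)// invf_le1.
  rewrite exprMn mulrAC; apply: (@le_trans _ _ (b0 ^+ l * b0 * (bl * b0 ^+ l.-1))).
    by rewrite ler_wpM2l ?mulr_ge0 ?exprn_ge0.
  rewrite mulrCA le_eqVlt; apply/orP; left; apply/eqP; congr (_ * _).
  by rewrite -exprSr -exprD; congr (_ ^+ _); case: (double_facts l0).
have Sl0 : 0 <= S ^+ (4 * l) by apply: exprn_ge0.
(* The gain in relative form: [P] misses the fraction 1 / (16 D) of S^(4l) b0. *)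
have h1 : S ^+ (4 * l) * b0 / (16 * D) <= S ^+ (4 * l) * b0 - P.
  rewrite -(ler_pM2l b1n); apply: le_trans hgain.
  have -> : b1 * (S ^+ (4 * l) * b0 / (16 * D)) = S ^+ (4 * l) / 16 * (b0 * b1 / D).
    by field; rewrite gt_eqF.
  have -> : S ^+ (4 * l + 4) / 16 = S ^+ (4 * l) / 16 * S ^+ 4 by rewrite exprD mulrAC.
  by rewrite ler_wpM2l ?divr_ge0// ler_pdivrMr// [S ^+ 4 * _]mulrC.
have h2 : S ^+ (4 * l) * b0 <= n ^+ 2 * bl.
  apply: le_trans (ler_wpM2r b00 hG) _.
  have -> : G * (bl * b0 ^+ (2 * l).-1) * b0 = G * b0 ^+ (2 * l) * bl.
    by rewrite -[in RHS](prednK (_ : 0 < 2 * l)%N) ?muln_gt0// exprSr; ring.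
  by rewrite ler_wpM2r.
have q0 : 0 <= (16 * D)^-1 <= 1.
  by rewrite invr_ge0 invf_le1 ?mulr_gt0//; apply/andP; split; lra.
have h3 : P <= n ^+ 2 * bl * (1 - (16 * D)^-1).
  apply: (@le_trans _ _ (S ^+ (4 * l) * b0 * (1 - (16 * D)^-1))).
    by rewrite mulrBr mulr1; lra.
  by rewrite ler_wpM2r// subr_ge0; case/andP: q0.
have D160 : 0 < 16 * D by rewrite mulr_gt0.
have h4' : n ^+ 2 * bl / (16 * D) <= 2 * n * X.
  by move: h3; rewrite mulrBr mulr1; lra.
(* Multiplication by 16 D produces the constant 32 n D; the factor n^2 >= 1 on the left is
   dropped. *)
move: h4'; rewrite ler_pdivrMr// => h4'.
have -> : 32 * n * D * X = 2 * n * X * (16 * D) by ring.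
by apply: le_trans h4'; rewrite ler_peMl//; lra.
Qed.

End Numeric.

(** * Bounds for the derivatives up to order 2l + 1 *)

Section AllDerivatives.
Variables (R : realType) (L a : R) (l k : nat).
Hypothesis L_gt0 : 0 < L.
Hypothesis l_gt0 : (0 < l)%N.
Hypothesis a_gt0 : 0 < a.

Definition lower_terms (U : nat -> R -> R) (x : R) : R :=
  a * U 0 x + \sum_(1 <= j < l) (-1) ^+ (j + 1) * U (2 * j + 1) x + U 0 x ^+ k * U 1 x.

Lemma lower_terms_bm (U : nat -> R -> R) :
  (forall i, (i < 2 * l)%N -> bm L (U i)) -> bm L (lower_terms U).
Proof.
move=> bU; have h0 : (0 < 2 * l)%N by rewrite muln_gt0.
have h1 : (1 < 2 * l)%N by lia.
apply: bmD; last by apply: bmM (bU _ h1); apply/bmX/bU.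
apply: bmD; first exact/bmZ/bU.
apply: bm_sum => j; rewrite mem_index_iota => /andP[_ jl].
by apply/bmZ/bU; lia.
Qed.

Lemma lower_terms_le (U : nat -> R -> R) (T S x : R) : 0 <= T ->
  (forall i, (i < 2 * l)%N -> `|U i x| <= T) -> `|U 0 x| <= S ->
  `|lower_terms U x| <= (a + l%:R + S ^+ k) * T.
Proof.
move=> T0 UT US; have h0 : (0 < 2 * l)%N by rewrite muln_gt0.
have h1 : (1 < 2 * l)%N by lia.
rewrite /lower_terms !mulrDl; apply: le_trans (ler_normD _ _) _; apply: lerD.
  apply: le_trans (ler_normD _ _) _; apply: lerD.
    by rewrite normrM gtr0_norm// ler_wpM2l ?(ltW a_gt0)// UT.
  apply: le_trans (ler_norm_sum _ _ _) _.
  apply: (@le_trans _ _ (\sum_(1 <= j < l) T)).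
    rewrite !big_nat; apply: ler_sum => j /andP[_ jl].
    by rewrite normrM normrX normrN1 expr1n mul1r; apply: UT; lia.
  by rewrite sumr_const_nat -[leLHS]mulr_natl ler_wpM2r// ler_nat leq_subr.
rewrite normrM normrX ler_pM ?exprn_ge0 ?UT// lerXn2r// nnegrE//.
by apply: le_trans US.
Qed.

Lemma sup_exists (P : R -> R) : bm L P -> exists M, [/\ 0 <= M,
  forall x, 0 <= x <= L -> `|P x| <= M &
  forall B, (forall x, 0 <= x <= L -> `|P x| <= B) -> M <= B].
Proof.
move=> [_ [M PM]].
pose E := [set `|P x| | x in `[0, L]].
have hE : has_sup E.
  split; first by exists `|P 0|; exists 0 => //=; rewrite in_itv /= lexx ltW.
  by exists M => _ [x /= xL <-]; apply: PM; rewrite in_itv in xL.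
have hx x : 0 <= x <= L -> `|P x| <= sup E.
  by move=> xL; apply: sup_upper_bound hE _ _; exists x => //=; rewrite in_itv.
exists (sup E); split=> //.
  by apply: le_trans (normr_ge0 _) (hx 0 _); rewrite lexx ltW.
move=> B hB; apply: ge_sup; first by case: hE.
by move=> _ [x /= xL <-]; apply: hB; rewrite in_itv in xL.
Qed.

Lemma double_le (i : nat) : ((i.+1 <= 2 * l)%N -> (i <= 2 * l)%N) * ((i.+2 <= 2 * l)%N -> (i <= 2 * l)%N).
Proof. by split; lia. Qed.

(** Suprema of consecutive derivatives up to order 2l satisfy Landau's inequalities. The loop is
    closed by the equation, which bounds the L^1 norm of D^(2l+1) u, hence sup|D^(2l) u|, by f and
    the derivatives of order below 2l; these interpolate with a small coefficient on sup|D^(2l)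
    u|. *)
Lemma all_derivatives (W K : R) : 0 <= K -> exists C : R, 0 <= C /\
  forall (f : R -> R) (tau : R) (U : nat -> R -> R),
    tower L l U -> L2 L f -> scaled_equation L l U a tau k f -> 0 < tau <= 1 ->
    sqn L f <= W -> sqn L (U l) <= K * W ->
    [/\ forall i x, (i <= 2 * l)%N -> 0 <= x <= L -> U i x ^+ 2 <= C * W,
        L2 L (U (2 * l + 1)) & sqn L (U (2 * l + 1)) <= C * W].
Proof.
move=> K0.
have L0 := L_gt0; have a0 := a_gt0.
have [W0|W0] := ltP W 0.
  exists 0; split=> // f tau U _ _ _ _ fW.
  by have := le_lt_trans fW W0; rewrite ltNge sqn_ge0.
pose om := Num.sqrt W; have om0 : 0 <= om by apply: sqrtr_ge0.
have om2 : om ^+ 2 = W by rewrite sqr_sqrtr.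
pose kap := K + 1 / a ^+ 2.
have kap0 : 0 <= kap by rewrite addr_ge0// divr_ge0// exprn_ge0// ltW.
pose K0' := Num.sqrt (2 * kap); have K00 : 0 <= K0' by apply: sqrtr_ge0.
pose S := K0' * om; have S0 : 0 <= S by rewrite mulr_ge0.
pose A := a + l%:R + S ^+ k.
have A0 : 0 < A by rewrite /A -addrA ltr_pwDl// addr_ge0// exprn_ge0.
(* If [T] bounds the derivatives of order below 2l, then A T bounds the lower order terms and E T is
   the contribution of [T] to sup|D^(2l) u|. Interpolating with the constant 1 / (2 E) makes half of
   it absorbable. *)
pose E := 2 / L + L * A.
have E0 : 0 < E by rewrite addr_gt0 ?divr_gt0 ?mulr_gt0.
have e0 : 0 < (2 * E)^-1 by rewrite invr_gt0 mulr_gt0.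
have [C0 [C00 hC0]] := interpolation (2 * l) L_gt0 e0.
(* In units of [om], the square root of W: [K1] bounds D^(2l) u, [K2] the derivatives below, [K4]
   the lower order terms. *)
pose K1 := 2 * (E * C0 * K0' + Num.sqrt L).
have K10 : 0 <= K1 by rewrite /K1 mulr_ge0// addr_ge0 ?sqrtr_ge0// mulr_ge0// mulr_ge0// ltW.
pose K2 := (2 * E)^-1 * K1 + C0 * K0'.
have K20 : 0 <= K2 by rewrite addr_ge0// mulr_ge0// ltW.
pose K4 := A * K2.
exists ((K1 + K2) ^+ 2 + (2 + 2 * K4 ^+ 2 * L)); split.
  by rewrite addr_ge0 ?sqr_ge0// addr_ge0// mulr_ge0 ?(ltW L0)// mulr_ge0// sqr_ge0.
move=> f tau U hU hf heq /andP[t0 t1] fW hK.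
have [Uac _ _] := hU.
have bU i : (i <= 2 * l)%N -> bm L (U i) by move=> /Uac/ac_bm.
have bUlt i : (i < 2 * l)%N -> bm L (U i) by move=> /ltnW/bU.
have h0 : (0 < 2 * l)%N by rewrite muln_gt0.
have hb0 : sqn L (U 0) <= W / a ^+ 2.
  rewrite ler_pdivlMr ?exprn_gt0// mulrC; apply: le_trans fW.
  by apply: sqn_le_forcing heq => //; rewrite t0.
have b00 := sqn_ge0 L (U 0); have b10 := sqn_ge0 L (U 1).
have b0k : sqn L (U 0) <= kap * W.
  by apply: le_trans hb0 _; rewrite /kap mulrDl mul1r [_^-1 * W]mulrC lerDr mulr_ge0.
have b1k : sqn L (U 1) <= kap * W.
  have kW : 0 <= kap * W by rewrite mulr_ge0.
  rewrite -(ler_pXn2r l_gt0) ?nnegrE//; apply: le_trans (sqn_logconvex L_gt0 l_gt0 hU) _.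
  rewrite -(prednK l_gt0) exprS /= (prednK l_gt0); apply: ler_pM; rewrite ?sqn_ge0 ?exprn_ge0//.
    by apply: le_trans hK _; rewrite ler_wpM2r// lerDl divr_ge0// exprn_ge0// ltW.
  by rewrite lerXn2r ?nnegrE.
have US x : 0 <= x <= L -> `|U 0 x| <= S.
  move=> xL; have := sup4_le L_gt0 l_gt0 hU xL => h.
  have {}h : U 0 x ^+ 4 <= (2 * kap * W) ^+ 2.
    apply: le_trans h _; rewrite -mulrA exprMn (_ : 2 ^+ 2 = 4); last by ring.
    by rewrite ler_wpM2l// expr2 ler_pM.
  rewrite -ler_sqr ?nnegrE// /S exprMn sqr_sqrtr ?mulr_ge0// om2.
  rewrite real_normK ?num_real// -ler_sqr ?nnegrE ?sqr_ge0 ?mulr_ge0//.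
  by rewrite -exprM.
have hsup i : exists M : R, 0 <= M /\ ((i <= 2 * l)%N ->
    (forall x : R, 0 <= x <= L -> `|U i x| <= M) /\
    (forall B : R, (forall x : R, 0 <= x <= L -> `|U i x| <= B) -> M <= B)).
  have [il|il] := leqP i (2 * l); last by exists 0; split=> //.
  by have [M [M0 h1 h2]] := sup_exists (bU i il); exists M.
have [s hs] := choice hsup.
have s_ge0 i : 0 <= s i by case: (hs i).
have sU i x : (i <= 2 * l)%N -> 0 <= x <= L -> `|U i x| <= s i.
  by move=> il; have [_ /(_ il)[h _]] := hs i; exact: h.
have sB i B : (i <= 2 * l)%N -> (forall x, 0 <= x <= L -> `|U i x| <= B) -> s i <= B.
  by move=> il; have [_ /(_ il)[_ h]] := hs i; exact: h.
have s0S : s 0%N <= S by apply: sB.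
have inter : forall i, (i < 2 * l)%N -> s i <= (2 * E)^-1 * s (2 * l)%N + C0 * s 0%N.
  apply: hC0 => // i il h /andP[hp hL].
  have il1 := (double_le i.+1).1 il; have il2 := (double_le i).2 il.
  rewrite -ler_pdivlMl//; apply: sB => // x xL.
  rewrite ler_pdivlMl// expr2 -mulrA; apply: (landau_bound (Uac i il2) _ xL).
  - by rewrite hp.
  - by move=> t tL; exact: sU.
  - move=> t tL th; apply: le_trans (ac_lip (Uac _ il1) _ xL tL) _.
      by move=> y yL; exact: (sU _ _ il yL).
    by rewrite mulrC ler_wpM2r.
pose T := (2 * E)^-1 * s (2 * l)%N + C0 * s 0%N.
have T0 : 0 <= T by rewrite addr_ge0// mulr_ge0// ltW.
have lowT x : 0 <= x <= L -> `|lower_terms U x| <= A * T.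
  move=> xL; apply: lower_terms_le => //; last exact: US.
  by move=> i il; apply: le_trans (inter i il); apply: sU => //; exact: ltnW.
have topE x : 0 <= x <= L -> U (2 * l + 1) x = (-1) ^+ (l + 1) * (tau * (f x - lower_terms U x)).
  by move=> xL; apply: (inv_inj (signrMK (l + 1))); rewrite signrMK; exact: heq xL.
have top_le x : 0 <= x <= L -> `|U (2 * l + 1) x| <= `|f x| + `|lower_terms U x|.
  move=> xL; rewrite topE// !normrM normrX normrN1 expr1n mul1r gtr0_norm//.
  by apply: le_trans (ler_normB _ _); rewrite ler_piMl.
have blow : bm L (lower_terms U) by apply: lower_terms_bm.
have top_L2 : L2 L (U (2 * l + 1)).
  apply: (eq_L2 (p := fun x => (-1) ^+ (l + 1) * (tau * (f x - lower_terms U x)))).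
    by move=> x xL; rewrite topE.
  exact/L2Z/L2Z/L2B/bm_L2.
have if_ := L2_itg hf.
have intf : prim (fun x => `|f x|) L <= Num.sqrt L * om.
  have h := cauchy_schwarz (L2_norm hf) (bm_L2 (bm_cst L 1)).
  rewrite (@eq_prim _ _ _ (fun x => `|f x|)) in h; last by move=> x _; rewrite mulr1.
  have e1 : sqn L (fun=> 1 : R) = L.
    by rewrite /sqn (@eq_prim _ _ _ (fun=> 1)) ?prim_cst ?mul1r ?ltW// => x _; rewrite expr1n.
  have e2 : sqn L (fun x => `|f x|) = sqn L f.
    by apply: eq_prim => x _; rewrite real_normK ?num_real.
  rewrite e1 e2 in h.
  rewrite -ler_sqr ?nnegrE ?mulr_ge0 ?sqrtr_ge0//; last by apply: prim_ge0.
  rewrite exprMn sqr_sqrtr ?(ltW L0)// om2 mulrC; apply: le_trans h _.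
  by rewrite ler_wpM2r// ltW.
have itop := L2_itg top_L2.
have int_top : prim (fun x => `|U (2 * l + 1) x|) L <= Num.sqrt L * om + A * T * L.
  apply: (@le_trans _ _ (prim (fun x => `|f x| + A * T) L)).
    apply: le_prim; [exact: itg_norm|by apply: itgD; [exact: itg_norm|exact: itg_cst]|].
    by move=> x xL; apply: le_trans (top_le x xL) _; rewrite lerD2l lowT.
  by rewrite primD ?prim_cst ?(ltW L0)//; [rewrite lerD2r|exact: itg_norm|exact: itg_cst].
have p2l : ((2 * l).-1.+1 = 2 * l)%N by rewrite prednK.
have top_s : s (2 * l)%N <= E * T + Num.sqrt L * om.
  have il1 : ((2 * l).-1 <= 2 * l)%N by apply: leq_pred.
  have ilt : ((2 * l).-1 < 2 * l)%N by rewrite p2l.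
  apply: (@le_trans _ _ (2 / L * T + (Num.sqrt L * om + A * T * L))); last first.
    by rewrite /E mulrDl; lra.
  apply: sB => // x xL; rewrite -(ler_pM2l L0).
  have -> : L * (2 / L * T + (Num.sqrt L * om + A * T * L)) =
    2 * T + L * (Num.sqrt L * om + A * T * L) by field; rewrite gt_eqF.
  have aP := Uac _ il1; rewrite p2l in aP.
  (* Landau's inequality with the full length h = L; the oscillation of D^(2l) u is at most the L^1
     norm of D^(2l+1) u, of which no supremum is available. *)
  apply: (landau_bound aP _ xL); first by rewrite L0 lexx.
    by move=> t tL; apply: le_trans (inter _ ilt); exact: sU.
  move=> t tL _; have [_ hP] := Uac _ (leqnn _).
  wlog tx : t x xL tL / x <= t.
    by move=> h; have [/h|/ltW/h] := leP x t; [exact|rewrite distrC; exact].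
  have [[x0 _] [_ tL']] := (andP xL, andP tL).
  rewrite (hP t tL) (hP x xL) opprD addrACA subrr add0r -addn1.
  apply: le_trans (norm_primB itop x0 tx tL') _; apply: le_trans int_top.
  apply: (@le_trans _ _ (prim (fun x => `|U (2 * l + 1) x|) t)).
    by rewrite lerBlDr lerDl; apply: prim_ge0.
  apply: (prim_le (itg_norm itop)) => //; exact: le_trans tx.
have topK : s (2 * l)%N <= K1 * om.
  have e1 : E * T = s (2 * l)%N / 2 + E * C0 * s 0%N by rewrite /T; field; rewrite gt_eqF.
  have e2 : E * C0 * s 0%N <= E * C0 * (K0' * om) by rewrite ler_wpM2l// mulr_ge0// ltW.
  have e3 : K1 * om = 2 * (E * C0 * (K0' * om)) + 2 * (Num.sqrt L * om) by rewrite /K1; ring.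
  rewrite e3; rewrite e1 in top_s; lra.
have TK : T <= K2 * om.
  have -> : K2 * om = (2 * E)^-1 * (K1 * om) + C0 * (K0' * om) by rewrite /K2; ring.
  apply: lerD; first by rewrite ler_wpM2l// ltW.
  by rewrite ler_wpM2l.
have sK i : (i <= 2 * l)%N -> s i <= (K1 + K2) * om.
  rewrite leq_eqVlt mulrDl => /orP[/eqP ->|il].
    by apply: le_trans topK _; rewrite lerDl mulr_ge0.
  by apply: le_trans (inter i il) _; apply: le_trans TK _; rewrite lerDr mulr_ge0.
have rest : 0 <= 2 + 2 * K4 ^+ 2 * L.
  by rewrite addr_ge0// mulr_ge0 ?(ltW L0)// mulr_ge0// sqr_ge0.
split=> //.
- move=> i x il xL; rewrite mulrDl; apply: (@le_trans _ _ ((K1 + K2) ^+ 2 * W)); last first.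
    by rewrite lerDl mulr_ge0.
  rewrite -om2 -exprMn -(real_normK (num_real (U i x))) ler_sqr ?nnegrE//.
    by apply: le_trans (sU i x il xL) (sK i il).
  exact: mulr_ge0 (addr_ge0 K10 K20) om0.
- apply: (@le_trans _ _ ((2 + 2 * K4 ^+ 2 * L) * W)); last first.
    by rewrite ler_wpM2r// lerDr sqr_ge0.
  have [_ if2] := hf; have [_ it2] := top_L2.
  apply: (@le_trans _ _ (prim (fun x => 2 * f x ^+ 2 + 2 * (K4 * om) ^+ 2) L)).
    apply: le_prim => //; first by apply: itgD; [exact: itgZ|exact: itg_cst].
    move=> x xL; rewrite -(real_normK (num_real (U _ x))) -(real_normK (num_real (f x))).
    have h1 := top_le x xL; have h2 : `|lower_terms U x| <= K4 * om.
      by apply: le_trans (lowT x xL) _; rewrite /K4 -mulrA ler_wpM2l// ltW.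
    have h3 : `|U (2 * l + 1) x| <= `|f x| + K4 * om by apply: le_trans h1 _; rewrite lerD2l.
    have h4 : `|U (2 * l + 1) x| ^+ 2 <= (`|f x| + K4 * om) ^+ 2.
      by rewrite ler_sqr ?nnegrE// (le_trans _ h3).
    apply: le_trans h4 _; have := sqr_ge0 (`|f x| - K4 * om).
    by rewrite !expr2; lra.
  rewrite primD; [|exact: itgZ|exact: itg_cst].
  rewrite primZ// prim_cst ?(ltW L0)//.
  rewrite -/(sqn L f) exprMn om2.
  have -> : (2 + 2 * K4 ^+ 2 * L) * W = 2 * W + 2 * (K4 ^+ 2 * W) * L by ring.
  by rewrite lerD2r ler_wpM2l.
Qed.

End AllDerivatives.

(** * Existence *)

Section Existence.
Variables (R : realType) (L a : R) (l k : nat) (f : R -> R).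
Hypothesis L_gt0 : 0 < L.
Hypothesis l_gt0 : (0 < l)%N.
Hypothesis a_gt0 : 0 < a.
Hypothesis f_itg : itg L f.

Lemma exprn_dist_le (u v M d : R) (n : nat) : 1 <= M -> `|u| <= M -> `|v| <= M ->
  `|u - v| <= d -> `|u ^+ n - v ^+ n| <= n%:R * M ^+ n * d.
Proof.
move=> M1 uM vM uv; have M0 : 0 <= M by lra.
have d0 : 0 <= d by apply: le_trans uv.
elim: n => [|n IH]; first by rewrite !expr0 subrr normr0 !mul0r.
rewrite (_ : u ^+ n.+1 - v ^+ n.+1 = u * (u ^+ n - v ^+ n) + v ^+ n * (u - v)); last first.
  by rewrite !exprS; ring.
apply: le_trans (ler_normD _ _) _; rewrite !normrM normrX.
apply: (@le_trans _ _ (M * (n%:R * M ^+ n * d) + M ^+ n.+1 * d)).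
  apply: lerD; first by apply: ler_pM.
  apply: ler_pM => //.
  apply: (@le_trans _ _ (M ^+ n)); first by rewrite lerXn2r// nnegrE.
  by rewrite ler_weXn2l.
by rewrite exprS -[n.+1%:R]natr1 le_eqVlt; apply/orP; left; apply/eqP; ring.
Qed.

Lemma lower_terms_dist_le (U V : nat -> R -> R) (M d x : R) : 1 <= M ->
  (forall i, `|U i x| <= M) -> (forall i, `|V i x| <= M) ->
  (forall i, `|U i x - V i x| <= d) ->
  `|lower_terms a l k U x - lower_terms a l k V x| <=
  (a + l%:R + (M ^+ k + k%:R * M ^+ k * M)) * d.
Proof.
move=> M1 UM VM UV; have M0 : 0 <= M by lra.
have d0 : 0 <= d by apply: le_trans (UV 0%N).
rewrite /lower_terms.
set s1 := \sum_(_ <= _ < _) _; set s2 := \sum_(_ <= _ < _) _.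
have hs : `|s1 - s2| <= l%:R * d.
  rewrite /s1 /s2 -sumrB; apply: le_trans (ler_norm_sum _ _ _) _.
  apply: (@le_trans _ _ (\sum_(1 <= j < l) d)).
    by apply: ler_sum => j _; rewrite -mulrBr normrM normrX normrN1 expr1n mul1r.
  by rewrite sumr_const_nat -[leLHS]mulr_natl ler_wpM2r// ler_nat leq_subr.
have hk := exprn_dist_le k M1 (UM 0%N) (VM 0%N) (UV 0%N).
have hp : `|U 0 x ^+ k * U 1 x - V 0 x ^+ k * V 1 x| <= (M ^+ k + k%:R * M ^+ k * M) * d.
  rewrite (_ : _ - _ = U 0 x ^+ k * (U 1 x - V 1 x) + (U 0 x ^+ k - V 0 x ^+ k) * V 1 x); last by ring.
  apply: le_trans (ler_normD _ _) _; rewrite !normrM mulrDl; apply: lerD.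
    by apply: ler_pM => //; rewrite normrX lerXn2r// nnegrE.
  rewrite (_ : k%:R * M ^+ k * M * d = k%:R * M ^+ k * d * M); last by ring.
  by apply: ler_pM.
rewrite (_ : _ - _ = a * (U 0 x - V 0 x) + (s1 - s2) +
  (U 0 x ^+ k * U 1 x - V 0 x ^+ k * V 1 x)); last by ring.
apply: le_trans (ler_normD _ _) _; rewrite mulrDl [(a + _) * d]mulrDl lerD//.
apply: le_trans (ler_normD _ _) _; rewrite lerD//.
by rewrite normrM gtr0_norm// ler_pM2l.
Qed.

Lemma odd_lt_double j : (j < l)%N -> (2 * j + 1 < 2 * l)%N.
Proof. by clear; lia. Qed.

(** The retraction radius M0 + 1 exceeds the a priori bound, so the limit stays away from the sphere
    and tau = 1. The value tau = 0 is excluded first, as the zero function is not near the sphere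
    either. *)
Lemma leray_schauder (M0 : R) : 0 <= M0 ->
  (forall tau U, tower L l U -> scaled_equation L l U a tau k f -> 0 < tau <= 1 ->
     forall i x, (i < 2 * l)%N -> 0 <= x <= L -> `|U i x| <= M0) ->
  exists U, tower L l U /\ scaled_equation L l U a 1 k f.
Proof.
move=> M00 apriori.
have L0 := L_gt0; have a0 := a_gt0.
have [e eP] := hermite_basis l (lt0r_neq0 L_gt0).
have [K0 [K00 hK0]] := invop_bound l e L_gt0.
pose M := M0 + 1.
have M1 : 1 <= M by rewrite /M; lra.
have M_gt0 : 0 < M by lra.
have h2l : (0 < 2 * l)%N by rewrite muln_gt0.
pose d := (2 * l).-1.
have dE : d.+1 = (2 * l)%N by rewrite /d prednK.
(* The lower order terms involve orders below 2l only, so the unknown is a tuple of 2l unrelated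
   functions; it is the fixed point equation that makes them successive derivatives. *)
pose W (w : 'I_d.+1 -> R -> R) (i : nat) : R -> R := w (inord i).
pose F (w : 'I_d.+1 -> R -> R) (x : R) := (-1) ^+ (l + 1) * (f x - lower_terms a l k (W w) x).
pose Psi (w : 'I_d.+1 -> R -> R) (i : 'I_d.+1) (x : R) := invop l L e (F w) i x.
have Wbm w i : admissible L M w -> bm L (W w i).
  by move=> /(_ (inord i))[mw wM]; split=> //; exists M.
have lowbm w : admissible L M w -> bm L (lower_terms a l k (W w)).
  by move=> adm; apply: lower_terms_bm => // i _; exact: Wbm.
have WM w i x : admissible L M w -> 0 <= x <= L -> `|W w i x| <= M.
  by move=> /(_ (inord i))[_ wM]; exact: wM.
have Fitg w : admissible L M w -> itg L (F w).
  move=> /lowbm/bm_itg h; apply: eq_itg (itgZ ((-1) ^+ (l + 1)) (itgD f_itg (itgZ (-1) h))) => x _.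
  by rewrite /F; ring.
pose A := a + l%:R + M ^+ k.
have A0 : 0 <= A by rewrite !addr_ge0// ?exprn_ge0// ltW.
pose Lam := K0 * (prim (fun x => `|f x|) L + A * M * L).
have Lam0 : 0 <= Lam.
  rewrite mulr_ge0// addr_ge0//; first by apply: prim_ge0.
  by rewrite mulr_ge0 ?(ltW L0)// mulr_ge0// ltW.
have intF w : admissible L M w -> prim (fun x => `|F w x|) L <= prim (fun x => `|f x|) L + A * M * L.
  move=> adm; apply: (@le_trans _ _ (prim (fun x => `|f x| + A * M) L)).
    apply: le_prim; [exact/itg_norm/Fitg|by apply: itgD; [exact: itg_norm|exact: itg_cst]|].
    move=> x xL; rewrite normrM normrX normrN1 expr1n mul1r.
    apply: le_trans (ler_normB _ _) _; rewrite lerD2l.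
    by apply: lower_terms_le => //; [exact: ltW|move=> i _; exact: WM|exact: WM].
  by rewrite primD ?prim_cst ?(ltW L0)//; [exact: itg_norm|exact: itg_cst].
pose B := a + l%:R + (M ^+ k + k%:R * M ^+ k * M).
have B0 : 0 <= B.
  have Mk : 0 <= M ^+ k by rewrite exprn_ge0// ltW.
  have kM : 0 <= k%:R * M ^+ k * M by rewrite mulr_ge0 ?mulr_ge0// ltW.
  by rewrite addr_ge0 ?addr_ge0// ltW.
have KB0 : 0 <= K0 * (B * L) by rewrite mulr_ge0// mulr_ge0// ltW.
have ile (i : 'I_d.+1) : (i < 2 * l)%N by rewrite -dE.
have [||tau [w [/andP[t0 t1] adm wE alt]]] := @schauder R d L M Lam (K0 * (B * L)) L_gt0 M_gt0 Lam0 KB0 Psi.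
- move=> w adm i x y xL yL; rewrite distrC [`|x - y|]distrC.
  have aP : ac L (invop l L e (F w) i) (invop l L e (F w) i.+1).
    by apply: invop_ac => //; [exact: Fitg|exact: ltnW (ile i)].
  apply: (ac_lip aP _ xL yL).
  move=> t tL; apply: le_trans (hK0 _ (Fitg _ adm) _ _ (ile i) tL) _.
  by rewrite ler_wpM2l// intF.
- move=> w w' dl adm adm' ww' i x xL.
  have dl0 : 0 <= dl by apply: le_trans (normr_ge0 _) (ww' i x xL).
  rewrite /Psi -invopB//; [|exact: Fitg..].
  have iFF : itg L (fun t => F w t - F w' t).
    by apply: eq_itg (itgD (Fitg _ adm) (itgZ (-1) (Fitg _ adm'))) => t _; ring.
  apply: le_trans (hK0 _ iFF _ _ (ltnW (ile i)) xL) _.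
  rewrite -!mulrA ler_wpM2l//; apply: (@le_trans _ _ (prim (fun=> B * dl) L)).
    apply: le_prim; [exact: itg_norm|exact: itg_cst|move=> t tL].
    rewrite /F -mulrBr normrM normrX normrN1 expr1n mul1r.
    rewrite (_ : _ - _ = - (lower_terms a l k (W w) t - lower_terms a l k (W w') t)); last by ring.
    rewrite normrN; apply: lower_terms_dist_le => // j; [exact: WM|exact: WM|exact: ww'].
  by rewrite prim_cst ?(ltW L0)// le_eqVlt; apply/orP; left; apply/eqP; ring.
pose U i x := tau * invop l L e (F w) i x.
have UW i x : (i < 2 * l)%N -> 0 <= x <= L -> U i x = W w i x.
  by move=> il xL; rewrite /W wE// /Psi inordK// dE.
have tU : tower L l U.
  split=> [i il|i il|i il]; first exact/acZ/invop_ac/il/Fitg.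
    by rewrite /U (invop0 L_gt0 eP)// mulr0.
  by rewrite /U (invopL eP)// mulr0.
have eU : scaled_equation L l U a tau k f.
  move=> x xL; have -> : U (2 * l + 1) x = tau * F w x by rewrite /U (invop_top eP).
  rewrite -/(lower_terms a l k U x) /F mulrCA signrMK.
  congr (_ * (_ - _)); rewrite /lower_terms !UW//; last exact: (@odd_lt_double 0).
  congr (_ + _ + _); rewrite !big_nat; apply: eq_bigr => j /andP[_ jl].
  by rewrite UW//; apply: odd_lt_double.
have tpos : 0 < tau.
  rewrite lt_neqAle t0 andbT eq_sym; apply/eqP => te.
  case: alt => [t1'|alt]; first by move/eqP: t1'; rewrite te eq_sym oner_eq0.
  have [|i [x [xL]]] := alt (M / 2); first by rewrite divr_gt0.
  by rewrite wE// te mul0r normr0; lra.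
have UM0 : forall i x, (i < 2 * l)%N -> 0 <= x <= L -> `|U i x| <= M0.
  by apply: (apriori tau U) => //; rewrite tpos.
exists U; split=> //.
case: alt => [<- //|alt].
have [|i [x [xL]]] := alt (1 / 2); first by rewrite divr_gt0.
have := UM0 i x (ile i) xL; rewrite UW// /W inord_val /M.
by lra.
Qed.

End Existence.

(** * Solutions as chains of primitives, with constants chosen before f *)

Section TowerSolutions.
Variables (R : realType) (L a : R) (l k : nat).
Hypothesis L_gt0 : 0 < L.
Hypothesis l_gt0 : (0 < l)%N.
Hypothesis a_gt0 : 0 < a.

Definition tower_solution (C W : R) (f : R -> R) (U : nat -> R -> R) : Prop :=
  [/\ tower L l U, scaled_equation L l U a 1 k f,
      forall i x, (i <= 2 * l)%N -> 0 <= x <= L -> U i x ^+ 2 <= C * W,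
      L2 L (U (2 * l + 1)) & sqn L (U (2 * l + 1)) <= C * W].

(** Reduces both cases to a bound of |D^l u|^2 that is uniform in [tau]. [C] is fixed before f,
    which enters through the bound [W] only. *)
Lemma exists_tower_solution (W K : R) : 0 <= K -> exists C, 0 <= C /\
  forall f, L2 L f -> sqn L f <= W ->
  (forall tau U, tower L l U -> scaled_equation L l U a tau k f -> 0 < tau <= 1 ->
     sqn L (U l) <= K * W) ->
  exists U, tower_solution C W f U.
Proof.
move=> K0; have [C [C0 hC]] := all_derivatives k L_gt0 l_gt0 a_gt0 W K0.
exists C; split=> // f hf fW hK.
have CW0 : 0 <= C * W by rewrite mulr_ge0// (le_trans (sqn_ge0 L f)).
have [U [tU eU]] : exists U, tower L l U /\ scaled_equation L l U a 1 k f.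
  apply: (leray_schauder L_gt0 l_gt0 a_gt0 (L2_itg hf) (sqrtr_ge0 (C * W))).
  move=> tau U tU eU t01 i x il xL.
  have [h _ _] := hC f tau U tU hf eU t01 fW (hK tau U tU eU t01).
  rewrite -ler_sqr ?nnegrE ?sqrtr_ge0// sqr_sqrtr// real_normK ?num_real//.
  by apply: h => //; exact: ltnW.
have t01 : 0 < (1 : R) <= 1 by rewrite ltr01 lexx.
have [h1 h2 h3] := hC f 1 U tU hf eU t01 fW (hK 1 U tU eU t01).
by exists U; split.
Qed.

Lemma regular_tower_solution (W : R) : (k < 4 * l)%N -> exists C, 0 <= C /\
  forall f, L2 L f -> sqn L f <= W -> exists U, tower_solution C W f U.
Proof.
move=> kl; have [W0|W0] := ltP W 0.
  by exists 0; split=> // f _ fW; have := le_lt_trans fW W0; rewrite ltNge sqn_ge0.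
pose K := (1 + L) / a + (4 ^+ l * (W / a ^+ 2) ^+ (2 * l) + 1) ^+ k / a ^+ 2.
have K0 : 0 <= K.
  have h1 : 0 <= W / a ^+ 2 by rewrite divr_ge0// exprn_ge0// ltW.
  rewrite addr_ge0// divr_ge0 ?exprn_ge0 ?(ltW a_gt0)//.
    by rewrite addr_ge0 ?ltW.
  by rewrite addr_ge0// mulr_ge0 ?exprn_ge0.
have [C [C0 hC]] := exists_tower_solution W K0.
exists C; split=> // f hf fW; apply: hC => // tau U tU eU t01.
have [S [S0 US [y yL Sy]]] := sup_attained L_gt0 tU.
apply: (@regular_numeric _ l k L a W (sqn L (U 0)) (sqn L (U 1)) (sqn L (U l)) S
  (prim (fun x => U 0 x ^+ (k + 2)) L)) => //; rewrite ?sqn_ge0//.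
- exact: le_trans (sqn_le_forcing L_gt0 l_gt0 tU hf a_gt0 t01 eU) fW.
- apply: le_trans (top_energy_le L_gt0 l_gt0 tU hf a_gt0 t01 eU) _.
  by rewrite lerD2r ler_wpM2l ?addr_ge0 ?(ltW L_gt0)// ler_pM2r ?invr_gt0.
- exact: prim_pow_le tU US.
- rewrite -Sy (_ : _ ^+ 4 = U 0 y ^+ 4); first exact: (sup4_le L_gt0 l_gt0 tU yL).
  by rewrite !(exprM _ 2 2) real_normK ?num_real.
- exact: sqn_logconvex.
Qed.

(** The Gagliardo-Nirenberg inequality raised to the power 4l, which clears the fractional
    exponents. *)
Definition tower_GN (G : R) : Prop := forall U, tower L l U -> forall x, 0 <= x <= L ->
  U 0 x ^+ (4 * l) <= G * (sqn L (U l) * sqn L (U 0) ^+ (2 * l).-1).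

Lemma critical_tower_solution (W : R) : k = (4 * l)%N -> exists C, 0 <= C /\
  forall f G, 0 <= G -> tower_GN G ->
    G * (sqn L f / a ^+ 2) ^+ (2 * l) <= (2 * l + 1)%:R ^+ 2 ->
    L2 L f -> sqn L f <= W -> exists U, tower_solution C W f U.
Proof.
move=> kl; have [W0|W0] := ltP W 0.
  by exists 0; split=> // f G _ _ _ _ fW; have := le_lt_trans fW W0; rewrite ltNge sqn_ge0.
pose K := 32 * (2 * l + 1)%:R * (1 + L) / a * ((W / a ^+ 2) ^+ (2 * l) + 1).
have a20 : 0 < a ^+ 2 by rewrite exprn_gt0.
have K0 : 0 <= K.
  have h1 : 0 <= W / a ^+ 2 by rewrite divr_ge0// ltW.
  apply: mulr_ge0; last by rewrite addr_ge0// exprn_ge0.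
  by rewrite divr_ge0 ?(ltW a_gt0)// mulr_ge0 ?addr_ge0 ?(ltW L_gt0).
have [C [C0 hC]] := exists_tower_solution W K0.
exists C; split=> // f G G0 hG hGf hf fW; apply: hC => // tau U tU eU t01.
have [S [S0 US [y yL Sy]]] := sup_attained L_gt0 tU.
have hb := sqn_le_forcing L_gt0 l_gt0 tU hf a_gt0 t01 eU.
apply: (@critical_numeric _ l L a W G (sqn L (U 0)) (sqn L (U 1)) (sqn L (U l)) S
  (prim (fun x => U 0 x ^+ (4 * l + 2)) L)) => //; rewrite ?sqn_ge0//.
- exact: le_trans hb fW.
- rewrite -kl; apply: le_trans (top_energy_le L_gt0 l_gt0 tU hf a_gt0 t01 eU) _.
  by rewrite lerD2r ler_wpM2l ?addr_ge0 ?(ltW L_gt0)// ler_pM2r ?invr_gt0.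
- exact: prim_pow_le tU US.
- by apply: prim_pow_gain => //; exists y.
- rewrite -Sy (_ : _ ^+ 4 = U 0 y ^+ 4); first exact: (sup4_le L_gt0 l_gt0 tU yL).
  by rewrite !(exprM _ 2 2) real_normK ?num_real.
- exact: sqn_logconvex.
- rewrite -Sy (_ : _ ^+ (4 * l) = U 0 y ^+ (4 * l)); first exact: hG.
  have -> : (4 * l = 2 * (2 * l))%N by rewrite mulnA.
  by rewrite !(exprM _ 2) real_normK ?num_real.
- apply: le_trans hGf; rewrite ler_wpM2l// lerXn2r ?nnegrE ?sqn_ge0//.
    by rewrite divr_ge0 ?sqn_ge0// ltW.
  by rewrite ler_pdivlMr// mulrC.
Qed.

End TowerSolutions.

(** * Test functions and weak derivatives *)

Section SmoothFunctions.
Variable R : realType.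
Implicit Types (f g phi : R -> R) (p : {poly R}) (s t x : R).

Definition smooth g : Prop := forall (n : nat) x, derivable (g^`(n)%classic) x 1.

Lemma smooth_seq (G : nat -> R -> R) :
  (forall n x, is_derive x 1 (G n) (G n.+1 x)) ->
  smooth (G 0%N) /\ forall n, ((G 0%N)^`(n)%classic = G n).
Proof.
move=> hG; have e n : (G 0%N)^`(n)%classic = G n.
  elim: n => [//|n IH]; rewrite derive1nS IH; apply/funext => x.
  by rewrite derive1E; have [_ ->] := hG n x.
by split=> // n x; rewrite e; case: (hG n x).
Qed.

Lemma smooth_is_derive g n x : smooth g ->
  is_derive x 1 (g^`(n)%classic) (g^`(n.+1)%classic x).
Proof.
move=> sg; apply: DeriveDef; first exact: sg.
by rewrite derive1nS derive1E.
Qed.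

Lemma expR_decay (n : nat) s : 0 < s ->
  exists C, forall y, 0 <= y -> y ^+ n * expR (- (s * y)) <= C.
Proof.
move=> s0; case: n => [|n].
  exists 1 => y y0; rewrite expr0 mul1r expR_le1 oppr_le0.
  by rewrite mulr_ge0// ltW.
exists (n.+1`!%:R / s ^+ n.+1) => y y0.
have sn : 0 < s ^+ n.+1 by rewrite exprn_gt0.
have fn : 0 < n.+1`!%:R :> R by rewrite ltr0n fact_gt0.
rewrite expRN ler_pdivrMr ?expR_gt0// mulrAC ler_pdivlMr// mulrC -exprMn.
rewrite -ler_pdivrMl// mulrC.
apply: le_trans (expR_ge1Dxn n (mulr_ge0 (ltW s0) y0)).
by rewrite lerDr.
Qed.

Lemma poly_expR_decay p s : 0 < s ->
  exists C, forall y, 0 <= y -> `|p.[y]| * expR (- (s * y)) <= C.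
Proof.
move=> s0; have /choice[c hc] n := expR_decay n s0.
exists (\sum_(i < size p) `|p`_i| * c i) => y y0.
rewrite horner_coef.
apply: (@le_trans _ _ (\sum_(i < size p) `|p`_i| * (y ^+ i * expR (- (s * y))))).
  under [leRHS]eq_bigr do rewrite mulrA.
  rewrite -mulr_suml ler_wpM2r ?expR_ge0//.
  apply: le_trans (ler_norm_sum _ _ _) _; apply: ler_sum => i _.
  by rewrite normrM normrX (ger0_norm y0).
by apply: ler_sum => i _; rewrite ler_wpM2l// hc.
Qed.

(** The classical flat function; the parameter [s] is kept because the function tends to 1 on t > 0
    as [s] tends to 0. *)
Definition psi s t : R := if 0 < t then expR (- (s * t^-1)) else 0.

Lemma is_derive0_quadratic g C : (forall h, `|g h| <= C * h ^+ 2) ->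
  is_derive (0 : R) 1 g 0.
Proof.
move=> hg; have g0 : g 0 = 0.
  by apply/eqP; rewrite -normr_le0 (le_trans (hg 0))// expr0n mulr0.
have cv : (fun h : R => h^-1 *: (g (h *: 1 + 0) - g 0)) @ 0^' --> (0 : R).
  apply/cvgrPdist_le => e e0.
  have C1 : 0 < `|C| + 1 by rewrite ltr_wpDl.
  have d0 : 0 < e / (`|C| + 1) by rewrite divr_gt0.
  exists (e / (`|C| + 1)) => //= h /=.
  rewrite sub0r normrN => hd hn0.
  rewrite sub0r normrN g0 subr0 addr0 [h *: 1]mulr1.
  rewrite [h^-1 *: _]/(h^-1 * g h) normrM normfV ler_pdivrMl ?normr_gt0//.
  apply: le_trans (hg h) _; rewrite -(real_normK (num_real h)) expr2 mulrCA.
  rewrite ler_wpM2l//; apply: (@le_trans _ _ ((`|C| + 1) * `|h|)).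
    by rewrite ler_wpM2r// (le_trans (ler_norm _))// lerDl.
  by move: hd; rewrite ltr_pdivlMr// mulrC => /ltW.
apply: DeriveDef; first by apply/cvg_ex; exists 0.
by apply: cvg_lim.
Qed.

(** The derivative has the same shape, so all orders follow. At 0 the exponential beats every
    polynomial in 1/t, which gives a quadratic bound and derivative 0. *)
Lemma is_derive_poly_psi p s t : 0 < s ->
  is_derive t 1 (fun t => p.[t^-1] * psi s t)
    ((('X ^+ 2 * (s *: p - p^`())).[t^-1]) * psi s t).
Proof.
move=> s0; have [t0|t0|t0] := ltgtP t 0.
- have -> : psi s t = 0 by rewrite /psi ltNge (ltW t0).
  rewrite mulr0.
  apply: (@near_eq_is_derive _ _ _ (cst 0)).
    near=> u; rewrite /psi /= ltNge ltW ?mulr0//.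
    by near: u; apply: lt_nbhsl.
- have -> : psi s t = expR (- (s * t^-1)) by rewrite /psi t0.
  apply: (@near_eq_is_derive _ _ _ (fun t => p.[t^-1] * expR (- (s * t^-1)))).
    near=> u; rewrite /psi ifT//.
    by near: u; apply: lt_nbhsr.
  have tn : id t != 0 by rewrite gt_eqF.
  have dV : is_derive t 1 (fun y : R => (id y)^-1) (- (t ^- 2) *: 1).
    exact: is_deriveV.
  have d1 : is_derive t 1 ((fun y => p.[y]) \o (fun y : R => (id y)^-1)) (p^`().[t^-1] * (- (t ^- 2) *: 1)).
    exact: (@is_derive1_comp _ (fun y => p.[y]) (fun y : R => (id y)^-1) t _ _ (is_derive_poly p _) dV).
  have d2 : is_derive t 1 (expR \o (fun y : R => - s * (id y)^-1)) (expR (- s * t^-1) * (- s * (- (t ^- 2) *: 1))).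
    apply: is_derive1_comp; apply: is_deriveZ.
  have := is_deriveM d1 d2.
  set D := _ + _; move=> h.
  rewrite (_ : _ * _ = D).
    rewrite (_ : (fun t0 => _) = ((fun y => p.[y]) \o (fun y : R => (id y)^-1)) \*
      (expR \o (fun y : R => - s * (id y)^-1)))//.
    by apply/funext => u /=; rewrite /= mulNr.
  rewrite /D /= !hornerE /= mulNr.
  set E := expR _; set P := p.[_]; set P' := p^`().[_].
  rewrite -![_ *: _]/(_ * _) -exprVn; ring.
- rewrite t0; have -> : psi s 0 = 0 by rewrite /psi ltxx.
  rewrite mulr0.
  have [C hC] := poly_expR_decay ('X ^+ 2 * p) s0.
  apply: (@is_derive0_quadratic _ C) => h; rewrite /psi; case: ifPn => h0.
    have h'0 : 0 <= h^-1 by rewrite invr_ge0 ltW.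
    have hh := hC _ h'0; rewrite hornerM hornerXn normrM normrX (ger0_norm h'0) in hh.
    have h2 : 0 < h ^+ 2 by rewrite exprn_gt0.
    rewrite -ler_pdivrMr//; apply: le_trans hh.
    rewrite normrM (gtr0_norm (expR_gt0 _)) -exprVn.
    by rewrite le_eqVlt; apply/orP; left; apply/eqP; ring.
  rewrite mulr0 normr0 mulr_ge0 ?sqr_ge0//.
  apply: le_trans (hC 0 (lexx _)); rewrite mulr_ge0 ?expR_ge0//.
Unshelve. all: by end_near. Qed.

(* A class of functions closed under differentiation that contains bumps. *)
Inductive psi_algebra : (R -> R) -> Prop :=
| PsiPoly p s of 0 < s : psi_algebra (fun t => p.[t^-1] * psi s t)
| PsiAdd f g of psi_algebra f & psi_algebra g : psi_algebra (f \+ g)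
| PsiMul f g of psi_algebra f & psi_algebra g : psi_algebra (f \* g)
| PsiAffine (a b c : R) f of psi_algebra f : psi_algebra (fun t => c * f (a * t + b)).

Lemma psi_algebra_derive g : psi_algebra g ->
  exists g', psi_algebra g' /\ forall x, is_derive x 1 g (g' x).
Proof.
elim=> [p s s0|f h _ [f' [pf df]] _ [h' [ph dh]]|f h pf0 [f' [pf df]] ph0 [h' [ph dh]]
  |a b c f _ [f' [pf df]]].
- exists (fun t => ('X ^+ 2 * (s *: p - p^`())).[t^-1] * psi s t); split; first exact: PsiPoly.
  by move=> x; apply: is_derive_poly_psi.
- exists (f' \+ h'); split; first exact: PsiAdd.
  by move=> x; apply: is_deriveD.
- exists ((f \* h') \+ (h \* f')); split; first by apply: PsiAdd; apply: PsiMul.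
  by move=> x; apply: is_deriveM.
- exists (fun t => (c * a) * f' (a * t + b)); split; first exact: PsiAffine.
  move=> x.
  have da : is_derive x 1 (fun t : R => a * t + b) a.
    have d1 : is_derive x 1 ((a \*: id) + cst b) (a *: 1 + 0).
      by apply: is_deriveD.
    by rewrite addr0 [_ *: 1]mulr1 in d1.
  have d2 := @is_derive1_comp _ f (fun t : R => a * t + b) x _ _ (df _) da.
  have := @is_deriveZ _ _ _ _ c x 1 _ d2.
  by rewrite [_ *: _]mulrA mulrAC.
Qed.

Lemma psi_algebra_smooth g : psi_algebra g -> smooth g.
Proof.
move=> pg.
have /choice[D hD] h : exists h', psi_algebra h -> psi_algebra h' /\
    forall x, is_derive x 1 h (h' x).
  have [/psi_algebra_derive[h' hh']|nh] := pselect (psi_algebra h); first by exists h'.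
  by exists h => /nh.
have pD n : psi_algebra (iter n D g).
  by elim: n => [//|n IH]; rewrite iterS; case: (hD _ IH).
have [] := @smooth_seq (fun n => iter n D g) => // n x.
by rewrite iterS; case: (hD _ (pD n)).
Qed.

(** The same [s] shrinks the support into (c, d) and flattens the profile: as it tends to 0, the
    bumps tend to the indicator function of (c, d). *)
Definition bump (c d s x : R) : R := psi s (x - (c + s)) * psi s (d - s - x).

Lemma bump_smooth c d s : 0 < s -> smooth (bump c d s).
Proof.
move=> s0; have p0 : psi_algebra (psi s).
  have := PsiPoly 1 s0; rewrite (_ : (fun t => _) = psi s)//.
  by apply/funext => t; rewrite hornerC mul1r.
have := psi_algebra_smooth
  (PsiMul (PsiAffine 1 (- (c + s)) 1 p0) (PsiAffine (-1) (d - s) 1 p0)).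
congr smooth; apply/funext => x /=; rewrite /bump !mul1r mulN1r.
by rewrite [- x + _]addrC.
Qed.

Lemma psi_ge0 s t : 0 <= psi s t.
Proof. by rewrite /psi; case: ifP => // _; apply: expR_ge0. Qed.

Lemma psi_le1 s t : 0 < s -> psi s t <= 1.
Proof.
move=> s0; rewrite /psi; case: ifP => // t0; rewrite expR_le1 oppr_le0.
by rewrite mulr_ge0 ?invr_ge0 ?ltW.
Qed.

Lemma psi_eq0 s t : t <= 0 -> psi s t = 0.
Proof. by move=> t0; rewrite /psi ltNge t0. Qed.

Lemma bump_bounds c d s x : 0 < s -> 0 <= bump c d s x <= 1.
Proof.
move=> s0; rewrite /bump mulr_ge0 ?psi_ge0//= -[leRHS]mul1r.
by rewrite ler_pM ?psi_ge0 ?psi_le1.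
Qed.

Lemma bump_eq0 c d s x : ~~ (c + s < x < d - s) -> bump c d s x = 0.
Proof.
rewrite negb_and -!leNgt => /orP[h|h]; rewrite /bump.
  by rewrite psi_eq0 ?mul0r// subr_le0.
by rewrite [psi s (d - s - x)]psi_eq0 ?mulr0// subr_le0.
Qed.

Lemma psi_cvg1 t : 0 < t -> psi n.+1%:R^-1 (t - n.+1%:R^-1) @[n --> \oo] --> (1 : R).
Proof.
move=> t0; have cs : n.+1%:R^-1 @[n --> \oo] --> (0 : R) by exact: cvg_harmonic.
have ct : t - n.+1%:R^-1 @[n --> \oo] --> t.
  by rewrite -[in X in _ --> X](subr0 t); apply: cvgB => //; exact: cvg_cst.
have ce : - (n.+1%:R^-1 * (t - n.+1%:R^-1)^-1) @[n --> \oo] --> (- (0 * t^-1) : R).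
  by apply: cvgN; apply: cvgM => //; apply: cvgV => //; rewrite gt_eqF.
rewrite mul0r oppr0 in ce.
have cx : expR (- (n.+1%:R^-1 * (t - n.+1%:R^-1)^-1)) @[n --> \oo] --> (1 : R).
  rewrite -[in X in _ --> X]expR0.
  apply: (@cvg_comp _ _ _ _ (@expR R) _ (nbhs (0 : R)) _ ce).
  exact: continuous_expR.
apply: cvg_trans cx; apply: near_eq_cvg.
have : \forall n \near \oo, 0 < t - n.+1%:R^-1.
  by exact: (@cvgr_gt _ _ _ _ _ _ ct _ t0).
by apply: filterS => n tn; rewrite /psi tn.
Qed.

Lemma bump_cvg1 c d x : c < x < d -> bump c d n.+1%:R^-1 x @[n --> \oo] --> (1 : R).
Proof.
move=> /andP[cx xd].
have h1 : 0 < x - c by rewrite subr_gt0.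
have h2 : 0 < d - x by rewrite subr_gt0.
have H : psi n.+1%:R^-1 (x - c - n.+1%:R^-1) * psi n.+1%:R^-1 (d - x - n.+1%:R^-1)
    @[n --> \oo] --> (1 * 1 : R).
  by apply: cvgM; apply: psi_cvg1.
rewrite mulr1 in H; apply: cvg_trans H; apply: near_eq_cvg; apply: nearW => n.
by rewrite /bump opprD addrA [d - _ - x]addrAC.
Qed.

End SmoothFunctions.

(** * Test functions and integration by parts *)

Section TestFunctions.
Variable R : realType.
Notation mu := (@lebesgue_measure R).
Implicit Types (f g h phi : R -> R) (L x : R).

Lemma prim_dominated L (h_ : nat -> R -> R) h G :
  (forall n, measurable_fun `[0, L] (h_ n)) -> measurable_fun `[0, L] h ->
  (forall x, 0 <= x <= L -> h_ n x @[n --> \oo] --> h x) ->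
  (forall n x, 0 <= x <= L -> `|h_ n x| <= G x) -> itg L G ->
  prim (h_ n) L @[n --> \oo] --> prim h L.
Proof.
move=> mh_ mh cv bd iG.
have m1 n : measurable_fun `[0, L] (EFin \o h_ n) by apply/measurable_EFinP.
have m2 : measurable_fun `[0, L] (EFin \o h) by apply/measurable_EFinP.
have c1 : {ae mu, forall x, `[0, L]%classic x -> (EFin \o h_ n) x @[n --> \oo] --> (EFin \o h) x}.
  apply: aeW => x /=; rewrite in_itv /= => xL; apply: cvg_EFin; first exact: nearW.
  exact: cv.
have b1 : {ae mu, forall x n, `[0, L]%classic x -> (`|(EFin \o h_ n) x| <= (EFin \o G) x)%E}.
  by apply: aeW => x n /=; rewrite in_itv /= => xL; rewrite lee_fin bd.
have [ih _ cv'] := @dominated_convergence _ _ _ mu `[0, L]%classic (measurable_itv _) _ _ _ m1 m2 c1 iG b1.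
have fin : (\int[mu]_(x in `[0%R, L]) (EFin \o h) x)%E = (prim h L)%:E.
  by rewrite /prim /Rintegral fineK//; exact: integrable_fin_num.
by move: cv'; rewrite fin => /fine_cvgP[_].
Qed.

Lemma oo_prim L h : itg L h -> \int[mu]_(x in `]0, L[) h x = prim h L.
Proof.
move=> ih.
have i1 : mu.-integrable `]0, L[ (EFin \o h).
  by apply: integrableS ih => //; apply: subset_itv_oo_cc.
have i2 : mu.-integrable `]0, L] (EFin \o h).
  by apply: integrableS ih => //; apply: subset_itv_oc_cc.
by rewrite (Rintegral_itv_bndo_bndc i1) (Rintegral_itv_obnd_cbnd i2).
Qed.

Lemma ac_derivable L g g' : (forall x, is_derive x 1 g (g' x)) -> continuous g' -> ac L g g'.
Proof.
move=> dg cg'; split.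
  apply: continuous_compact_integrable; first exact: segment_compact.
  exact: continuous_subspaceT.
have cg : continuous g.
  by move=> x; apply/differentiable_continuous/derivable1_diffP; case: (dg x).
move=> x /andP[]; rewrite le_eqVlt => /orP[/eqP <- _|x0 xL]; first by rewrite prim0 addr0.
have := @continuous_FTC2 R g' g 0 x x0 _ _ _.
rewrite /prim /Rintegral => ->.
- by rewrite /= addrCA subrr addr0.
- exact: continuous_subspaceT.
- split; first by move=> y _; case: (dg y).
    exact/cvg_at_right_filter/cg.
  exact/cvg_at_left_filter/cg.
- by move=> y _; rewrite derive1E; case: (dg y).
Qed.

Lemma smooth_ac L phi n : smooth phi -> ac L (phi^`(n)%classic) (phi^`(n.+1)%classic).
Proof.
move=> sp; apply: ac_derivable => [x|x]; first exact: smooth_is_derive.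
by apply/differentiable_continuous/derivable1_diffP; exact: sp.
Qed.

Lemma test_function_eq0 L phi n x : test_function L phi -> ~~ (0 < x < L) ->
  phi^`(n)%classic x = 0.
Proof.
move=> [_ _ sub] xL; pose O := ~` closure [set x | phi x != 0].
have oO : open O by apply: closed_openC; exact: closed_closure.
have : O x by move=> /sub /=; rewrite in_itv /= (negbTE xL).
elim: n x {xL} => [|n IH] x Ox.
  apply/eqP; apply: contrapT => h; apply: Ox; apply: subset_closure => /=; exact/negP.
rewrite derive1nS derive1E -(@derive_cst R R R 0 x 1).
apply: near_eq_derive; have := open_nbhs_nbhs (conj oO Ox).
by apply: filterS => y /IH.
Qed.

Lemma weak_deriv_tower L (U : nat -> R -> R) (N i : nat) : 0 < L ->
  (forall j, (j < N)%N -> ac L (U j) (U j.+1)) -> (i <= N)%N ->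
  weak_deriv L i (U 0) (U i).
Proof.
move=> L0 hU iN phi tphi; have [sp _ _] := tphi.
have p0 n : phi^`(n)%classic 0 = 0 by apply: (test_function_eq0 n tphi); rewrite ltxx.
have pL n : phi^`(n)%classic L = 0 by apply: (test_function_eq0 n tphi); rewrite ltxx andbF.
have bp n : bm L (phi^`(n)%classic) := ac_bm (smooth_ac L n sp).
case: i iN => [|i] iN; first by rewrite expr0 mul1r.
have iU j : (j <= N)%N -> itg L (U j).
  rewrite leq_eqVlt => /orP[/eqP ->|/hU/ac_bm/bm_itg//].
  by case: N hU iN => // N hU _; case: (hU N (leqnn _)).
have iUp j n : (j <= N)%N -> itg L (fun x => U j x * phi^`(n)%classic x).
  by move=> jN; apply: itgM_bm (iU j jN) (bp n).
rewrite !oo_prim; last 2 first.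
- exact: (iUp i.+1 0%N iN).
- exact: iUp.
suff H : forall j, (j <= i.+1)%N -> prim (fun x => U 0 x * phi^`(i.+1)%classic x) L =
    (-1) ^+ j * prim (fun x => U j x * phi^`(i.+1 - j)%classic x) L.
  by rewrite (H i.+1 (leqnn _)) subnn.
elim=> [|j IH] ji; first by rewrite expr0 mul1r subn0.
rewrite IH ?(ltnW ji)//.
have e : (i.+1 - j = (i.+1 - j.+1).+1)%N by rewrite subSS subSn.
have := prim_ibp L0 (hU j (leq_trans ji iN)) (smooth_ac L (i.+1 - j.+1) sp).
by rewrite p0 pL !mulr0 subrr sub0r -e => ->; rewrite exprS mulrN mulN1r mulNr.
Qed.

End TestFunctions.

(** * Square integrability and norms on (0, L) in terms of [sqn] *)

Section L2Conversion.
Variable R : realType.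
Notation mu := (@lebesgue_measure R).
Implicit Types (f g h phi : R -> R) (L x : R).

Lemma itv_oo_cc_integral L h : (forall x, 0 <= h x) -> measurable_fun `[0, L] h ->
  (\int[mu]_(x in `]0%R, L[) (h x)%:E)%E = (\int[mu]_(x in `[0%R, L]) (h x)%:E)%E.
Proof.
move=> h0 mh.
have m1 : measurable_fun `]0, L[ (EFin \o h).
  by apply/measurable_EFinP; apply: measurable_funS mh => //; apply: subset_itv_oo_cc.
have m2 : measurable_fun `]0, L] (EFin \o h).
  by apply/measurable_EFinP; apply: measurable_funS mh => //; apply: subset_itv_oc_cc.
by rewrite (integral_itv_bndo_bndc m1) (integral_itv_obnd_cbnd m2).
Qed.

Lemma Lnorm2E L f :
  Lnorm mu 2%:E (EFin \o (f \_ `]0, L[)) =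
  ((\int[mu]_(x in `]0%R, L[) (f x ^+ 2)%:E) `^ 2^-1)%E.
Proof.
rewrite unlock /=; congr (_ `^ _)%E.
rewrite [RHS]integral_mkcond; apply: eq_integral => x _.
rewrite !patchE; case: ifP => _; last by rewrite /= normr0 powR0// pnatr_eq0.
by rewrite /= powR_mulrn// real_normK ?num_real.
Qed.

Lemma measurable_patch L f : measurable_fun `[0, L] f -> measurable_fun setT (f \_ `]0, L[).
Proof.
move=> mf; apply: (iffLR (measurable_restrictT _ _)) => //.
by apply: measurable_funS mf => //; apply: subset_itv_oo_cc.
Qed.

Lemma L2_integral L g : L2 L g ->
  (\int[mu]_(x in `]0%R, L[) (g x ^+ 2)%:E)%E = (sqn L g)%:E.
Proof.
move=> [mg ig]; rewrite itv_oo_cc_integral; last exact: measurable_funX.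
  by rewrite /sqn /prim /Rintegral fineK//; exact: integrable_fin_num.
by move=> x; apply: sqr_ge0.
Qed.

Lemma L2_in_L2 L g : L2 L g -> in_L2 L g.
Proof.
move=> hg; rewrite /in_L2; apply/andP; split.
  by rewrite inE; apply: measurable_patch; case: hg.
rewrite inE /= /finite_norm Lnorm2E L2_integral// poweR_EFin; exact: ltry.
Qed.

Lemma L2normE L g : L2 L g -> L2norm L g = Num.sqrt (sqn L g).
Proof.
move=> hg; rewrite /L2norm Lnorm2E L2_integral// poweR_EFin /=.
by rewrite powR12_sqrt// sqn_ge0.
Qed.

Lemma in_L2_patch L f : in_L2 L f -> L2 L (f \_ `]0, L[).
Proof.
rewrite /in_L2 => /andP[]; rewrite inE => mf; rewrite inE /= /finite_norm Lnorm2E => fin.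
have mf' : measurable_fun `[0, L] (f \_ `]0, L[) by apply: measurable_funTS.
split=> //; apply/integrableP; split; first exact/measurable_EFinP/measurable_funX.
under eq_integral do rewrite /= ger0_norm ?sqr_ge0//.
rewrite -itv_oo_cc_integral; [|by move=> x; apply: sqr_ge0|exact: measurable_funX].
under eq_integral => x xL do rewrite patchE xL.
move: fin; set J := (\int[mu]_(x in _) _)%E => fin.
rewrite ltey; apply/eqP => Jy; move: fin; rewrite Jy poweRyr// ?invr_eq0 ?pnatr_eq0//.
Qed.

Lemma patch_id L f : (f \_ `]0, L[) \_ `]0, L[ = f \_ `]0, L[.
Proof. by apply/funext => x; rewrite [LHS]patchE; case: ifPn => xL //; rewrite patchE (negbTE xL). Qed.

Lemma L2norm_patch L f : L2norm L (f \_ `]0, L[) = L2norm L f.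
Proof. by rewrite /L2norm patch_id. Qed.

Lemma ae_eq_sqn L f g : L2 L f -> L2 L g ->
  {ae mu, forall x, x \in `]0, L[ -> f x = g x} -> sqn L f = sqn L g.
Proof.
move=> hf hg fg; apply: EFin_inj; rewrite -!L2_integral//.
apply: ae_eq_integral => //.
- by apply/measurable_EFinP/measurable_funX; case: hf => mf _;
    apply: measurable_funS mf => //; apply: subset_itv_oo_cc.
- by apply/measurable_EFinP/measurable_funX; case: hg => mf _;
    apply: measurable_funS mf => //; apply: subset_itv_oo_cc.
move: fg; apply: filterS; first exact: (ae_filter_ringOfSetsType mu).
by move=> x h /= xL; rewrite h// inE.
Qed.

End L2Conversion.

(** * Fundamental lemma of the calculus of variations; uniqueness of weak derivatives *)

Section FundamentalLemma.
Variable R : realType.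
Notation mu := (@lebesgue_measure R).
Implicit Types (f g h phi : R -> R) (L x : R).

Lemma smooth_test_function L c d phi : 0 < c -> d < L -> smooth phi ->
  (forall x, ~~ (c <= x <= d) -> phi x = 0) -> test_function L phi.
Proof.
move=> c0 dL sphi p0.
have sub : closure [set x | phi x != 0] `<=` `[c, d].
  rewrite [X in _ `<=` X](iffLR (closure_id _)); last exact: itv_closed.
  apply: closureS => x /= px; rewrite in_itv /=; apply: contraNT px => /p0 ->.
  by rewrite eqxx.
split=> //.
  apply: subclosed_compact sub; [exact: closed_closure|exact: segment_compact].
move=> x /sub /=; rewrite !in_itv /= => /andP[h1 h2].
by rewrite (lt_le_trans c0 h1) (le_lt_trans h2 dL).
Qed.

(** Test functions with an explicit interval around the support, easier to follow through sums and
    primitives than the compactness of a closure. *)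
Definition compact_smooth L phi : Prop :=
  smooth phi /\ exists c d, [/\ 0 < c, d < L & forall x, ~~ (c <= x <= d) -> phi x = 0].

Lemma compact_smooth_test_function L phi : compact_smooth L phi -> test_function L phi.
Proof. by move=> [sp [c [d [c0 dL p0]]]]; exact: smooth_test_function c0 dL sp p0. Qed.

Lemma bump_compact_smooth L c d s : 0 <= c -> d <= L -> 0 < s ->
  compact_smooth L (bump c d s).
Proof.
move=> c0 dL s0; split; first exact: bump_smooth.
exists (c + s), (d - s); split.
- by rewrite ltr_wpDl.
- by rewrite ltrBlDr (le_lt_trans dL)// ltrDl.
move=> x h; apply: bump_eq0; apply: contraNN h => /andP[h1 h2].
by rewrite (ltW h1) (ltW h2).
Qed.

Lemma prim_indic L g c d : itg L g -> 0 <= c -> c <= d -> d <= L ->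
  prim (fun x => g x * \1_`]c, d[ x) L = prim g d - prim g c.
Proof.
move=> ig c0 cd dL; rewrite (prim_split ig)//.
have sub : `]c, d] `<=` `[0, L].
  move=> x /=; rewrite !in_itv /= => /andP[h1 h2].
  by rewrite (le_trans c0 (ltW h1)) (le_trans h2 dL).
have sub' : `]c, d[ `<=` `[0, L] by move=> x h; apply/sub/subset_itv_oo_oc.
have i1 : mu.-integrable `]c, d[ (EFin \o g) by apply: integrableS ig.
rewrite -(Rintegral_itv_bndo_bndc i1).
transitivity (\int[mu]_(x in `[0, L] `&` `]c, d[) g x).
  rewrite Rintegral_mkcondr /prim; congr Rintegral.
  by apply/funext => x; rewrite patchE indicE; case: ifP; rewrite ?mulr1 ?mulr0.
by congr (Rintegral _ _ _); rewrite setIC setIidl.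
Qed.

Lemma bump_bm L c d s : 0 < s -> bm L (bump c d s).
Proof. by move=> s0; apply: ac_bm (smooth_ac L 0 _); exact: bump_smooth. Qed.

Lemma bump_cvg_indic c d x : bump c d n.+1%:R^-1 x @[n --> \oo] --> (\1_`]c, d[ x : R).
Proof.
rewrite indicE mem_setE in_itv /=; have [h|h] := boolP (c < x < d).
  exact: bump_cvg1.
rewrite (_ : (fun n => _) = (fun=> 0)); first exact: cvg_cst.
apply/funext => n; apply: bump_eq0; apply: contraNN h => /andP[h1 h2].
have s0 : 0 < n.+1%:R^-1 :> R by rewrite invr_gt0.
by rewrite (lt_trans _ h1) ?(lt_trans h2)// ?ltrDl// ltrBlDr ltrDl.
Qed.

Lemma prim_bump_cvg L g c d : itg L g -> 0 <= c -> c <= d -> d <= L ->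
  prim (fun x => g x * bump c d n.+1%:R^-1 x) L @[n --> \oo] --> prim g d - prim g c.
Proof.
move=> ig c0 cd dL; rewrite -(prim_indic ig c0 cd dL).
have s0 n : 0 < n.+1%:R^-1 :> R by rewrite invr_gt0.
apply: (@prim_dominated _ _ _ _ (fun x => `|g x|)).
- by move=> n; exact: itg_measurable (itgM_bm ig (bump_bm L c d (s0 n))).
- by apply: measurable_funM; [exact: itg_measurable|exact: measurable_indic].
- by move=> x _; apply: cvgM; [exact: cvg_cst|exact: bump_cvg_indic].
- move=> n x _; rewrite normrM; have /andP[b0 b1] := bump_bounds c d x (s0 n).
  by rewrite (ger0_norm b0) ler_piMr.
- exact: itg_norm.
Qed.

(** Testing with bumps that tend to the indicator function of (c, d) shows that the primitive of [g]
    agrees at [c] and [d]. It is constant inside (0, L), and by Lebesgue's differentiation theorem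
    its derivative is [g] almost everywhere. *)
Lemma ae_eq0_of_test L g : itg L g ->
  (forall phi, test_function L phi -> prim (fun x => g x * phi x) L = 0) ->
  {ae mu, forall x, x \in `]0, L[ -> g x = 0}.
Proof.
move=> ig hg.
have s0 n : 0 < n.+1%:R^-1 :> R by rewrite invr_gt0.
have pcst c d : 0 < c -> c <= d -> d < L -> prim g c = prim g d.
  move=> c0 cd dL; apply/esym/eqP; rewrite -subr_eq0; apply/eqP.
  have h := prim_bump_cvg ig (ltW c0) cd (ltW dL).
  have h' : prim (fun x => g x * bump c d n.+1%:R^-1 x) L @[n --> \oo] --> (0 : R).
    rewrite (_ : (fun n => _) = (fun=> 0)); first exact: cvg_cst.
    by apply/funext => n; apply/hg/compact_smooth_test_function/bump_compact_smooth => //; apply: ltW.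
  exact: cvg_unique h h'.
pose h := g \_ `[0, L].
have ih := iffLR (itgT L g) ig.
have lh : locally_integrable [set: R] h by apply: integrable_locally_restrict.
have ihy y : mu.-integrable `[0, y] (EFin \o h) by apply: integrableS ih.
have := FTC1 ihy lh.
apply: filterS; first exact: (ae_filter_ringOfSetsType mu).
move=> x hx; rewrite in_itv /= => /andP[x0 xL].
have [_] := hx x0.
have -> : h x = g x by rewrite /h patchE mem_setE in_itv /= (ltW x0) (ltW xL).
move=> <-; rewrite derive1E.
transitivity ('D_1 (cst (prim g x) : R -> R) x); last exact: derive_cst.
apply: near_eq_derive; near=> y.
have y0 : 0 < y by near: y; apply: lt_nbhsr.
have yL : y < L by near: y; apply: lt_nbhsl.
transitivity (prim g y).
  apply: eq_Rintegral => t; rewrite mem_setE in_itv /= => /andP[t0 ty].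
  by rewrite /h patchE mem_setE in_itv /= t0 (le_trans ty (ltW yL)).
by case: (leP y x) => xy; [apply: pcst|apply/esym/pcst => //; apply: ltW].
Unshelve. all: by end_near. Qed.



Lemma weak_deriv_unique L n u v g : 0 < L -> in_L2 L v -> weak_deriv L n u v ->
  L2 L g -> weak_deriv L n u g ->
  {ae mu, forall x, x \in `]0, L[ -> v x = g x}.
Proof.
move=> L0 v2 wv g2 wg.
have p2 := in_L2_patch v2.
have ip : itg L (v \_ `]0, L[) := L2_itg p2.
have ig : itg L g := L2_itg g2.
have : {ae mu, forall x, x \in `]0, L[ -> (v \_ `]0, L[) x - g x = 0}.
  apply: ae_eq0_of_test.
    by have := itgD ip (itgZ (-1) ig); apply: eq_itg => x _; rewrite mulN1r.
  move=> phi tphi; have [sp _ _] := tphi.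
  have bp : bm L phi := ac_bm (smooth_ac L 0 sp).
  under [X in prim X]eq_fun do rewrite mulrBl.
  have iv := itgM_bm ip bp; have iu := itgM_bm ig bp.
  rewrite (primB iv iu); apply/eqP; rewrite subr_eq0; apply/eqP.
  have := wv _ tphi; rewrite (wg _ tphi) => /(@mulfI _ _ _).
  rewrite signr_eq0 => /(_ isT) e.
  rewrite -(oo_prim iv) -(oo_prim iu) e.
  by apply: eq_Rintegral => x xL; rewrite patchE xL.
apply: filterS; first exact: (ae_filter_ringOfSetsType mu).
move=> x h xL; have /eqP := h xL.
by rewrite patchE mem_setE xL subr_eq0 => /eqP.
Qed.

Section Tower.
Variables (L : R) (N : nat) (U : nat -> R -> R).
Hypotheses (L_gt0 : 0 < L).
Hypothesis acU : forall j, (j < N)%N -> ac L (U j) (U j.+1).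
Hypothesis L2U : forall j, (j <= N)%N -> L2 L (U j).

Lemma tower_wDP i : (i <= N)%N -> in_L2 L (wD L i (U 0%N)) /\ weak_deriv L i (U 0%N) (wD L i (U 0%N)).
Proof.
move=> iN; apply: (@xgetPex _ (cst 0) [set v | in_L2 L v /\ weak_deriv L i (U 0%N) v]).
exists (U i); split; first exact/L2_in_L2/L2U.
exact: weak_deriv_tower acU iN.
Qed.

Lemma tower_in_H : in_H L N (U 0%N).
Proof.
split; first exact/L2_in_L2/L2U.
by move=> i iN; exists (wD L i (U 0%N)); apply: tower_wDP.
Qed.

Lemma tower_wD_ae i : (i <= N)%N -> {ae mu, forall x, x \in `]0, L[ -> wD L i (U 0%N) x = U i x}.
Proof.
move=> iN; have [h1 h2] := tower_wDP iN.
apply: weak_deriv_unique h2 _ _ => //; first exact: L2U.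
exact: weak_deriv_tower acU iN.
Qed.

Lemma tower_L2norm_wD i : (i <= N)%N -> L2norm L (wD L i (U 0%N)) = Num.sqrt (sqn L (U i)).
Proof.
move=> iN; have [h1 h2] := tower_wDP iN; have p2 := in_L2_patch h1.
rewrite -L2norm_patch L2normE//; congr Num.sqrt; apply: ae_eq_sqn => //; first exact: L2U.
have := tower_wD_ae iN.
apply: filterS; first exact: (ae_filter_ringOfSetsType mu).
by move=> x h xL; rewrite patchE mem_setE xL h.
Qed.

Lemma tower_Hnorm : Hnorm L N (U 0%N) = Num.sqrt (\sum_(0 <= i < N.+1) sqn L (U i)).
Proof.
rewrite /Hnorm; congr Num.sqrt; apply: eq_big_nat => i /andP[_ iN].
by rewrite tower_L2norm_wD// sqr_sqrtr// sqn_ge0.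
Qed.

End Tower.

End FundamentalLemma.

(** * Density of test functions and the Gagliardo-Nirenberg inequality *)

Section Density.
Variable R : realType.
Notation mu := (@lebesgue_measure R).
Implicit Types (f g h phi psi : R -> R) (L x c d : R).

Lemma smoothD phi psi : smooth phi -> smooth psi -> smooth (phi \+ psi) /\
  forall n, (phi \+ psi)^`(n)%classic = phi^`(n)%classic \+ psi^`(n)%classic.
Proof.
move=> hp hq.
have [] := @smooth_seq R (fun n => phi^`(n)%classic \+ psi^`(n)%classic) _ => //.
by move=> n x; apply: is_deriveD; apply: smooth_is_derive.
Qed.

Lemma smoothZ c phi : smooth phi -> smooth (c \*: phi) /\
  forall n, (c \*: phi)^`(n)%classic = c \*: phi^`(n)%classic.
Proof.
move=> hp.
have [] := @smooth_seq R (fun n => c \*: phi^`(n)%classic) _ => //.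
by move=> n x; apply: is_deriveZ; apply: smooth_is_derive.
Qed.

Lemma compact_smooth0 L : 0 < L -> compact_smooth L (cst 0).
Proof.
move=> L0; split.
  have [] // := @smooth_seq R (fun n => cst 0) _.
exists (L / 2), (L / 2); split=> //; rewrite ?divr_gt0// ltr_pdivrMr//.
by rewrite ltr_pMr// ltr1n.
Qed.

Lemma compact_smoothD L phi psi : compact_smooth L phi -> compact_smooth L psi ->
  compact_smooth L (phi \+ psi).
Proof.
move=> [sp [c [d [c0 dL hp]]]] [sq [c' [d' [c'0 d'L hq]]]].
split; first by case: (smoothD sp sq).
exists (Num.min c c'), (Num.max d d'); split.
- by rewrite lt_min c0 c'0.
- by rewrite gt_max dL d'L.
move=> x; rewrite ge_min le_max !negb_and !negb_or => h /=.
rewrite hp ?hq ?addr0// negb_and; move: h => /orP[/andP[h1 h2]|/andP[h1 h2]];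
  by rewrite ?h1 ?h2 ?orbT.
Qed.

Lemma compact_smoothZ L c phi : compact_smooth L phi -> compact_smooth L (c \*: phi).
Proof.
move=> [sp [c' [d [c0 dL hp]]]]; split; first by case: (smoothZ c sp).
by exists c', d; split=> // x /hp /= ->; rewrite scaler0.
Qed.

Lemma compact_smooth_sum L (I : Type) (s : seq I) (F : I -> R -> R) : 0 < L ->
  (forall i, compact_smooth L (F i)) -> compact_smooth L (fun x => \sum_(i <- s) F i x).
Proof.
move=> L0 hF; elim: s => [|i s IH].
  rewrite (_ : (fun x => _) = cst 0); first exact: compact_smooth0.
  by apply/funext => x; rewrite big_nil.
rewrite (_ : (fun x => _) = F i \+ (fun x => \sum_(i <- s) F i x)); first exact: compact_smoothD.
by apply/funext => x; rewrite big_cons.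
Qed.

Lemma compact_smooth_bm L phi n : compact_smooth L phi -> bm L (phi^`(n)%classic).
Proof. by move=> [sp _]; apply: ac_bm (smooth_ac L n sp). Qed.

(** Zero mean is what makes the primitive vanish again to the right of the support. *)
Lemma compact_smooth_prim L psi : 0 < L -> compact_smooth L psi -> prim psi L = 0 ->
  compact_smooth L (prim psi) /\
  forall n, (prim psi)^`(n.+1)%classic = psi^`(n)%classic.
Proof.
move=> L0 [sp [c [d [c0 dL p0]]]] pL.
have ipsi y : itg y psi := bm_itg (ac_bm (smooth_ac y 0 sp)).
have cpsi x : {for x, continuous psi}.
  apply/differentiable_continuous/derivable1_diffP; exact: (sp 0%N).
have lt_c x : x < c -> prim psi x = 0.
  move=> xc; rewrite (@eq_prim _ _ _ (fun=> 0 * 0)).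
    by rewrite primZ ?mul0r//; exact: itg_cst.
  move=> t /andP[_ tx]; rewrite p0 ?mul0r// negb_and -ltNge.
  by rewrite (le_lt_trans tx xc).
have gt_d x : d < x -> 0 <= x -> prim psi x = 0.
  move=> dx x0.
  have aux y z : d < y -> 0 <= y -> y <= z -> prim psi z = prim psi y.
    move=> dy y0 yz; apply/eqP; rewrite -subr_eq0 (prim_split (ipsi z))//.
    apply/eqP; transitivity (\int[mu]_(t in `]y, z]) (0 : R)).
      apply: eq_Rintegral => t; rewrite mem_setE in_itv /= => /andP[yt tz].
      by rewrite p0// negb_and -!ltNge (lt_trans dy yt) orbT.
    by rewrite /Rintegral integral0.
  case: (leP x L) => xL; first by rewrite -(aux x L dx).
  by rewrite (aux L x)// ltW.
have dP x : is_derive x 1 (prim psi) (psi x).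
  have [xc|cx] := ltP x c.
    rewrite p0; last by rewrite negb_and -ltNge xc.
    apply: (@near_eq_is_derive _ _ _ (cst 0)).
    near=> y; rewrite lt_c//.
    by near: y; apply: lt_nbhsl.
  have x0 : 0 < x by apply: lt_le_trans cx.
  have xx : x < x + 1 by rewrite ltrDl.
  have [d1 d2] := @continuous_FTC1 R psi (BLeft 0) x (x + 1) xx (ipsi _) x0 (cpsi x).
  by apply: DeriveDef; [exact: d1|rewrite -derive1E; exact: d2].
have [h1 h2] := @smooth_seq R (fun n => if n is n'.+1 then psi^`(n')%classic else prim psi)
   (fun n x => match n with 0%N => dP x | n'.+1 => smooth_is_derive n' x sp end).
split; last by move=> n; exact: (h2 n.+1).
split=> //; exists c, d; split=> // x; rewrite negb_and -!ltNge => /orP[|dx].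
  exact: lt_c.
have [x0|x0] := leP 0 x; first exact: gt_d.
by apply: lt_c; apply: lt_trans c0.
Unshelve. all: by end_near. Qed.

(* Each antiderivative is made compactly supported by subtracting a multiple of
   [beta]; the multiple tends to 0 since the top derivative has zero mean. *)
Lemma compact_smooth_dense_tower L n (V : nat -> R -> R) : 0 < L ->
  (forall j, (j < n)%N -> [/\ ac L (V j) (V j.+1), V j 0 = 0 & V j L = 0]) ->
  L2 L (V n) ->
  (exists psi : nat -> R -> R, (forall m, compact_smooth L (psi m)) /\
     sqn L (fun x => V n x - psi m x) @[m --> \oo] --> (0 : R)) ->
  exists phi : nat -> R -> R, (forall m, compact_smooth L (phi m)) /\
    forall j, (j <= n)%N ->
     sqn L (fun x => V j x - (phi m)^`(j)%classic x) @[m --> \oo] --> (0 : R).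
Proof.
move=> L0; elim: n V => [|n IH] V hV L2n [psi [tpsi cpsi]].
  by exists psi; split=> // j; rewrite leqn0 => /eqP ->.
have [] := IH (fun j => V j.+1) (fun j jn => hV j.+1 jn) L2n.
  by exists psi.
move=> phi [tphi cphi] {psi tpsi cpsi}.
have L2V j : (j <= n.+1)%N -> L2 L (V j).
  rewrite leq_eqVlt => /orP[/eqP ->//|jn]; apply: bm_L2.
  by case: (hV j jn) => /ac_bm.
have [beta [tbeta I0]] : exists beta, compact_smooth L beta /\ 0 < prim beta L.
  have := prim_bump_cvg (itg_cst L 1) (lexx 0) (ltW L0) (lexx L).
  rewrite prim0 subr0 prim_cst ?(ltW L0)// mul1r => cv.
  have [N _ /(_ N (leqnn N)) /= IN] := @cvgr_gt _ _ _ _ _ _ cv _ L0.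
  exists (bump 0 L N.+1%:R^-1); split; first exact: bump_compact_smooth.
  by rewrite (eq_prim (q := fun x => 1 * bump 0 L N.+1%:R^-1 x))// => t _; rewrite mul1r.
have bbeta k := compact_smooth_bm k tbeta.
have L2p m j : L2 L ((phi m)^`(j)%classic) := bm_L2 (compact_smooth_bm j (tphi m)).
pose c m := - (prim (phi m) L / prim beta L).
pose phi' m := phi m \+ c m \*: beta.
have tphi' m : compact_smooth L (phi' m).
  by apply: compact_smoothD => //; apply: compact_smoothZ.
have phi'0 m : prim (phi' m) L = 0.
  rewrite /phi' primD ?primZ.
  - by rewrite /c mulNr divfK ?subrr// gt_eqF.
  - exact: bm_itg (bbeta 0%N).
  - exact: bm_itg (compact_smooth_bm 0 (tphi m)).
  - exact: itgZ (bm_itg (bbeta 0%N)).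
have phi'E m j : (phi' m)^`(j)%classic = (phi m)^`(j)%classic \+ c m \*: beta^`(j)%classic.
  have [sphi _] := tphi m; have [sb _] := tbeta.
  have [sZ eZ] := smoothZ (c m) sb.
  by have [_ ->] := smoothD sphi sZ; rewrite eZ.
have [ac0 V00 V0L] := hV 0%N (ltn0Sn n).
have V1 : prim (V 1%N) L = 0.
  by have [_ /(_ L)] := ac0; rewrite lexx ltW// V00 V0L add0r => ->.
(* V_1 has zero mean because V_0 vanishes at both ends, so [c m] is the integral of V_1 - phi_m
   divided by that of [beta]. *)
have c2 m : c m ^+ 2 <= L / prim beta L ^+ 2 * sqn L (fun x => V 1%N x - phi m x).
  have h1 : L2 L (fun x => V 1%N x - phi m x).
    by apply: L2B; [apply: L2V|apply: (L2p m 0%N)].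
  have := cauchy_schwarz (bm_L2 (bm_cst L 1)) h1.
  rewrite (@eq_prim _ _ _ (fun x => V 1%N x - phi m x)); last by move=> t _; rewrite mul1r.
  rewrite primB; [|exact: L2_itg (L2V 1%N _)|exact: L2_itg (L2p m 0%N)].
  rewrite V1 sub0r sqrrN /sqn (@eq_prim _ L (fun=> 1 ^+ 2) (fun=> 1)); last by move=> t _; rewrite expr1n.
  rewrite prim_cst ?mul1r; last exact: ltW.
  move=> h; rewrite /c sqrrN expr_div_n [leRHS]mulrAC ler_wpM2r//.
  by rewrite invr_ge0 sqr_ge0.
have cc : c m ^+ 2 @[m --> \oo] --> (0 : R).
  apply: (@squeeze_cvgr _ _ _ _ (cst 0)
    (fun m => L / prim beta L ^+ 2 * sqn L (fun x => V 1%N x - phi m x))).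
  - by apply: nearW => m; rewrite sqr_ge0 c2.
  - exact: cvg_cst.
  - rewrite -[X in _ --> X](mulr0 (L / prim beta L ^+ 2)).
    by apply: cvgM; [exact: cvg_cst|exact: (cphi 0%N)].
have cphi' j : (j <= n)%N ->
    sqn L (fun x => V j.+1 x - (phi' m)^`(j)%classic x) @[m --> \oo] --> (0 : R).
  move=> jn.
  apply: (@squeeze_cvgr _ _ _ _ (cst 0)
    (fun m => 2 * sqn L (fun x => V j.+1 x - (phi m)^`(j)%classic x) +
              2 * (c m ^+ 2 * sqn L (beta^`(j)%classic)))).
  - apply: nearW => m; rewrite sqn_ge0 /= phi'E.
    have i1 : L2 L (fun x => V j.+1 x - (phi m)^`(j)%classic x).
      by apply: L2B => //; apply: L2V.
    have i2 : L2 L (fun x => c m * beta^`(j)%classic x) by apply/L2Z/bm_L2.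
    have [_ i1'] := i1; have [_ i2'] := i2.
    have e2 : c m ^+ 2 * sqn L (beta^`(j)%classic) = sqn L (fun x => c m * beta^`(j)%classic x).
      rewrite /sqn -primZ; last by case: (bm_L2 (bbeta j)).
      by apply: eq_prim => t _; rewrite exprMn.
    rewrite e2 /sqn -!primZ// -primD; [|exact: itgZ..].
    apply: le_prim.
    + by case: (L2B (L2V j.+1 jn) (bm_L2 (compact_smooth_bm j (tphi' m)))); rewrite phi'E.
    + by apply: itgD; apply: itgZ.
    move=> t _ /=; rewrite -[_ *: _]/(_ * _) -subr_ge0.
    set u := V _ _; set v := _^`(j)%classic t; set w := c m * _.
    by rewrite (_ : _ - _ = (u - v + w) ^+ 2) ?sqr_ge0//; ring.
  - exact: cvg_cst.
  - rewrite -[X in _ --> X](_ : 2 * 0 + 2 * (0 * sqn L (beta^`(j)%classic)) = 0); last by rewrite mul0r !mulr0 addr0.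
    apply: cvgD; apply: cvgM; try exact: cvg_cst; first exact: cphi.
    by apply: cvgM => //; exact: cvg_cst.
have hP m := compact_smooth_prim L0 (tphi' m) (phi'0 m).
exists (fun m => prim (phi' m)); split; first by move=> m; case: (hP m).
case=> [_|j jn]; last first.
  rewrite (_ : (fun m => _) = fun m => sqn L (fun x => V j.+1 x - (phi' m)^`(j)%classic x)).
    exact: cphi'.
  by apply/funext => m; case: (hP m) => _ ->.
(* Order 0: both functions vanish at 0, so the square of their difference is at most [L] times the
   squared norm of the difference of the derivatives. *)
apply: (@squeeze_cvgr _ _ _ _ (cst 0)
  (fun m => L ^+ 2 * sqn L (fun x => V 1%N x - phi' m x))).
- apply: nearW => m; rewrite sqn_ge0 /=.
  have [[i1 hV0] iphi] := (ac0, bm_itg (compact_smooth_bm 0 (tphi' m))).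
  set S := sqn L (fun x => V 1%N x - _).
  have L2d : L2 L (fun x => V 1%N x - phi' m x).
    by apply: L2B; [exact: L2V|exact: bm_L2 (compact_smooth_bm 0 (tphi' m))].
  have S0 : 0 <= S := sqn_ge0 _ _.
  have bd x : 0 <= x <= L -> (V 0%N x - prim (phi' m) x) ^+ 2 <= L * S.
    move=> xL; have [x0 xL'] := andP xL; rewrite hV0// V00 add0r.
    rewrite -primB; [|exact: itg_le i1|exact: itg_le iphi].
    have := cauchy_schwarz_norm (bm_L2 (bm_cst L 1)) L2d.
    rewrite (@eq_prim _ _ _ (fun x => `|V 1%N x - phi' m x|)); last by move=> t _; rewrite mul1r.
    rewrite [sqn L (fun=> 1)](@eq_prim _ L _ (fun=> 1)); last by move=> t _; rewrite expr1n.
    rewrite prim_cst ?mul1r ?(ltW L0)//; apply: le_trans.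
    rewrite -real_normK ?num_real// ler_sqr ?nnegrE//; last by apply: prim_ge0.
    have id := L2_itg L2d.
    apply: le_trans (le_norm_prim (itg_le xL' id)) _.
    by apply: (prim_le (itg_norm id)).
  have := @le_prim _ L (fun x => (V 0%N x - prim (phi' m) x) ^+ 2) (fun=> L * S) _ _ bd.
  rewrite prim_cst ?(ltW L0)// [_ * L]mulrAC -expr2 => -> //; last exact: itg_cst.
  have [tP _] := hP m.
  by case: (L2B (L2V 0%N isT) (bm_L2 (compact_smooth_bm 0 tP))).
- exact: cvg_cst.
- rewrite -[X in _ --> X](mulr0 (L ^+ 2)).
  by apply: cvgM; [exact: cvg_cst|exact: (cphi' 0%N)].
Qed.

Lemma cell_decomposition (h x : R) N : 0 < h -> 0 < x -> x < N%:R * h ->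
  (forall i : nat, x != i%:R * h) -> exists2 j, (j < N)%N & j%:R * h < x < j.+1%:R * h.
Proof.
move=> h0 x0; elim: N => [|N IH] xN xi; first by move: xN; rewrite mul0r ltNge (ltW x0).
have [/IH[//|j jN jx]|Nx] := ltP x (N%:R * h); first by exists j => //; apply: ltnW.
by exists N => //; rewrite xN lt_neqAle Nx eq_sym xi.
Qed.

Lemma prim_countable L (F : set R) : countable F -> prim \1_F L = 0.
Proof.
move=> cF; have mF : measurable F by apply: countable_measurable => // t; exact: measurable_set1.
rewrite /prim /Rintegral integral_indic//.
set S := F `&` _; suff e : mu S = 0%E by exact: (congr1 fine e).
apply: (@subset_measure0 _ _ _ mu _ F) => //.
- exact: measurableI.
- by move=> x [].
exact: countable_lebesgue_measure0.
Qed.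

(** Two limits in turn. On each cell of a mesh, [g] is replaced by its left node value times a bump;
    the bumps tend to the indicator functions of the cells by dominated convergence, and then the
    mesh tends to 0. *)
Lemma lipschitz_bump_approx L g K : 0 < L -> bm L g -> 0 <= K ->
  (forall x y, 0 <= x <= L -> 0 <= y <= L -> `|g y - g x| <= K * `|y - x|) ->
  exists psi : nat -> R -> R, (forall m, compact_smooth L (psi m)) /\
     sqn L (fun x => g x - psi m x) @[m --> \oo] --> (0 : R).
Proof.
move=> L0 bg K0 lg; have [mg [M gM]] := bg.
have M0 : 0 <= M.
  have z : 0 <= (0 : R) <= L by rewrite lexx ltW.
  exact: le_trans (normr_ge0 _) (gM 0 z).
suff H N : exists psi, compact_smooth L psi /\
    sqn L (fun x => g x - psi x) <= L * (K * (L / N.+1%:R)) ^+ 2 + N.+1%:R^-1.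
  have /choice[psi hpsi] := H; exists psi; split; first by move=> m; case: (hpsi m).
  apply: (@squeeze_cvgr _ _ _ _ (cst 0)
    (fun N => L * (K * (L / N.+1%:R)) ^+ 2 + N.+1%:R^-1)).
  - by apply: nearW => N; case: (hpsi N) => _ ->; rewrite sqn_ge0.
  - exact: cvg_cst.
  have ch : n.+1%:R^-1 @[n --> \oo] --> (0 : R) by exact: cvg_harmonic.
  rewrite -[X in _ --> X](_ : L * (K * (L * 0)) ^+ 2 + 0 = 0); last by rewrite !mulr0 expr0n mulr0 addr0.
  apply: cvgD => //; apply: cvgM; first exact: cvg_cst.
  have h : K * (L / n.+1%:R) @[n --> \oo] --> (K * (L * 0) : R).
    by apply: cvgM; [exact: cvg_cst|apply: cvgM => //; exact: cvg_cst].
  exact: (cvgM h h).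
pose h := L / N.+1%:R.
have h0 : 0 < h by rewrite divr_gt0.
have Kh0 : 0 <= K * h := mulr_ge0 K0 (ltW h0).
have Nh : N.+1%:R * h = L by rewrite mulrC divfK// pnatr_eq0.
have xiL i : (i <= N.+1)%N -> 0 <= i%:R * h <= L.
  by move=> iN; rewrite mulr_ge0 ?(ltW h0)//= -Nh ler_wpM2r ?(ltW h0)// ler_nat.
pose psi n x := \sum_(i < N.+1) g (i%:R * h) * bump (i%:R * h) (i.+1%:R * h) n.+1%:R^-1 x.
pose G x := \sum_(i < N.+1) g (i%:R * h) * \1_`]i%:R * h, i.+1%:R * h[ x.
have s0 n : 0 < n.+1%:R^-1 :> R by rewrite invr_gt0.
have tpsi n : compact_smooth L (psi n).
  apply: (compact_smooth_sum (index_enum 'I_N.+1)) => // i; apply: compact_smoothZ.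
  have /andP[x0 _] := xiL i (ltnW (ltn_ord i)); have /andP[_ x1] := xiL i.+1 (ltn_ord i).
  exact: bump_compact_smooth.
pose B := \sum_(i < N.+1) M.
have leB (F : 'I_N.+1 -> R) : (forall i, 0 <= F i <= 1) ->
    `|\sum_(i < N.+1) g (i%:R * h) * F i| <= B.
  move=> hF; apply: le_trans (ler_norm_sum _ _ _) _; apply: ler_sum => i _.
  have /andP[F0 F1] := hF i; rewrite normrM (ger0_norm F0) -[leRHS]mulr1.
  by apply: ler_pM => //; apply/gM/xiL/ltnW.
have indic01 (A : set R) x : 0 <= (\1_A x : R) <= 1.
  by rewrite indicE; case: (_ \in _); rewrite /= ?lexx ler01.
have bG : bm L G.
  apply: bm_sum => i _; apply: bmZ; split; first exact: measurable_indic.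
  by exists 1 => x _; have /andP[a b] := indic01 `]i%:R * h, i.+1%:R * h[%classic x; rewrite ger0_norm.
have cvp : sqn L (fun x => g x - psi n x) @[n --> \oo] --> sqn L (fun x => g x - G x).
  apply: (@prim_dominated _ _ _ _ (fun=> (M + B) ^+ 2)).
  - move=> n; apply: measurable_funX.
    by have [] := bmB bg (compact_smooth_bm 0 (tpsi n)).
  - by apply: measurable_funX; have [] := bmB bg bG.
  - move=> x _; have c1 : g x - psi n x @[n --> \oo] --> g x - G x.
      apply: cvgB; first exact: cvg_cst.
      apply: (cvg_big (op := +%R)) => [|i _]; first exact: add_continuous.
      apply: cvgM; [exact: cvg_cst|exact: bump_cvg_indic].
    by rewrite expr2; under eq_fun do rewrite expr2; apply: cvgM.
  - move=> n x xL; rewrite ger0_norm ?sqr_ge0// -real_normK ?num_real//.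
    rewrite ler_sqr ?nnegrE ?normr_ge0//; last by rewrite addr_ge0// sumr_ge0.
    apply: le_trans (ler_normB _ _) _; apply: lerD; first exact: gM.
    by apply: leB => i; apply: bump_bounds.
  - exact: itg_cst.
have Gle : sqn L (fun x => g x - G x) <= L * (K * h) ^+ 2.
  (* The nodes, where the open cells make [G] vanish; they form a countable, hence negligible,
     set. *)
  pose F := range (fun i : nat => i%:R * h).
  have cF : countable F by exact: sub_countable (card_image_le _ _) (countableP _).
  have mF : measurable F by apply: countable_measurable => // t; exact: measurable_set1.
  have bF : bm L \1_F.
    split; first exact: measurable_indic.
    by exists 1 => x _; have /andP[a b] := indic01 F x; rewrite ger0_norm.
  apply: (@le_trans _ _ (prim (fun x => (K * h) ^+ 2 + (M + B) ^+ 2 * \1_F x) L)); last first.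
    rewrite (primD (itg_cst _ _) (itgZ _ (bm_itg bF))) (primZ _ (bm_itg bF)).
    by rewrite prim_countable// mulr0 addr0 prim_cst ?(ltW L0)// [leRHS]mulrC.
  apply: le_prim.
  - by case: (bm_L2 (bmB bg bG)).
  - by apply: itgD; [exact: itg_cst|exact: itgZ (bm_itg bF)].
  move=> x xL; rewrite indicE; have [xF|xF] := boolP (x \in F).
    rewrite mulr1; apply: ler_wpDl; first exact: sqr_ge0.
    rewrite -real_normK ?num_real// ler_sqr ?nnegrE ?normr_ge0//; last by rewrite addr_ge0// sumr_ge0.
    by apply: le_trans (ler_normB _ _) _; apply: lerD; [exact: gM|apply: leB].
  rewrite mulr0 addr0; have xn i : x != i%:R * h.
    apply: contraNneq xF => ->; rewrite inE; by exists i.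
  have [x0 x1] := andP xL.
  have [||j jN /andP[jx xj]] := @cell_decomposition h x N.+1 h0 _ _ xn.
  - by rewrite lt_neqAle x0 andbT eq_sym; have := xn 0%N; rewrite mul0r.
  - by rewrite Nh lt_neqAle x1 andbT -Nh.
  have -> : G x = g (j%:R * h).
    rewrite /G (bigD1 (Ordinal jN))//= indicE mem_setE in_itv /= jx xj mulr1 big1 ?addr0// => i ij.
    rewrite indicE mem_setE in_itv /=.
    have [/andP[ix xi]|_] := boolP (i%:R * h < x < i.+1%:R * h); last by rewrite mulr0.
    have h1 : (i < j.+1)%N by rewrite -(ltr_nat R) -(ltr_pM2r h0) (lt_trans ix).
    have h2 : (j < i.+1)%N by rewrite -(ltr_nat R) -(ltr_pM2r h0) (lt_trans jx).
    move: ij; rewrite -val_eqE /= => /eqP[]; apply/eqP.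
    by rewrite eqn_leq -ltnS h1 -ltnS h2.
  rewrite -real_normK ?num_real// ler_sqr ?nnegrE ?normr_ge0//.
  apply: le_trans (lg _ _ (xiL j (ltnW jN)) xL) _; rewrite ler_wpM2l//.
  rewrite ger0_norm ?subr_ge0 ?(ltW jx)// lerBlDr.
  by move: (ltW xj); rewrite -natr1 mulrDl mul1r addrC.
have lt : sqn L (fun x => g x - G x) < L * (K * h) ^+ 2 + N.+1%:R^-1.
  by apply: le_lt_trans Gle _; rewrite ltrDl.
have [n _ /(_ n (leqnn n)) /= hn] := @cvgr_lt _ _ _ _ _ _ cvp _ lt.
by exists (psi n); split=> //; apply: ltW.
Qed.

End Density.

(** * The Gagliardo-Nirenberg inequality for chains of primitives *)

Section GagliardoNirenberg.
Variable R : realType.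
Notation mu := (@lebesgue_measure R).
Implicit Types (f g h phi psi : R -> R) (L x c d : R).

Section FixedTower.
Variables (L : R) (l : nat) (U : nat -> R -> R).
Hypotheses (L_gt0 : 0 < L) (l_gt0 : (0 < l)%N) (tU : tower L l U).

Lemma tower_ac i : (i < l)%N -> ac L (U i) (U i.+1).
Proof. by move=> il; have [h _ _] := tU; apply: h; apply: leq_trans (ltnW il) _; rewrite leq_pmull. Qed.

Lemma tower_L2 i : (i <= l)%N -> L2 L (U i).
Proof.
by move=> il; apply/bm_L2/(tower_bm tU); apply: leq_trans il _; rewrite leq_pmull.
Qed.

(** Since l + 1 <= 2l, D^l u is Lipschitz and hence approximable by sums of bumps;
    [compact_smooth_dense_tower] then integrates the approximations [l] times. *)
Lemma tower_in_H0 : in_H0 L l (U 0).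
Proof.
split; first exact: tower_in_H L_gt0 tower_ac tower_L2.
move=> e e0; have [hac hU0 hUL] := tU.
have l2 : (l.+1 <= 2 * l)%N by rewrite mul2n -addnn -addn1 leq_add2l.
have [phi [tphi cphi]] : exists phi : nat -> R -> R, (forall m, compact_smooth L (phi m)) /\
    forall j, (j <= l)%N ->
     sqn L (fun x => U j x - (phi m)^`(j)%classic x) @[m --> \oo] --> (0 : R).
  apply: compact_smooth_dense_tower => //.
  - by move=> j jl; split; [exact: tower_ac|exact: hU0|exact/hUL/ltnW].
  - exact: tower_L2.
  have [_ [K hK]] := tower_bm tU l2.
  have K0 : 0 <= K.
    have z : 0 <= (0 : R) <= L by rewrite lexx ltW.
    exact: le_trans (normr_ge0 _) (hK 0 z).
  apply: (lipschitz_bump_approx L_gt0 (tower_bm tU (ltnW l2)) K0) => x y xL yL.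
  by apply: (ac_lip _ hK xL yL); apply: hac; apply: ltnW.
have cvs : Num.sqrt (\sum_(0 <= i < l.+1) sqn L (fun x => U i x - (phi m)^`(i)%classic x))
    @[m --> \oo] --> (0 : R).
  have c0 : \sum_(i < l.+1) sqn L (fun x => U i x - (phi m)^`(i)%classic x)
      @[m --> \oo] --> (\sum_(i < l.+1) 0 : R).
    apply: (cvg_big (op := +%R)) => [|i _]; first exact: add_continuous.
    by apply: cphi; rewrite -ltnS.
  rewrite -[X in _ --> X]sqrtr0; under eq_fun do rewrite big_mkord.
  rewrite big1_eq in c0; apply: (@cvg_comp _ _ _ _ (@Num.sqrt R) _ _ _ c0).
  exact: sqrt_continuous.
have [n _ /(_ n (leqnn n)) /= hn] := @cvgr_lt _ _ _ _ _ _ cvs _ e0.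
exists (phi n); split; first exact: compact_smooth_test_function.
have [sp _] := tphi n.
have acV j : (j < l)%N -> ac L (U j \- (phi n)^`(j)%classic) (U j.+1 \- (phi n)^`(j.+1)%classic).
  by move=> jl; apply: acB; [exact: tower_ac|exact: smooth_ac].
have L2V j : (j <= l)%N -> L2 L (U j \- (phi n)^`(j)%classic).
  by move=> jl; apply: L2B; [exact: tower_L2|exact: bm_L2 (compact_smooth_bm j (tphi n))].
by rewrite (tower_Hnorm L_gt0 acV L2V).
Qed.

Lemma ae_exists_itv (P : R -> Prop) c d :
  {ae mu, forall x, x \in `]0, L[ -> P x} -> 0 <= c -> c < d -> d <= L ->
  exists2 y, c < y < d & P y.
Proof.
move=> [N [mN N0 sN]] c0 cd dL; apply: contrapT => hn.
have sub : `]c, d[%classic `<=` N.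
  move=> x /= xcd; apply: sN => /= hP; apply: hn.
  move: (xcd); rewrite in_itv /= => /andP[cx xd].
  exists x; first by rewrite cx xd.
  by apply: hP; rewrite in_itv /= (le_lt_trans c0 cx) (lt_le_trans xd dL).
have : mu `]c, d[%classic = 0%E by apply: (@subset_measure0 _ _ _ mu _ N).
rewrite lebesgue_measure_itv /= lte_fin cd => /eqP.
by rewrite -EFinB eqe subr_eq0 gt_eqF.
Qed.

Lemma supnorm_ae f B : (supnorm L f <= B%:E)%E ->
  {ae mu, forall x, x \in `]0, L[ -> `|f x| <= B}.
Proof.
(* The norm of exponent +oo is an essential supremum when the line has positive measure, which is
   checked first. *)
rewrite /supnorm unlock /=; case: ifP => [_|]; last first.
  have : (0 < mu `]0%R, L[)%E by rewrite lebesgue_measure_itv /= lte_fin L_gt0 -EFinB lte_fin subr0.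
  move=> h /negP[]; apply: lt_le_trans h _; apply: le_measure; rewrite ?inE//.
move=> /ess_supP; apply: (@filterS _ _ (ae_filter_ringOfSetsType mu)).
by move=> x /=; rewrite patchE lee_fin => h xL; move: h; rewrite mem_setE xL.
Qed.

(** Points where the bound holds lie arbitrarily close to [x], and u is Lipschitz. *)
Lemma tower_le_of_ae B : {ae mu, forall x, x \in `]0, L[ -> `|U 0 x| <= B} ->
  forall x, 0 <= x <= L -> `|U 0 x| <= B.
Proof.
move=> hB x xL; have [hac _ _] := tU; have [x0 x1] := andP xL.
have l2 : (1 <= 2 * l)%N by rewrite muln_gt0 l_gt0.
have [_ [K hK]] := tower_bm tU l2.
have K0 : 0 <= K by exact: le_trans (normr_ge0 _) (hK x xL).
apply/ler_addgt0Pr => e e0.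
have K1 : 0 < K + 1 by rewrite ltr_wpDl.
have d0 : 0 < e / (K + 1) by rewrite divr_gt0.
have [y /andP[y0 yL] [hy yd]] : exists2 y, 0 < y < L & `|U 0 y| <= B /\ `|x - y| <= e / (K + 1).
  have cd : Num.max 0 (x - e / (K + 1)) < Num.min L (x + e / (K + 1)).
    have L0 := L_gt0; rewrite lt_min !gt_max L_gt0 /=.
    by move: d0; set d := e / _ => d0; apply/andP; split; [|apply/andP; split]; lra.
  have [||y] := ae_exists_itv hB _ cd _; first by rewrite le_max lexx.
    by rewrite ge_min lexx.
  rewrite gt_max lt_min => /andP[/andP[y0 xy] /andP[yL yx]] hy.
  exists y; first by rewrite y0.
  split=> //; rewrite ler_norml; clear -xy yx.
  by move: xy yx; set d := e / _ => xy yx; apply/andP; split; lra.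
have yL' : 0 <= y <= L by rewrite !ltW.
rewrite -(subrK (U 0 y) (U 0 x)) addrC.
apply: le_trans (ler_normD _ _) _; apply: lerD => //.
apply: le_trans (ac_lip (hac 0%N (leq0n _)) hK yL' xL) _.
apply: (@le_trans _ _ (K * (e / (K + 1)))); first by rewrite ler_wpM2l.
by rewrite mulrA ler_pdivrMr// mulrDr mulr1 mulrC lerDl ltW.
Qed.

End FixedTower.

Lemma GN_power_identity (A B Cs : R) l : (0 < l)%N -> 0 <= A -> 0 <= B ->
  (Cs * Num.sqrt A `^ ((2 * l)%:R^-1) * Num.sqrt B `^ (1 - (2 * l)%:R^-1)) ^+ (4 * l) =
  Cs ^+ (4 * l) * (A * B ^+ (2 * l).-1).
Proof.
move=> l0 A0 B0.
have l2 : (2 * l)%:R != 0 :> R by rewrite pnatr_eq0 muln_eq0 -lt0n l0.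
have e4 : (4 * l)%:R = (2 * l)%:R * 2 :> R by rewrite -natrM mulnAC.
have e2 : (2 * l)%:R = (2 * l).-1%:R + 1 :> R by rewrite natr1 prednK// muln_gt0.
rewrite !exprMn mulrA; congr (_ * _ * _).
  rewrite -powR_mulrn ?powR_ge0// -powRrM e4 mulrA mulVf// mul1r.
  by rewrite powR_mulrn ?sqrtr_ge0// sqr_sqrtr.
rewrite -[LHS]powR_mulrn ?powR_ge0// -powRrM.
rewrite (_ : _ * _ = (2 * (2 * l).-1)%:R); last first.
  rewrite mulrBl mul1r e4 mulrA mulVf// mul1r [RHS]natrM e2; ring.
by rewrite powR_mulrn ?sqrtr_ge0// exprM sqr_sqrtr.
Qed.

Lemma GN_tower_GN L l Cs : 0 < L -> (0 < l)%N -> 0 < Cs -> GN_constant L l Cs ->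
  tower_GN L l (Cs ^+ (4 * l)).
Proof.
move=> L0 l0 Cs0 hGN U tU x xL.
have := hGN _ (tower_in_H0 L0 l0 tU).
have hac := tower_ac tU; have hL2 := tower_L2 tU.
rewrite (tower_L2norm_wD L0 hac hL2 (leqnn l)) (L2normE (hL2 0%N (leq0n l))).
move=> /(supnorm_ae L0)/(tower_le_of_ae L0 l0 tU)/(_ _ xL) h.
rewrite -GN_power_identity ?sqn_ge0//.
have -> : U 0 x ^+ (4 * l) = `|U 0 x| ^+ (4 * l).
  have -> : (4 * l = 2 * (2 * l))%N by rewrite mulnA.
  by rewrite !(exprM _ 2) real_normK ?num_real.
by rewrite lerXn2r ?nnegrE// (le_trans _ h).
Qed.

End GagliardoNirenberg.

(** * Regular solutions *)

Section RegularSolutions.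
Variable R : realType.
Notation mu := (@lebesgue_measure R).
Implicit Types (f g h u : R -> R) (L x C W : R).

(** Lets the weighted norm serve as the bound [W] of |f|^2 on which all constants are built. *)
Lemma weighted_sq_ge L f : 0 < L -> in_L2 L f -> sqn L (f \_ `]0, L[) <= weighted_sq L f.
Proof.
move=> L0 /in_L2_patch hf; have [_ if2] := hf.
have bw : bm L (fun x => 1 + x) by apply: bmD; [exact: bm_cst|exact: bm_id].
have iw := itgM_bm if2 bw.
have -> : weighted_sq L f = prim (fun x => (f \_ `]0, L[) x ^+ 2 * (1 + x)) L.
  by rewrite -(oo_prim iw); apply: eq_Rintegral => x xL; rewrite patchE xL mulrC.
apply: le_prim => // x /andP[x0 _].
by rewrite -[leLHS]mulr1 ler_wpM2l ?sqr_ge0// lerDl.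
Qed.

Section Assembly.
Variables (L a : R) (l k : nat) (f : R -> R) (C W : R) (U : nat -> R -> R).
Hypotheses (L_gt0 : 0 < L) (C_ge0 : 0 <= C).
Hypothesis solU : tower_solution L a l k C W (f \_ `]0, L[) U.

Lemma solution_ac j : (j < 2 * l + 1)%N -> ac L (U j) (U j.+1).
Proof. by case: solU => [[h _ _] _ _ _ _]; rewrite addn1 ltnS => /h. Qed.

Lemma solution_L2 j : (j <= 2 * l + 1)%N -> L2 L (U j).
Proof.
rewrite leq_eqVlt => /orP[/eqP ->|jl]; first by case: solU.
exact: bm_L2 (ac_bm (solution_ac jl)).
Qed.

Lemma solution_wD_ae j : (j <= 2 * l + 1)%N ->
  {ae mu, forall x, x \in `]0, L[ -> wD L j (U 0) x = U j x}.
Proof. exact: tower_wD_ae L_gt0 solution_ac solution_L2 j. Qed.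

Lemma solution_boundary_value i x y : (i <= l)%N -> U i x = y ->
  boundary_value L (wD L i (U 0)) x y.
Proof.
move=> il Uxy.
have il1 : (i < 2 * l + 1)%N by rewrite addn1 ltnS (leq_trans il)// leq_pmull.
exists (U i); split=> //; first exact: ac_continuous (ltW L_gt0) (solution_ac il1).
have := solution_wD_ae (ltnW il1).
by apply: (@filterS _ _ (ae_filter_ringOfSetsType mu)) => z h /h.
Qed.

Lemma solution_regular : (0 < l)%N -> regular_solution a L l k f (U 0).
Proof.
move=> l0; have [[hac hU0 hUL] eU _ _ _] := solU; split.
- exact: tower_in_H L_gt0 solution_ac solution_L2.
- have : {ae mu, forall x (j : nat), (j <= 2 * l + 1)%N -> x \in `]0, L[ -> wD L j (U 0) x = U j x}.
    apply/ae_foralln => j; case: (leqP j (2 * l + 1)) => jl; last exact: nearW.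
    have := solution_wD_ae jl.
    by apply: (@filterS _ _ (ae_filter_ringOfSetsType mu)) => z h _ /h.
  apply: (@filterS _ _ (ae_filter_ringOfSetsType mu)) => x h xL.
  have [x0 xL'] : 0 < x /\ x < L by apply/andP; move: xL; rewrite in_itv.
  have xL2 : 0 <= x <= L by rewrite !ltW.
  have := eU x xL2; rewrite mul1r patchE mem_setE xL => e.
  rewrite (h 1%N _ xL) ?addn1//.
  rewrite (_ : \sum_(1 <= j < l.+1) _ = \sum_(1 <= j < l.+1) (-1) ^+ (j + 1) * U (2 * j + 1)%N x); last first.
    apply: eq_big_nat => j /andP[_ jl]; rewrite h// leq_add2r leq_pmul2l//.
  rewrite big_nat_recr//= e; ring.
- by move=> i il; apply: solution_boundary_value (ltnW il) (hU0 i il).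
- by move=> i il; apply: solution_boundary_value (ltnW il) (hUL i (ltnW il)).
- exact: solution_boundary_value (leqnn l) (hUL l (leqnn l)).
Qed.

(** Each of the 2l + 2 squared norms is at most C (1 + L) W: up to order 2l by the supremum bound
    and the length [L], at the top order directly. *)
Lemma solution_Hnorm : 0 <= W ->
  Hnorm L (2 * l + 1) (U 0) <= Num.sqrt ((2 * l + 2)%:R * (C * (1 + L))) * Num.sqrt W.
Proof.
move=> W0; have L0 := ltW L_gt0; have [_ _ hU _ hT] := solU.
have CW0 : 0 <= C * W by apply: mulr_ge0.
rewrite (tower_Hnorm L_gt0 solution_ac solution_L2) -sqrtrM; last first.
  by rewrite mulr_ge0// mulr_ge0// addr_ge0.
apply: ler_wsqrtr.
have -> : (2 * l + 2)%:R * (C * (1 + L)) * W = \sum_(0 <= i < (2 * l + 1).+1) C * (1 + L) * W.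
  by rewrite sumr_const_nat subn0 -[RHS]mulr_natl -addnS -[LHS]mulrA.
apply: ler_sum_nat => i /andP[_ il]; rewrite ltnS leq_eqVlt in il.
have e : C * (1 + L) * W = C * W + C * W * L by ring.
rewrite e; case/orP: il => [/eqP ->|il].
  by apply: le_trans hT _; rewrite lerDl mulr_ge0.
apply: (@le_trans _ _ (C * W * L)); last by rewrite lerDr.
rewrite -prim_cst//; apply: le_prim.
- by case: (solution_L2 (ltnW il)).
- exact: itg_cst.
by move=> x; apply: hU; rewrite addn1 ltnS in il.
Qed.

End Assembly.

Lemma regular_case L a l k W : 0 < L -> 0 < a -> (0 < l)%N -> (k < 4 * l)%N ->
  exists C, forall f, in_L2 L f -> weighted_sq L f = W ->
  exists u, regular_solution a L l k f u /\ Hnorm L (2 * l + 1) u <= C * Num.sqrt W.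
Proof.
move=> L0 a0 l0 kl; have [C [C0 hC]] := regular_tower_solution L0 l0 a0 W kl.
exists (Num.sqrt ((2 * l + 2)%:R * (C * (1 + L)))) => f hf fW.
have fle := weighted_sq_ge L0 hf; rewrite fW in fle.
have [U hU] := hC _ (in_L2_patch hf) fle.
exists (U 0%N); split; first exact: solution_regular L0 hU l0.
exact: solution_Hnorm L0 C0 hU (le_trans (sqn_ge0 _ _) fle).
Qed.

Lemma expr_powR_inv (x : R) n : (0 < n)%N -> 0 <= x -> (x `^ (n%:R^-1)) ^+ n = x.
Proof.
move=> n0 x0; rewrite -powR_mulrn ?powR_ge0// -powRrM mulVf ?powRr1//.
by rewrite pnatr_eq0 -lt0n.
Qed.

(** The power 4l of the condition; (2l+1)(4l+2) = 2 (2l+1)^2, and the factor 2 cancels against the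
    denominator. *)
Lemma threshold_power L a Cs l f : (0 < l)%N -> 0 < a -> 0 < Cs -> in_L2 L f ->
  L2norm L f < (((2 * l + 1) * (4 * l + 2))%:R `^ ((4 * l)%:R^-1) * a)
     / (2 `^ ((4 * l)%:R^-1) * Cs) ->
  Cs ^+ (4 * l) * (sqn L (f \_ `]0, L[) / a ^+ 2) ^+ (2 * l) <= (2 * l + 1)%:R ^+ 2.
Proof.
move=> l0 a0 Cs0 hf; rewrite -L2norm_patch (L2normE (in_L2_patch hf)).
set F := sqn _ _; have F0 : 0 <= F := sqn_ge0 _ _.
have n0 : (0 < 4 * l)%N by rewrite muln_gt0.
have p2 : 0 < 2 `^ ((4 * l)%:R^-1) :> R by rewrite powR_gt0.
rewrite ltr_pdivlMr ?mulr_gt0// => /ltW h.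
have : (Num.sqrt F * (2 `^ ((4 * l)%:R^-1) * Cs)) ^+ (4 * l) <=
   (((2 * l + 1) * (4 * l + 2))%:R `^ ((4 * l)%:R^-1) * a) ^+ (4 * l).
  by rewrite lerXn2r ?nnegrE// ?mulr_ge0 ?sqrtr_ge0 ?powR_ge0 ?(ltW a0) ?(ltW Cs0).
move=> h'; rewrite !exprMn !expr_powR_inv// in h'.
have e : (4 * l = 2 * (2 * l))%N by rewrite mulnA.
rewrite {1}e exprM sqr_sqrtr// in h'.
rewrite (_ : ((2 * l + 1) * (4 * l + 2))%:R = 2 * (2 * l + 1)%:R ^+ 2 :> R) in h'; last first.
  have -> : (4 * l + 2 = 2 * (2 * l + 1))%N by rewrite mulnDr mulnA.
  by rewrite !natrM expr2 mulrCA.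
have a2 : 0 < a ^+ (4 * l) by rewrite exprn_gt0.
rewrite expr_div_n -exprM -e mulrA ler_pdivrMr// -(ler_pM2l (ltr0n R 2)).
move: h'; set P := F ^+ _; set Q := Cs ^+ _; set A := a ^+ _; set N := _ ^+ 2.
move=> h'; rewrite [leRHS]mulrA (_ : 2 * (Q * P) = P * (2 * Q)); [exact: h'|ring].
Qed.

Lemma critical_case L a l W : 0 < L -> 0 < a -> (0 < l)%N ->
  exists C, forall Cs f, 0 < Cs -> GN_constant L l Cs -> in_L2 L f ->
  L2norm L f < (((2 * l + 1) * (4 * l + 2))%:R `^ ((4 * l)%:R^-1) * a)
     / (2 `^ ((4 * l)%:R^-1) * Cs) -> weighted_sq L f = W ->
  exists u, regular_solution a L l (4 * l) f u /\ Hnorm L (2 * l + 1) u <= C * Num.sqrt W.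
Proof.
move=> L0 a0 l0.
have [C [C0 hC]] := critical_tower_solution L0 l0 a0 W (erefl (4 * l)%N).
exists (Num.sqrt ((2 * l + 2)%:R * (C * (1 + L)))) => Cs f Cs0 hGN hf hlt fW.
have fle := weighted_sq_ge L0 hf; rewrite fW in fle.
have [U hU] := hC _ _ (exprn_ge0 _ (ltW Cs0)) (GN_tower_GN L0 l0 Cs0 hGN)
  (threshold_power l0 a0 Cs0 hf hlt) (in_L2_patch hf) fle.
exists (U 0%N); split; first exact: solution_regular L0 hU l0.
exact: solution_Hnorm L0 C0 hU (le_trans (sqn_ge0 _ _) fle).
Qed.

End RegularSolutions.

Theorem theorem2p2 (R : realType) :
  (* regular case: C is a function of L, l, k, a and ((1+x), f^2) *)
  (exists C : R -> nat -> nat -> R -> R -> R,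
     forall (a L : R) (l k : nat) (f : R -> R),
       0 < a -> 0 < L -> (1 <= l)%N -> (1 <= k)%N -> (k < 4 * l)%N ->
       in_L2 L f ->
       exists u : R -> R,
         regular_solution a L l k f u /\
         Hnorm L (2 * l + 1) u
           <= C L l k a (weighted_sq L f) * Num.sqrt (weighted_sq L f))
  /\
  (* critical case: C' is a function of L, l, a and ((1+x), f^2) *)
  (exists C' : R -> nat -> R -> R -> R,
     forall (a L Cs : R) (l : nat) (f : R -> R),
       0 < a -> 0 < L -> (1 <= l)%N ->
       0 < Cs -> GN_constant L l Cs ->
       in_L2 L f ->
       L2norm L f <
         (((2 * l + 1) * (4 * l + 2))%:R `^ ((4 * l)%:R^-1) * a)
         / (2 `^ ((4 * l)%:R^-1) * Cs) ->
       exists u : R -> R,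
         regular_solution a L l (4 * l) f u /\
         Hnorm L (2 * l + 1) u
           <= C' L l a (weighted_sq L f) * Num.sqrt (weighted_sq L f)).
Proof.
split.
  (* Choosing over the tuples of parameters, with [W] standing for the value of the weighted norm,
     yields a constant that does not see f otherwise; tuples outside the hypotheses get 0. *)
  have /choice[C hC] : forall p : R * nat * nat * R * R, exists C : R,
      let: (L, l, k, a, W) := p in
      0 < L -> 0 < a -> (0 < l)%N -> (k < 4 * l)%N ->
      forall f, in_L2 L f -> weighted_sq L f = W ->
      exists u, regular_solution a L l k f u /\
        Hnorm L (2 * l + 1) u <= C * Num.sqrt W.
    move=> [[[[L l] k] a] W].
    have [[L0 a0 l0 kl]|nH] := pselect [/\ 0 < L, 0 < a, (0 < l)%N & (k < 4 * l)%N].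
      by have [C hC] := regular_case W L0 a0 l0 kl; exists C.
    by exists 0 => L0 a0 l0 kl; case: nH.
  exists (fun L l k a W => C (L, l, k, a, W)) => a L l k f a0 L0 l0 _ kl hf.
  exact: (hC (L, l, k, a, weighted_sq L f)).
(* [Cs] is not part of the tuple: it is quantified after the constant. *)
have /choice[C hC] : forall p : R * nat * R * R, exists C : R,
    let: (L, l, a, W) := p in
    0 < L -> 0 < a -> (0 < l)%N ->
    forall Cs f, 0 < Cs -> GN_constant L l Cs -> in_L2 L f ->
    L2norm L f < (((2 * l + 1) * (4 * l + 2))%:R `^ ((4 * l)%:R^-1) * a)
       / (2 `^ ((4 * l)%:R^-1) * Cs) -> weighted_sq L f = W ->
    exists u, regular_solution a L l (4 * l) f u /\
      Hnorm L (2 * l + 1) u <= C * Num.sqrt W.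
  move=> [[[L l] a] W].
  have [[L0 a0 l0]|nH] := pselect [/\ 0 < L, 0 < a & (0 < l)%N].
    by have [C hC] := critical_case W L0 a0 l0; exists C.
  by exists 0 => L0 a0 l0; case: nH.
exists (fun L l a W => C (L, l, a, W)) => a L Cs l f a0 L0 l0 Cs0 hGN hf hlt.
exact: (hC (L, l, a, weighted_sq L f) L0 a0 l0 Cs f Cs0 hGN hf hlt erefl).
Qed.
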